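(* Let $\Bbbk$ be an algebraically closed field, let $G$ be a connected affine algebraic group over $\Bbbk$, and let $R$ be an associative $\Bbbk$-algebra with $1$ on which $G$ acts rationally by $\Bbbk$-algebra automorphisms; denote this action by $\rho$. For a given $I\in G\text{-}\operatorname{Spec}R$, let $T_I=\mathcal C(R/I)\otimes_{\Bbbk}\Bbbk(G)$. Then there is a bijection $$c\colon \operatorname{Spec}_I R=\{P\in\operatorname{Spec}R\mid \textstyle\bigcap_{g\in G}g.P=I\}\longrightarrow \operatorname{Spec}^G(T_I)$$ having the following properties, for all $P,P'\in\operatorname{Spec}_IR$ and $g\in G$: (a) ($G$-equivariance) $c(g.P)=(\operatorname{Id}\otimes\rho_\ell(g))(c(P))$; (b) (inclusions) $P\subseteq P'\iff c(P)\subseteq c(P')$; (c) (hearts) there is an isomorphism of $\Bbbk(G)$-fields $\Psi_P\colon \mathcal C(T_I/c(P))\to\mathcal C\big((R/P)\otimes_{\Bbbk}\Bbbk(G)\big)$ (one for each $P \in \operatorname{Spec}_I R$) satisfying $$\Psi_P\circ(\rho\otimes\rho_r)(g)=(\operatorname{Id}_{R/P}\otimes\rho_r)(g)\circ\Psi_P,\qquad \Psi_{g.P}\circ(\operatorname{Id}\otimes\rho_\ell)(g)=(\rho\otimes\rho_\ell)(g)\circ\Psi_P;$$ (d) (rationality) $P$ is rational if and only if $T_I/c(P)\cong\Bbbk(G)$ as $\Bbbk(G)$-algebras.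
   Context: The action of $G$ on $R$ is rational if $R$ is a union of finite-dimensional $G$-stable subspaces $V$ on each of which $G$ acts via a homomorphism of algebraic groups $G\to \operatorname{GL}(V)$. Extended centroid: for a ring $U$, let $\mathcal E$ be the filter of all two-sided ideals $I$ of $U$ with zero left annihilator $\{u\in U\mid uI=0\}$; the (right) Amitsur-Martindale ring of quotients of $U$ is $\varinjlim_{I\in\mathcal E}\operatorname{Hom}(I_U,U_U)$, and the extended centroid $\mathcal C(U)$ is its center. Ring automorphisms (and isomorphisms) of $U$ extend uniquely to the ring of quotients and hence act on $\mathcal C(U)$. If $U$ is prime, $\mathcal C(U)$ is a field; if $U$ is a commutative domain, $\mathcal C(U)$ is its field of fractions. $\operatorname{Spec}R$ is the set of prime ideals of $R$. A prime $P$ of $R$ is rational if $\mathcal C(R/P)=\Bbbk$. A proper $G$-stable ideal $I$ of $R$ is $G$-prime if $AB\subseteq I$ for $G$-stable ideals $A,B$ of $R$ implies $A\subseteq I$ or $B\subseteq I$; $G\text{-}\operatorname{Spec}R$ is the set of all $G$-prime ideals of $R$. For $G$ connected, every $G$-prime $I$ is a prime ideal of $R$, so $\mathcal C(R/I)$ is a field. $\Bbbk(G)$ is the field of rational functions on $G$ (fraction field of $\Bbbk[G]$). The right and left regular actions $\rho_r,\rho_\ell$ of $G$ on $\Bbbk[G]$ are $(\rho_r(x)f)(y)=f(yx)$ and $(\rho_\ell(x)f)(y)=f(x^{-1}y)$; they extend uniquely to $\Bbbk(G)$. The action of $G$ on $R$ induces an action on $R/I$ and hence on $\mathcal C(R/I)$,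 again denoted $\rho$. $G$ acts on $T_I$ via $\rho\otimes\rho_r$ and via $\operatorname{Id}\otimes\rho_\ell$, and these two actions commute. $\operatorname{Spec}^G(T_I)$ is the set of prime ideals of $T_I$ that are stable under $(\rho\otimes\rho_r)(G)$; $G$ acts on it through $\operatorname{Id}\otimes\rho_\ell$. For $P\in\operatorname{Spec}_IR$, the algebra $(R/P)\otimes_{\Bbbk}\Bbbk(G)$ is prime. In (c), the maps written $(\rho\otimes\rho_r)(g)$ on $\mathcal C(T_I/c(P))$, $(\operatorname{Id}_{R/P}\otimes\rho_r)(g)$ on $\mathcal C((R/P)\otimes\Bbbk(G))$, $(\operatorname{Id}\otimes\rho_\ell)(g)\colon\mathcal C(T_I/c(P))\to\mathcal C(T_I/c(g.P))$ and $(\rho\otimes\rho_\ell)(g)\colon\mathcal C((R/P)\otimes\Bbbk(G))\to\mathcal C((R/g.P)\otimes\Bbbk(G))$ are the evident induced isomorphisms. A $\Bbbk(G)$-field is a field that is a $\Bbbk(G)$-algebra. *)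

(* Defs.v *)
From HB Require Import structures.
From mathcomp Require Import all_boot all_order all_algebra.
From mathcomp Require Import boolp classical_sets.

Set Implicit Arguments.
Unset Strict Implicit.
Unset Printing Implicit Defensive.

Import GRing.Theory.
Local Open Scope ring_scope.
Local Open Scope quotient_scope.
Local Open Scope classical_set_scope.

Record ring_iso (U V : nzRingType) := RingIso {
  iso_fun :> {rmorphism U -> V};
  iso_inv : V -> U;
  iso_funK : cancel iso_fun iso_inv;
  iso_invK : cancel iso_inv iso_fun }.

Record alg_iso (F : nzRingType) (A B : algType F) := AlgIso {
  alg_ring_iso :> ring_iso A B;
  alg_iso_scalable : scalable alg_ring_iso }.

Section IsoConstructions.

Lemma morphD_zmod (U V : zmodType) (f : U -> V) :
  {morph f : x y / x + y} -> zmod_morphism f.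
Proof. by move=> fD x y; apply: (addIr (f y)); rewrite -fD !subrK. Qed.

Section MkRingIso.
Variables (U V : nzRingType) (f : U -> V) (g : V -> U).
Hypotheses (fD : {morph f : x y / x + y}) (fM : {morph f : x y / x * y}).
Hypotheses (f1 : f 1 = 1) (fK : cancel f g) (gK : cancel g f).

Definition mk_rmorphism : {rmorphism U -> V} :=
  HB.pack f (GRing.isZmodMorphism.Build U V f (morphD_zmod fD))
            (GRing.isMonoidMorphism.Build U V f (f1, fM)).

Definition mk_ring_iso : ring_iso U V := @RingIso U V mk_rmorphism g fK gK.

End MkRingIso.

Definition iso_id (U : nzRingType) : ring_iso U U :=
  @RingIso U U idfun id (fun=> erefl) (fun=> erefl).

Lemma iso_invD (U V : nzRingType) (f : ring_iso U V) :
  {morph iso_inv f : x y / x + y}.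
Proof.
move=> x y; apply: (can_inj (iso_funK f)).
by rewrite rmorphD !iso_invK.
Qed.

Lemma iso_invM (U V : nzRingType) (f : ring_iso U V) :
  {morph iso_inv f : x y / x * y}.
Proof.
move=> x y; apply: (can_inj (iso_funK f)).
by rewrite rmorphM !iso_invK.
Qed.

Lemma iso_inv1 (U V : nzRingType) (f : ring_iso U V) : iso_inv f 1 = 1.
Proof. by rewrite -(rmorph1 f) iso_funK. Qed.

Definition iso_sym (U V : nzRingType) (f : ring_iso U V) : ring_iso V U :=
  mk_ring_iso (iso_invD f) (iso_invM f) (iso_inv1 f) (iso_invK f) (iso_funK f).

Definition alg_iso_id (F : nzRingType) (A : algType F) : alg_iso A A :=
  @AlgIso F A A (iso_id A) (fun _ _ => erefl).

Lemma iso_symE (U V : nzRingType) (f : ring_iso U V) x :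
  iso_sym f x = iso_inv f x.
Proof. by []. Qed.

Lemma alg_iso_sym_scalable (F : nzRingType) (A B : algType F)
  (f : alg_iso A B) : scalable (iso_sym f).
Proof.
move=> a x; apply: (can_inj (iso_funK f)).
by rewrite !iso_symE alg_iso_scalable !iso_invK.
Qed.

Definition alg_iso_sym (F : nzRingType) (A B : algType F) (f : alg_iso A B) :
  alg_iso B A := AlgIso (alg_iso_sym_scalable f).

End IsoConstructions.

Section Ideals.
Context {U : nzRingType}.
Implicit Types (A B I P : set U).

Definition is_ideal I : Prop :=
  [/\ I 0, forall x y, I x -> I y -> I (x + y) &
      forall u x, I x -> I (u * x) /\ I (x * u)].

Definition ideal_prod A B : set U :=
  [set x | exists s : seq (U * U),
     (forall p, p \in s -> A p.1 /\ B p.2) /\ x = \sum_(p <- s) p.1 * p.2].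

Definition is_prime P : Prop :=
  [/\ is_ideal P, ~ P 1 &
      forall A B, is_ideal A -> is_ideal B ->
        ideal_prod A B `<=` P -> A `<=` P \/ B `<=` P].

Lemma is_ideal_sum I (T : eqType) (s : seq T) (f : T -> U) :
  is_ideal I -> (forall t, t \in s -> I (f t)) -> I (\sum_(t <- s) f t).
Proof.
case=> I0 ID _; elim: s => [|t s IHs] Is; first by rewrite big_nil.
rewrite big_cons; apply: ID; first by apply: Is; rewrite mem_head.
by apply: IHs => t' t's; apply: Is; rewrite inE t's orbT.
Qed.

Lemma is_idealN I x : is_ideal I -> I x -> I (- x).
Proof. by case=> _ _ IM Ix; rewrite -mulN1r; have [] := IM (-1) _ Ix. Qed.

Lemma is_idealT : is_ideal [set: U].
Proof. by split. Qed.

Lemma is_idealI A B : is_ideal A -> is_ideal B -> is_ideal (A `&` B).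
Proof.
move=> [A0 AD AM] [B0 BD BM]; split=> // [x y [Ax Bx] [Ay By]|u x [Ax Bx]].
  by split; [apply: AD | apply: BD].
by have [? ?] := AM u x Ax; have [? ?] := BM u x Bx.
Qed.

Lemma is_ideal_prod A B : is_ideal A -> is_ideal B -> is_ideal (ideal_prod A B).
Proof.
move=> [_ _ AM] [_ _ BM]; split.
- by exists [::]; rewrite big_nil.
- move=> _ _ [s [sP ->]] [t [tP ->]]; exists (s ++ t); rewrite big_cat.
  by split=> // p; rewrite mem_cat => /orP[/sP|/tP].
- move=> u _ [s [sP ->]]; split.
    exists [seq (u * p.1, p.2) | p <- s]; split.
      by move=> _ /mapP[p /sP[Ap Bp] ->] /=; split=> //; case: (AM u _ Ap).
    by rewrite big_map mulr_sumr; apply: eq_bigr => p _; rewrite mulrA.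
  exists [seq (p.1, p.2 * u) | p <- s]; split.
    by move=> _ /mapP[p /sP[Ap Bp] ->] /=; split=> //; case: (BM u _ Bp).
  by rewrite big_map mulr_suml; apply: eq_bigr => p _; rewrite mulrA.
Qed.

End Ideals.

Record proper_ideal (U : nzRingType) := ProperIdeal {
  ideal_set :> set U;
  ideal_setP : is_ideal ideal_set;
  ideal_set1 : ~ ideal_set 1 }.

Section Transport.
Context {U V : nzRingType} (f : ring_iso U V).

Lemma image_isoE (A : set U) : f @` A = [set v | A (iso_inv f v)].
Proof.
apply/seteqP; split=> [_ [u Au <-]|v Av] /=; first by rewrite iso_funK.
by exists (iso_inv f v) => //; rewrite iso_invK.
Qed.

Lemma is_ideal_image (A : set U) : is_ideal A -> is_ideal (f @` A).
Proof.
move=> [A0 AD AM]; rewrite image_isoE; split=> /=.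
- by rewrite -(rmorph0 f) iso_funK.
- by move=> x y Ax Ay; rewrite iso_invD; apply: AD.
- by move=> u x Ax; rewrite !iso_invM; apply: AM.
Qed.

Lemma image_proper (P : set U) : ~ P 1 -> ~ (f @` P) 1.
Proof. by rewrite image_isoE /= iso_inv1. Qed.

End Transport.

Lemma is_prime_image (U V : nzRingType) (f : ring_iso U V) (P : set U) :
  is_prime P -> is_prime (f @` P).
Proof.
move=> [Pi P1 PP]; split.
- exact: is_ideal_image.
- exact: image_proper.
move=> A B hA hB AB.
have sub (C : set V) : iso_sym f @` C `<=` P -> C `<=` f @` P.
  by move=> CP v Cv; rewrite image_isoE; apply: CP; exists v.
have [] := PP (iso_sym f @` A) (iso_sym f @` B).
- exact: is_ideal_image.
- exact: is_ideal_image.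
- move=> _ [s [sP ->]].
  have : (f @` P) (\sum_(p <- [seq (f p.1, f p.2) | p <- s]) p.1 * p.2).
    apply: AB; exists [seq (f p.1, f p.2) | p <- s]; split=> //.
    move=> _ /mapP[p /sP[[a Aa <-] [b Bb <-]] ->] /=.
    by rewrite !iso_invK.
  rewrite image_isoE /= big_map.
  have -> : \sum_(p <- s) f p.1 * f p.2 = f (\sum_(p <- s) p.1 * p.2).
    by rewrite rmorph_sum; apply: eq_bigr => p _; rewrite rmorphM.
  by rewrite iso_funK.
- by move/sub; left.
- by move/sub; right.
Qed.

Section QuotientRing.
Context {U : nzRingType} (I : proper_ideal U).

Definition quot_eq (x y : U) : bool := `[< ideal_set I (x - y) >].

Lemma quot_eq_refl : reflexive quot_eq.
Proof. by move=> x; apply/asboolP; rewrite subrr; case: (ideal_setP I). Qed.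

Lemma quot_eq_sym : symmetric quot_eq.
Proof.
have sub x y : ideal_set I (x - y) -> ideal_set I (y - x).
  by move=> /(is_idealN (ideal_setP I)); rewrite opprB.
by move=> x y; apply/asboolP/asboolP => /sub.
Qed.

Lemma quot_eq_trans : transitive quot_eq.
Proof.
move=> y x z /asboolP xy /asboolP yz; apply/asboolP.
have [_ ID _] := ideal_setP I.
by rewrite -(subrK y x) -addrA; apply: ID.
Qed.

Canonical quot_equiv := EquivRel quot_eq quot_eq_refl quot_eq_sym quot_eq_trans.

Definition quot := {eq_quot quot_equiv}.
HB.instance Definition _ := Choice.on quot.

Definition to_quot (x : U) : quot := \pi_{eq_quot quot_equiv} x.

Lemma quotP x y : to_quot x = to_quot y <-> ideal_set I (x - y).
Proof. by split=> [/eqmodP /asboolP|xy] //; apply/eqmodP/asboolP. Qed.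

Lemma quot_ind (P : quot -> Prop) : (forall x, P (to_quot x)) -> forall q, P q.
Proof. by move=> HP q; rewrite -[q]reprK; apply: HP. Qed.

Lemma quot_ex (q : quot) : exists x, q = to_quot x.
Proof. by exists (repr (q : {eq_quot quot_equiv})); rewrite /to_quot reprK. Qed.

Definition quot_repr (q : quot) : U := repr (q : {eq_quot quot_equiv}).

Lemma quot_reprK q : to_quot (quot_repr q) = q.
Proof. exact: reprK. Qed.

Lemma quot_reprP x : ideal_set I (x - quot_repr (to_quot x)).
Proof. by apply/quotP; rewrite quot_reprK. Qed.

Definition quot_add (p q : quot) := to_quot (quot_repr p + quot_repr q).
Definition quot_opp (p : quot) := to_quot (- quot_repr p).
Definition quot_mul (p q : quot) := to_quot (quot_repr p * quot_repr q).

Lemma quot_addE x y : quot_add (to_quot x) (to_quot y) = to_quot (x + y).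
Proof.
apply/esym/quotP; rewrite opprD addrACA.
by case: (ideal_setP I) => _ ID _; apply: ID; apply: quot_reprP.
Qed.

Lemma quot_oppE x : quot_opp (to_quot x) = to_quot (- x).
Proof.
apply/esym/quotP; rewrite -opprD.
exact: (is_idealN (ideal_setP I) (quot_reprP x)).
Qed.

Lemma quot_mulE x y : quot_mul (to_quot x) (to_quot y) = to_quot (x * y).
Proof.
apply/esym/quotP; set x' := quot_repr _; set y' := quot_repr _.
have -> : x * y - x' * y' = x * (y - y') + (x - x') * y'.
  by rewrite mulrBr mulrBl addrA subrK.
have [_ ID IM] := ideal_setP I; apply: ID.
  by have [] := IM x _ (quot_reprP y).
by have [] := IM y' _ (quot_reprP x).
Qed.

Lemma quot_addA : associative quot_add.
Proof.
by do 3 elim/quot_ind => ?; rewrite !quot_addE addrA.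
Qed.

Lemma quot_addC : commutative quot_add.
Proof. by do 2 elim/quot_ind => ?; rewrite !quot_addE addrC. Qed.

Lemma quot_add0 : left_id (to_quot 0) quot_add.
Proof. by elim/quot_ind => ?; rewrite !quot_addE add0r. Qed.

Lemma quot_addN : left_inverse (to_quot 0) quot_opp quot_add.
Proof. by elim/quot_ind => ?; rewrite quot_oppE !quot_addE addNr. Qed.

HB.instance Definition _ :=
  GRing.isZmodule.Build quot quot_addA quot_addC quot_add0 quot_addN.

Lemma quot_mulA : associative quot_mul.
Proof. by do 3 elim/quot_ind => ?; rewrite !quot_mulE mulrA. Qed.

Lemma quot_mul1 : left_id (to_quot 1) quot_mul.
Proof. by elim/quot_ind => ?; rewrite !quot_mulE mul1r. Qed.

Lemma quot_mulr1 : right_id (to_quot 1) quot_mul.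
Proof. by elim/quot_ind => ?; rewrite !quot_mulE mulr1. Qed.

Lemma quot_mulDl : left_distributive quot_mul +%R.
Proof.
by do 3 elim/quot_ind => ?; rewrite /+%R /= ?(quot_mulE, quot_addE) mulrDl.
Qed.

Lemma quot_mulDr : right_distributive quot_mul +%R.
Proof.
by do 3 elim/quot_ind => ?; rewrite /+%R /= ?(quot_mulE, quot_addE) mulrDr.
Qed.

Lemma quot_one_neq0 : to_quot 1 != 0.
Proof.
apply/eqP => /quotP; rewrite subr0.
exact: ideal_set1.
Qed.

HB.instance Definition _ := GRing.Zmodule_isNzRing.Build quot
  quot_mulA quot_mul1 quot_mulr1 quot_mulDl quot_mulDr quot_one_neq0.

Lemma to_quotD : {morph to_quot : x y / x + y}.
Proof. by move=> x y; rewrite -quot_addE. Qed.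

Lemma to_quotM : {morph to_quot : x y / x * y}.
Proof. by move=> x y; rewrite -quot_mulE. Qed.

HB.instance Definition _ :=
  GRing.isZmodMorphism.Build U quot to_quot (morphD_zmod to_quotD).
HB.instance Definition _ :=
  GRing.isMonoidMorphism.Build U quot to_quot (erefl, to_quotM).

End QuotientRing.

Section QuotientAlgebra.
Context {F : nzRingType} {A : algType F} (I : proper_ideal A).

Definition quot_scale (a : F) (q : quot I) : quot I :=
  to_quot I (a *: quot_repr q).

Lemma quot_scaleE a x : quot_scale a (to_quot I x) = to_quot I (a *: x).
Proof.
apply/esym/quotP; rewrite -scalerBr -mulr_algl.
by have [_ _ IM] := ideal_setP I; have [] := IM a%:A _ (quot_reprP I x).
Qed.

Lemma quot_scaleA a b q : quot_scale a (quot_scale b q) = quot_scale (a * b) q.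
Proof. by have [x ->] := quot_ex q; rewrite !quot_scaleE scalerA. Qed.

Lemma quot_scale1 : left_id 1 quot_scale.
Proof. by move=> qx; have [x ->] := quot_ex qx; rewrite !quot_scaleE scale1r. Qed.

Lemma quot_scaleDr : right_distributive quot_scale +%R.
Proof.
move=> a; move=> qx; have [x ->] := quot_ex qx; move=> qy; have [y ->] := quot_ex qy.
by rewrite -to_quotD !quot_scaleE scalerDr to_quotD.
Qed.

Lemma quot_scaleDl q : {morph quot_scale^~ q : a b / a + b}.
Proof.
by move=> a b /=; have [x ->] := quot_ex q; rewrite !quot_scaleE scalerDl to_quotD.
Qed.

HB.instance Definition _ := GRing.Zmodule_isLmodule.Build F (quot I)
  quot_scaleA quot_scale1 quot_scaleDr quot_scaleDl.

Lemma to_quotZ a x : to_quot I (a *: x) = a *: to_quot I x.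
Proof. by rewrite -quot_scaleE. Qed.

Lemma quot_scaleAl a (p q : quot I) : a *: (p * q) = (a *: p) * q.
Proof.
have [x ->] := quot_ex p; have [y ->] := quot_ex q.
by rewrite -to_quotM -!to_quotZ -to_quotM scalerAl.
Qed.

HB.instance Definition _ :=
  GRing.Lmodule_isLalgebra.Build F (quot I) quot_scaleAl.

Lemma quot_scaleAr a (p q : quot I) : a *: (p * q) = p * (a *: q).
Proof.
have [x ->] := quot_ex p; have [y ->] := quot_ex q.
by rewrite -to_quotM -!to_quotZ -to_quotM scalerAr.
Qed.

HB.instance Definition _ :=
  GRing.Lalgebra_isAlgebra.Build F (quot I) quot_scaleAr.

End QuotientAlgebra.

Section QuotientMap.
Context {U V : nzRingType} (f : ring_iso U V).
Context (I : proper_ideal U) (J : proper_ideal V) (fIJ : f @` I = J :> set V).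

Definition quot_fun (q : quot I) : quot J := to_quot J (f (quot_repr q)).

Lemma quot_mapP x : ideal_set I x -> ideal_set J (f x).
Proof. by move=> Ix; rewrite -fIJ; exists x. Qed.

Lemma quot_funE x : quot_fun (to_quot I x) = to_quot J (f x).
Proof. by apply/esym/quotP; rewrite -rmorphB; apply/quot_mapP/quot_reprP. Qed.

Lemma quot_funD : {morph quot_fun : x y / x + y}.
Proof.
move=> qx; have [x ->] := quot_ex qx; move=> qy; have [y ->] := quot_ex qy.
by rewrite -to_quotD !quot_funE rmorphD to_quotD.
Qed.

Lemma quot_funM : {morph quot_fun : x y / x * y}.
Proof.
move=> qx; have [x ->] := quot_ex qx; move=> qy; have [y ->] := quot_ex qy.
by rewrite -to_quotM !quot_funE rmorphM to_quotM.
Qed.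

Lemma quot_fun1 : quot_fun 1 = 1.
Proof. by rewrite quot_funE rmorph1. Qed.

End QuotientMap.
Arguments quot_fun {U V} f I J q.

Section QuotientIso.
Context {U V : nzRingType} (f : ring_iso U V).
Context {I : proper_ideal U} {J : proper_ideal V} (fIJ : f @` I = J :> set V).

Lemma iso_sym_image : iso_sym f @` J = I :> set U.
Proof.
rewrite image_isoE -fIJ; apply/seteqP; split=> [x /= [y Iy /(can_inj (iso_funK f)) <-]|x Ix] //.
by exists x.
Qed.

Lemma quot_funK : cancel (quot_fun f I J) (quot_fun (iso_sym f) J I).
Proof.
move=> qx; have [x ->] := quot_ex qx.
by rewrite quot_funE // quot_funE ?iso_symE ?iso_funK //; apply: iso_sym_image.
Qed.

Lemma quot_invK : cancel (quot_fun (iso_sym f) J I) (quot_fun f I J).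
Proof.
move=> qx; have [x ->] := quot_ex qx.
rewrite quot_funE; last exact: iso_sym_image.
by rewrite quot_funE // iso_symE iso_invK.
Qed.

Definition quot_iso : ring_iso (quot I) (quot J) :=
  mk_ring_iso (quot_funD fIJ) (quot_funM fIJ) (quot_fun1 fIJ)
    quot_funK quot_invK.

End QuotientIso.

Section QuotientAlgIso.
Context {F : nzRingType} {A B : algType F} (f : alg_iso A B).
Context {I : proper_ideal A} {J : proper_ideal B} (fIJ : f @` I = J :> set B).

Lemma quot_iso_scalable : scalable (quot_iso fIJ).
Proof.
move=> a; move=> qx; have [x ->] := quot_ex qx; rewrite -to_quotZ.
by rewrite [LHS]quot_funE // [in RHS]/= quot_funE // alg_iso_scalable to_quotZ.
Qed.

Definition quot_alg_iso : alg_iso (quot I) (quot J) := AlgIso quot_iso_scalable.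

End QuotientAlgIso.

Section AmitsurMartindale.
Context {U : nzRingType}.
Implicit Types (I J : set U).

Definition in_filter I : Prop :=
  is_ideal I /\ forall u, (forall x, I x -> u * x = 0) -> u = 0.

Lemma in_filterT : in_filter [set: U].
Proof.
by split=> [|u /(_ 1 Logic.I)]; [exact: is_idealT | rewrite mulr1].
Qed.

Lemma ideal_prodMr I J x y : I x -> J y -> ideal_prod I J (x * y).
Proof.
move=> Ix Jy; exists [:: (x, y)]; rewrite big_seq1; split=> // p.
by rewrite inE => /eqP ->.
Qed.

Lemma ideal_prod_subl I J : is_ideal I -> ideal_prod I J `<=` I.
Proof.
move=> hI _ [s [sP ->]]; apply: is_ideal_sum => // p /sP[Ip _].
by have [_ _ IM] := hI; have [] := IM p.2 _ Ip.
Qed.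

Lemma ideal_prod_subr I J : is_ideal J -> ideal_prod I J `<=` J.
Proof.
move=> hJ _ [s [sP ->]]; apply: is_ideal_sum => // p /sP[_ Jp].
by have [_ _ JM] := hJ; have [] := JM p.1 _ Jp.
Qed.

Lemma in_filter_prod I J : in_filter I -> in_filter J ->
  in_filter (ideal_prod I J).
Proof.
move=> [hI I0] [hJ J0]; split=> [|u uIJ]; first exact: is_ideal_prod.
apply: I0 => x Ix; apply: J0 => y Jy; rewrite -mulrA; apply: uIJ.
exact: ideal_prodMr.
Qed.

Lemma in_filterI I J : in_filter I -> in_filter J -> in_filter (I `&` J).
Proof.
move=> fI fJ; have [hI _] := fI; have [hJ _] := fJ.
split=> [|u uIJ]; first exact: is_idealI.
have [_ IJ0] := in_filter_prod fI fJ.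
apply: IJ0 => x IJx; apply: uIJ; split.
- exact: ideal_prod_subl IJx.
- exact: ideal_prod_subr IJx.
Qed.

(* An element of Hom(I_U, U_U) with I in the filter.  It is encoded by a total
   function whose values off ph_dom = I are irrelevant: parthom_eq identifies
   homomorphisms that agree on a common smaller ideal of the filter. *)
Record parthom := Parthom {
  ph_dom : set U;
  ph_fun :> U -> U;
  ph_domP : in_filter ph_dom;
  ph_funD : forall x y, ph_dom x -> ph_dom y ->
    ph_fun (x + y) = ph_fun x + ph_fun y;
  ph_funM : forall x u, ph_dom x -> ph_fun (x * u) = ph_fun x * u }.

HB.instance Definition _ := gen_eqMixin parthom.
HB.instance Definition _ := gen_choiceMixin parthom.

Definition parthom_eq (f g : parthom) : bool :=
  `[< exists K, [/\ in_filter K, K `<=` ph_dom f `&` ph_dom g &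
                    forall x, K x -> f x = g x] >].

Lemma parthom_eq_refl : reflexive parthom_eq.
Proof.
move=> f; apply/asboolP; exists (ph_dom f); split=> //.
exact: ph_domP.
Qed.

Lemma parthom_eq_sym : symmetric parthom_eq.
Proof.
have sub f g : parthom_eq f g -> parthom_eq g f.
  move=> /asboolP[K [hK sK eK]]; apply/asboolP; exists K; split=> //.
    by rewrite setIC.
  by move=> x /eK.
by move=> f g; apply/idP/idP => /sub.
Qed.

Lemma parthom_eq_trans : transitive parthom_eq.
Proof.
move=> g f h /asboolP[K [hK sK eK]] /asboolP[L [hL sL eL]].
apply/asboolP; exists (K `&` L); split.
- exact: in_filterI.
- by move=> x [/sK[? ?] /sL[? ?]].
- by move=> x [/eK -> /eL ->].
Qed.

Canonical parthom_equiv :=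
  EquivRel parthom_eq parthom_eq_refl parthom_eq_sym parthom_eq_trans.

Definition amring_def := {eq_quot parthom_equiv}.

End AmitsurMartindale.

Arguments parthom U : clear implicits.
Arguments amring_def U : clear implicits.

Definition amring (U : nzRingType) := amring_def U.
HB.instance Definition _ (U : nzRingType) := Choice.on (amring U).

Section AmitsurMartindaleRing.
Context {U : nzRingType}.
Implicit Types (f g h : parthom U) (p q r : amring U).

Definition amclass f : amring U := \pi_{eq_quot (@parthom_equiv U)} f.
Definition amrepr q : parthom U := repr (q : {eq_quot (@parthom_equiv U)}).

Lemma amreprK q : amclass (amrepr q) = q.
Proof. exact: reprK. Qed.

Lemma amring_ex q : exists f, q = amclass f.
Proof. by exists (amrepr q); rewrite amreprK. Qed.

Lemma amclassP f g : amclass f = amclass g <->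
  exists K, [/\ in_filter K, K `<=` ph_dom f `&` ph_dom g &
                forall x, K x -> f x = g x].
Proof. by split=> [/eqmodP /asboolP|fg] //; apply/eqmodP/asboolP. Qed.

Lemma amreprP f : exists K,
  [/\ in_filter K, K `<=` ph_dom f `&` ph_dom (amrepr (amclass f)) &
      forall x, K x -> f x = amrepr (amclass f) x].
Proof. by apply/amclassP; rewrite amreprK. Qed.

Lemma amclass_eq f g : (forall x, ph_dom f x -> ph_dom g x -> f x = g x) ->
  amclass f = amclass g.
Proof.
move=> fg; apply/amclassP; exists (ph_dom f `&` ph_dom g); split=> //.
  by apply: in_filterI; exact: ph_domP.
by move=> x [fx gx]; apply: fg.
Qed.

Definition is_parthom (I : set U) (f : U -> U) : Prop :=
  [/\ in_filter I, forall x y, I x -> I y -> f (x + y) = f x + f y &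
      forall x u, I x -> f (x * u) = f x * u].

Definition mk_parthom (I : set U) (f : U -> U) (If : is_parthom I f) : parthom U :=
  @Parthom U I f (let: And3 H _ _ := If in H) (let: And3 _ H _ := If in H)
    (let: And3 _ _ H := If in H).

Lemma parthom0P : is_parthom [set: U] (fun=> 0).
Proof.
by split=> [|x y _ _|x u _]; [exact: in_filterT | rewrite addr0 | rewrite mul0r].
Qed.

Lemma parthom_lmulP a : is_parthom [set: U] (fun x => a * x).
Proof.
by split=> [|x y _ _|x u _]; [exact: in_filterT | rewrite mulrDr | rewrite mulrA].
Qed.

Lemma parthom_oppP f : is_parthom (ph_dom f) (fun x => - f x).
Proof.
split=> [|x y fx fy|x u fx]; first exact: ph_domP.
  by rewrite ph_funD // opprD.
by rewrite ph_funM // mulNr.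
Qed.

Lemma parthom_addP f g :
  is_parthom (ph_dom f `&` ph_dom g) (fun x => f x + g x).
Proof.
split.
- by apply: in_filterI; exact: ph_domP.
- by move=> x y [fx gx] [fy gy]; rewrite !ph_funD // addrACA.
- by move=> x u [fx gx]; rewrite !ph_funM // mulrDl.
Qed.

Lemma ph_fun0 f : f 0 = 0.
Proof.
have [[f0 _ _] _] := ph_domP f.
by apply: (addIr (f 0)); rewrite -ph_funD // addr0 add0r.
Qed.

Lemma ph_fun_sum f (s : seq (U * U)) : (forall t, t \in s -> ph_dom f t.1) ->
  f (\sum_(t <- s) t.1 * t.2) = \sum_(t <- s) f t.1 * t.2.
Proof.
have [[f0 fD fM] _] := ph_domP f.
elim: s => [|p s IHs] sP; first by rewrite !big_nil ph_fun0.
have fs t : t \in s -> ph_dom f t.1 by move=> ts; apply: sP; rewrite inE ts orbT.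
have fp : ph_dom f p.1 by apply: sP; rewrite mem_head.
rewrite !big_cons ph_funD ?IHs ?ph_funM //; first by have [] := fM p.2 _ fp.
apply: is_ideal_sum; first by split.
by move=> t /fs ft; have [] := fM t.2 _ ft.
Qed.

Lemma ph_fun_prod g (I J : set U) x : is_ideal I -> J `<=` ph_dom g ->
  ideal_prod J I x -> I (g x).
Proof.
move=> hI Jg [s [sP ->]]; rewrite ph_fun_sum; last by move=> p /sP[/Jg].
apply: is_ideal_sum => // p /sP[_ Ip].
by have [_ _ IM] := hI; have [] := IM (g p.1) _ Ip.
Qed.

Lemma ph_dom_ideal f : is_ideal (ph_dom f).
Proof. by have [] := ph_domP f. Qed.

Lemma parthom_mulP f g :
  is_parthom (ideal_prod (ph_dom g) (ph_dom f)) (fun x => f (g x)).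
Proof.
have gf x : ideal_prod (ph_dom g) (ph_dom f) x -> ph_dom g x /\ ph_dom f (g x).
  move=> gfx; split; first exact: (ideal_prod_subl (ph_dom_ideal g) gfx).
  exact: (ph_fun_prod (ph_dom_ideal f) (@subset_refl _ _) gfx).
split.
- by apply: in_filter_prod; exact: ph_domP.
- by move=> x y /gf[gx fgx] /gf[gy fgy]; rewrite !ph_funD.
- by move=> x u /gf[gx fgx]; rewrite !ph_funM.
Qed.

Definition parthom0 := mk_parthom parthom0P.
Definition parthom_lmul a := mk_parthom (parthom_lmulP a).
Definition parthom_opp f := mk_parthom (parthom_oppP f).
Definition parthom_add f g := mk_parthom (parthom_addP f g).
Definition parthom_mul f g := mk_parthom (parthom_mulP f g).

Definition am_opp p := amclass (parthom_opp (amrepr p)).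
Definition am_add p q := amclass (parthom_add (amrepr p) (amrepr q)).
Definition am_mul p q := amclass (parthom_mul (amrepr p) (amrepr q)).

Lemma am_oppE f : am_opp (amclass f) = amclass (parthom_opp f).
Proof.
have [K [hK sK eK]] := amreprP f; apply/esym/amclassP; exists K; split=> //.
by move=> x /eK /= ->.
Qed.

Lemma am_addE f g : am_add (amclass f) (amclass g) = amclass (parthom_add f g).
Proof.
have [K [hK sK eK]] := amreprP f; have [L [hL sL eL]] := amreprP g.
apply/esym/amclassP; exists (K `&` L); split=> /=.
- exact: in_filterI.
- by move=> x [/sK[? ?] /sL[? ?]].
- by move=> x [/eK -> /eL ->].
Qed.

Lemma am_mulE f g : am_mul (amclass f) (amclass g) = amclass (parthom_mul f g).
Proof.
have [K [hK sK eK]] := amreprP f; have [L [hL sL eL]] := amreprP g.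
have [iK _] := hK; have [iL _] := hL.
apply/esym/amclassP; exists (ideal_prod L K); split=> /=.
- exact: in_filter_prod.
- have mono (A B C D : set U) : A `<=` C -> B `<=` D ->
      ideal_prod A B `<=` ideal_prod C D.
    move=> AC BD _ [s [sP ->]]; exists s; split=> // p /sP[Ap Bp].
    by split; [apply: AC | apply: BD].
  by move=> x LKx; split; apply: mono LKx => y; [move/sL|move/sK|move/sL|move/sK];
    case.
- move=> x LKx; rewrite -eL; last exact: (ideal_prod_subl iL LKx).
  by apply: eK; apply: (ph_fun_prod iK _ LKx) => y /sL[].
Qed.

Lemma am_addA : associative am_add.
Proof.
move=> p q r; have [f ->] := amring_ex p; have [g ->] := amring_ex q.
have [h ->] := amring_ex r; rewrite !am_addE.
by apply: amclass_eq => x _ _ /=; rewrite addrA.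
Qed.

Lemma am_addC : commutative am_add.
Proof.
move=> p q; have [f ->] := amring_ex p; have [g ->] := amring_ex q.
by rewrite !am_addE; apply: amclass_eq => x _ _ /=; rewrite addrC.
Qed.

Lemma am_add0 : left_id (amclass parthom0) am_add.
Proof.
move=> p; have [f ->] := amring_ex p.
by rewrite !am_addE; apply: amclass_eq => x _ _ /=; rewrite add0r.
Qed.

Lemma am_addN : left_inverse (amclass parthom0) am_opp am_add.
Proof.
move=> p; have [f ->] := amring_ex p.
by rewrite !am_oppE !am_addE; apply: amclass_eq => x _ _ /=; rewrite addNr.
Qed.

HB.instance Definition _ :=
  GRing.isZmodule.Build (amring U) am_addA am_addC am_add0 am_addN.

Lemma amclassD f g : amclass f + amclass g = amclass (parthom_add f g).
Proof. exact: am_addE. Qed.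

Lemma am_mulA : associative am_mul.
Proof.
move=> p q r; have [f ->] := amring_ex p; have [g ->] := amring_ex q.
by have [h ->] := amring_ex r; rewrite !am_mulE; apply: amclass_eq.
Qed.

Lemma am_mul1 : left_id (amclass (parthom_lmul 1)) am_mul.
Proof.
move=> p; have [f ->] := amring_ex p.
by rewrite !am_mulE; apply: amclass_eq => x _ _ /=; rewrite mul1r.
Qed.

Lemma am_mulr1 : right_id (amclass (parthom_lmul 1)) am_mul.
Proof.
move=> p; have [f ->] := amring_ex p.
by rewrite !am_mulE; apply: amclass_eq => x _ _ /=; rewrite mul1r.
Qed.

Lemma am_mulDl : left_distributive am_mul +%R.
Proof.
move=> p q r; have [f ->] := amring_ex p; have [g ->] := amring_ex q.
have [h ->] := amring_ex r.
by rewrite !(amclassD, am_mulE); apply: amclass_eq.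
Qed.

Lemma am_mulDr : right_distributive am_mul +%R.
Proof.
move=> p q r; have [f ->] := amring_ex p; have [g ->] := amring_ex q.
have [h ->] := amring_ex r.
rewrite !(amclassD, am_mulE); apply: amclass_eq => x _ /= [gfx hfx].
have idom := @ph_dom_ideal.
by rewrite ph_funD //; [move: gfx | move: hfx]; apply: ph_fun_prod.
Qed.

Lemma am_one_neq0 : amclass (parthom_lmul 1) != amclass parthom0.
Proof.
apply/eqP => /amclassP[K [[_ K0] _ K1]].
suff : (1 : U) = 0 by apply/eqP; rewrite oner_eq0.
by apply: K0 => x /K1 /= ->.
Qed.

HB.instance Definition _ := GRing.Zmodule_isNzRing.Build (amring U)
  am_mulA am_mul1 am_mulr1 am_mulDl am_mulDr am_one_neq0.

Lemma amclassM f g : amclass f * amclass g = amclass (parthom_mul f g).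
Proof. exact: am_mulE. Qed.

Lemma amclass1 : 1 = amclass (parthom_lmul 1).
Proof. by []. Qed.

Definition am_center : {pred amring U} := fun p => `[< forall q, p * q = q * p >].

Lemma am_centerP p : reflect (forall q, p * q = q * p) (p \in am_center).
Proof. exact: asboolP. Qed.

Lemma am_center_closed : subring_closed am_center.
Proof.
split; first by apply/am_centerP => q; rewrite mul1r mulr1.
  by move=> p q /am_centerP hp /am_centerP hq; apply/am_centerP => r;
    rewrite mulrBl mulrBr hp hq.
move=> p q /am_centerP hp /am_centerP hq; apply/am_centerP => r.
by rewrite -mulrA hq mulrA hp mulrA.
Qed.

HB.instance Definition _ :=
  GRing.isSubringClosed.Build (amring U) am_center am_center_closed.

End AmitsurMartindaleRing.

Record extcentroid (U : nzRingType) := ExtCentroid {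
  ec_val : amring U;
  ec_valP : ec_val \in am_center }.

Section ExtendedCentroid.
Context {U : nzRingType}.

HB.instance Definition _ := [isSub for @ec_val U].
HB.instance Definition _ := [Choice of extcentroid U by <:].
HB.instance Definition _ :=
  [SubChoice_isSubNzRing of extcentroid U by <:].

Lemma ec_valD (p q : extcentroid U) : ec_val (p + q) = ec_val p + ec_val q.
Proof. exact: (raddfD val). Qed.

Lemma ec_valM (p q : extcentroid U) : ec_val (p * q) = ec_val p * ec_val q.
Proof. exact: (rmorphM val). Qed.

Lemma ec_val1 : ec_val (1 : extcentroid U) = 1.
Proof. exact: (rmorph1 val). Qed.

Lemma extcentroid_mulC : commutative (@GRing.mul (extcentroid U)).
Proof.
move=> p q; apply: val_inj; rewrite !rmorphM /=.
exact: (elimT (am_centerP _) (ec_valP p)).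
Qed.

HB.instance Definition _ :=
  GRing.PzRing_hasCommutativeMul.Build (extcentroid U) extcentroid_mulC.

End ExtendedCentroid.

Section ExtendedCentroidAlgebra.
Context {F : nzRingType} {A : algType F}.
Implicit Types (f g : parthom A) (p q : amring A).

Lemma ph_dom_scale f a x : ph_dom f x -> ph_dom f (a *: x).
Proof.
move=> fx; have [_ _ fM] := ph_dom_ideal f.
by have [] := fM a%:A _ fx; rewrite mulr_algl.
Qed.

Lemma ph_funZ f a x : ph_dom f x -> f (a *: x) = a *: f x.
Proof. by move=> fx; rewrite -mulr_algr ph_funM // mulr_algr. Qed.

Lemma parthom_scaleP a f : is_parthom (ph_dom f) (fun x => a *: f x).
Proof.
split=> [|x y fx fy|x u fx]; first exact: ph_domP.
  by rewrite ph_funD // scalerDr.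
by rewrite ph_funM // scalerAl.
Qed.

Definition parthom_scale a f := mk_parthom (parthom_scaleP a f).

Definition am_scale a p : amring A := amclass (parthom_scale a (amrepr p)).

Lemma am_scaleE a f : am_scale a (amclass f) = amclass (parthom_scale a f).
Proof.
have [K [hK sK eK]] := amreprP f; apply/esym/amclassP; exists K; split=> //.
by move=> x /eK /= ->.
Qed.

Lemma am_scaleA a b p : am_scale a (am_scale b p) = am_scale (a * b) p.
Proof.
have [f ->] := amring_ex p; rewrite !am_scaleE.
by apply: amclass_eq => x _ _ /=; rewrite scalerA.
Qed.

Lemma am_scale1 : left_id 1 am_scale.
Proof.
move=> p; have [f ->] := amring_ex p; rewrite !am_scaleE.
by apply: amclass_eq => x _ _ /=; rewrite scale1r.
Qed.

Lemma am_scaleDr : right_distributive am_scale +%R.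
Proof.
move=> a p q; have [f ->] := amring_ex p; have [g ->] := amring_ex q.
rewrite !(amclassD, am_scaleE).
by apply: amclass_eq => x _ _ /=; rewrite scalerDr.
Qed.

Lemma am_scaleDl p : {morph am_scale^~ p : a b / a + b}.
Proof.
move=> a b /=; have [f ->] := amring_ex p; rewrite !(amclassD, am_scaleE).
by apply: amclass_eq => x _ _ /=; rewrite scalerDl.
Qed.

HB.instance Definition _ := GRing.Zmodule_isLmodule.Build F (amring A)
  am_scaleA am_scale1 am_scaleDr am_scaleDl.

Lemma amclassZ a f : a *: amclass f = amclass (parthom_scale a f).
Proof. exact: am_scaleE. Qed.

Lemma am_scaleAl a p q : a *: (p * q) = (a *: p) * q.
Proof.
have [f ->] := amring_ex p; have [g ->] := amring_ex q.
by rewrite !(amclassM, amclassZ); apply: amclass_eq.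
Qed.

HB.instance Definition _ :=
  GRing.Lmodule_isLalgebra.Build F (amring A) am_scaleAl.

Lemma am_scaleAr a p q : a *: (p * q) = p * (a *: q).
Proof.
have [f ->] := amring_ex p; have [g ->] := amring_ex q.
rewrite !(amclassM, amclassZ); apply: amclass_eq => x gfx _ /=.
by rewrite ph_funZ //; apply: ph_fun_prod gfx => //; exact: ph_dom_ideal.
Qed.

HB.instance Definition _ :=
  GRing.Lalgebra_isAlgebra.Build F (amring A) am_scaleAr.

Lemma am_center_scale a p : p \in am_center -> a *: p \in am_center.
Proof.
by move=> /am_centerP hp; apply/am_centerP => q; rewrite -scalerAl hp scalerAr.
Qed.

Definition ec_scale a (p : extcentroid A) : extcentroid A :=
  ExtCentroid (am_center_scale a (ec_valP p)).

Lemma ec_scaleA a b (p : extcentroid A) : ec_scale a (ec_scale b p) = ec_scale (a * b) p.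
Proof. by apply: val_inj; rewrite /= scalerA. Qed.

Lemma ec_scale1 : left_id 1 ec_scale.
Proof. by move=> p; apply: val_inj; rewrite /= scale1r. Qed.

Lemma ec_scaleDr : right_distributive ec_scale +%R.
Proof. by move=> a p q; apply: val_inj; rewrite raddfD /= -scalerDr. Qed.

Lemma ec_scaleDl (p : extcentroid A) : {morph ec_scale^~ p : a b / a + b}.
Proof. by move=> a b; apply: val_inj; rewrite raddfD /= -scalerDl. Qed.

HB.instance Definition _ := GRing.Zmodule_isLmodule.Build F (extcentroid A)
  ec_scaleA ec_scale1 ec_scaleDr ec_scaleDl.

Lemma ec_valZ a (p : extcentroid A) : ec_val (a *: p) = a *: ec_val p.
Proof. by []. Qed.

Lemma ec_scaleAl a (p q : extcentroid A) : a *: (p * q) = (a *: p) * q.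
Proof. by apply: val_inj; rewrite rmorphM /= -scalerAl. Qed.

HB.instance Definition _ :=
  GRing.Lmodule_isLalgebra.Build F (extcentroid A) ec_scaleAl.

Lemma ec_scaleAr a (p q : extcentroid A) : a *: (p * q) = p * (a *: q).
Proof. by apply: val_inj; rewrite rmorphM /= -scalerAr. Qed.

HB.instance Definition _ :=
  GRing.Lalgebra_isAlgebra.Build F (extcentroid A) ec_scaleAr.

End ExtendedCentroidAlgebra.

Section ExtendedCentroidMap.
Context {U V : nzRingType} (f : ring_iso U V).

Lemma in_filter_image (I : set U) : in_filter I -> in_filter (f @` I).
Proof.
move=> [hI I0]; split=> [|v vI]; first exact: is_ideal_image.
apply: (can_inj (iso_invK f)); rewrite -[in RHS](rmorph0 f) iso_funK.
apply: I0 => x Ix; apply: (can_inj (iso_funK f)).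
by rewrite rmorphM rmorph0 iso_invK; apply: vI; exists x.
Qed.

Lemma parthom_mapP (h : parthom U) :
  is_parthom (f @` ph_dom h) (fun v => f (h (iso_inv f v))).
Proof.
split; first exact/in_filter_image/ph_domP.
  move=> _ _ [x hx <-] [y hy <-].
  by rewrite iso_invD !iso_funK ph_funD // rmorphD.
move=> _ v [x hx <-].
by rewrite iso_invM iso_funK ph_funM // rmorphM iso_invK.
Qed.

Definition parthom_map h := mk_parthom (parthom_mapP h).

Definition am_fun (p : amring U) : amring V :=
  amclass (parthom_map (amrepr p)).

Lemma am_funE h : am_fun (amclass h) = amclass (parthom_map h).
Proof.
have [K [hK sK eK]] := amreprP h; apply/esym/amclassP.
exists (f @` K); split; first exact: in_filter_image.
  by move=> _ [x /sK[? ?] <-]; split; exists x.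
by move=> _ [x /eK Kx <-] /=; rewrite iso_funK Kx.
Qed.

Lemma am_funD : {morph am_fun : p q / p + q}.
Proof.
move=> p q; have [g ->] := amring_ex p; have [h ->] := amring_ex q.
rewrite !(amclassD, am_funE).
by apply: amclass_eq => x _ _ /=; rewrite rmorphD.
Qed.

Lemma am_funM : {morph am_fun : p q / p * q}.
Proof.
move=> p q; have [g ->] := amring_ex p; have [h ->] := amring_ex q.
rewrite !(amclassM, am_funE).
by apply: amclass_eq => x _ _ /=; rewrite iso_funK.
Qed.

Lemma am_fun1 : am_fun 1 = 1.
Proof.
rewrite !amclass1 am_funE; apply: amclass_eq => x _ _ /=.
by rewrite !mul1r iso_invK.
Qed.

End ExtendedCentroidMap.

Section ExtendedCentroidIso.
Context {U V : nzRingType} (f : ring_iso U V).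

Lemma am_funK : cancel (am_fun f) (am_fun (iso_sym f)).
Proof.
move=> p; have [h ->] := amring_ex p; rewrite !am_funE.
by apply: amclass_eq => x _ _ /=; rewrite !iso_funK.
Qed.

Lemma am_invK : cancel (am_fun (iso_sym f)) (am_fun f).
Proof.
move=> p; have [h ->] := amring_ex p; rewrite !am_funE.
by apply: amclass_eq => x _ _ /=; rewrite !iso_invK.
Qed.

Definition am_iso : ring_iso (amring U) (amring V) :=
  mk_ring_iso (am_funD f) (am_funM f) (am_fun1 f) am_funK am_invK.

End ExtendedCentroidIso.

Lemma am_iso_center (U V : nzRingType) (f : ring_iso U V) p :
  p \in am_center -> am_iso f p \in am_center.
Proof.
move=> /am_centerP hp; apply/am_centerP => q.
by rewrite -[q](iso_invK (am_iso f)) -!rmorphM hp.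
Qed.

Section ExtendedCentroidIso2.
Context {U V : nzRingType} (f : ring_iso U V).

Definition ec_fun (p : extcentroid U) : extcentroid V :=
  ExtCentroid (am_iso_center f (ec_valP p)).

Lemma ec_funD : {morph ec_fun : p q / p + q}.
Proof. by move=> p q; apply: val_inj; rewrite /= am_funD. Qed.

Lemma ec_funM : {morph ec_fun : p q / p * q}.
Proof. by move=> p q; apply: val_inj; rewrite /= am_funM. Qed.

Lemma ec_fun1 : ec_fun 1 = 1.
Proof. by apply: val_inj; rewrite /= am_fun1. Qed.

Definition ec_inv (p : extcentroid V) : extcentroid U :=
  ExtCentroid (am_iso_center (iso_sym f) (ec_valP p)).

Lemma ec_funK : cancel ec_fun ec_inv.
Proof. by move=> p; apply: val_inj; rewrite /= am_funK. Qed.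

Lemma ec_invK : cancel ec_inv ec_fun.
Proof. by move=> p; apply: val_inj; rewrite /= am_invK. Qed.

(* the class of h : I -> U is sent to that of f \o h \o f^-1 : f(I) -> V *)
Definition ec_iso : ring_iso (extcentroid U) (extcentroid V) :=
  mk_ring_iso ec_funD ec_funM ec_fun1 ec_funK ec_invK.

End ExtendedCentroidIso2.

Section ExtendedCentroidAlgIso.
Context {F : nzRingType} {A B : algType F} (f : alg_iso A B).

Lemma ec_iso_scalable : scalable (ec_iso f).
Proof.
move=> a p; apply: val_inj => /=.
have [h ->] := amring_ex (ec_val p); rewrite !(amclassZ, am_funE).
by apply: amclass_eq => x _ _ /=; rewrite alg_iso_scalable.
Qed.

Definition ec_alg_iso : alg_iso (extcentroid A) (extcentroid B) :=
  AlgIso ec_iso_scalable.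

End ExtendedCentroidAlgIso.

Section LinearForm.
Variables (k : fieldType) (A : algType k).

Lemma exists_linear_form : exists phi : A -> k,
  [/\ phi 1 = 1, forall x y, phi (x + y) = phi x + phi y &
      forall c x, phi (c *: x) = c * phi x].
Proof.
pose lin (W : set A) := forall c x y, W x -> W y -> W (c *: x + y).
pose P (W : set A) := lin W /\ ~ W 1.
have [|W [[Wlin W1] Wmax]] := @Zorn_bigcup A P.
  move=> F FP Ftot; split; last by move=> [X FX X1]; have [] := FP X FX.
  move=> c x y [X FX Xx] [Y FY Yy].
  have [XY|YX] := Ftot X Y FX FY.
    by exists Y => //; have [Yl _] := FP Y FY; apply: Yl => //; apply: XY.
  by exists X => //; have [Xl _] := FP X FX; apply: Xl => //; apply: YX.
pose W0 (x : A) := x = 0 \/ W x.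
have W0Z c x : W0 x -> W0 (c *: x).
  move=> [->|Wx]; first by left; rewrite scaler0.
  right; have := Wlin (c - 1) x x Wx Wx.
  by rewrite scalerBl scale1r subrK.
have W0D x y : W0 x -> W0 y -> W0 (x + y).
  move=> [->|Wx] [->|Wy]; rewrite ?addr0 ?add0r; [by left|by right|by right|].
  by right; have := Wlin 1 x y Wx Wy; rewrite scale1r.
have W01 : ~ W0 1 by move=> [/eqP|//]; rewrite oner_eq0.
have dec a : exists c, W0 (a - c%:A).
  have [Wa|nWa] := pselect (W a); first by exists 0; rewrite scale0r subr0; right.
  pose W' : set A := [set x | exists w c, W0 w /\ x = w + c *: a].
  have [|nP] := pselect (P W').
    move=> PW'; exfalso; apply: (Wmax W') => //; split.
      by move=> w Ww; exists w, 0; rewrite scale0r addr0; split=> //; right.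
    move=> W'W; apply: nWa; apply: W'W; exists 0, 1.
    by rewrite scale1r add0r; split=> //; left.
  have /contrapT[w [c [Ww e]]] : ~ ~ W' 1.
    move=> nW'1; apply: nP; split=> // d _ _ [w [c [Ww ->]]] [v [b [Wv ->]]].
    exists (d *: w + v), (d * c + b); split; first by apply/W0D => //; apply: W0Z.
    by rewrite scalerDr scalerA scalerDl addrACA.
  have c0 : c != 0.
    by apply/eqP => c0; apply: W01; rewrite e c0 scale0r addr0.
  exists c^-1.
  have -> : a - c^-1%:A = (- c^-1) *: w.
    rewrite [X in c^-1 *: X]e scalerDr scalerA mulVf // scale1r opprD addrCA.
    by rewrite subrr addr0 scaleNr.
  exact: W0Z.
have uniq x c d : W0 (x - c%:A) -> W0 (x - d%:A) -> c = d.
  move=> xc xd; apply/eqP; rewrite -subr_eq0; apply/negP => /negP cd.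
  apply: W01; have -> : 1 = (c - d)^-1 *: ((x - d%:A) + (-1) *: (x - c%:A)).
    rewrite scaleN1r opprB [X in _ *: X]addrC addrA subrK -scalerBl scalerA mulVf //.
    by rewrite scale1r.
  by apply: (W0Z); apply: W0D => //; apply: W0Z.
have {dec} [phi phiP] := choice dec; exists phi; split.
- by apply: uniq (phiP 1) _; rewrite scale1r subrr; left.
- move=> x y; apply: uniq (phiP _) _.
  by rewrite scalerDl opprD addrACA; apply: W0D.
- move=> c x; apply: uniq (phiP _) _.
  by rewrite -scalerA -scalerBr; apply: W0Z.
Qed.

End LinearForm.

Section BaseChange.
Context {k L : fieldType} (i : {rmorphism k -> L}) (A : algType k).
Implicit Types (s t : seq (A * L)).

Definition balanced (M : zmodType) (b : A -> L -> M) : Prop :=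
  [/\ forall a a' x, b (a + a') x = b a x + b a' x,
      forall a x x', b a (x + x') = b a x + b a x' &
      forall c a x, b (c *: a) x = b a (i c * x)].

(* A list of pairs (a, x) stands for the formal sum of the a (x) x.  Two formal
   sums are equal in A (x)_k L iff every k-balanced biadditive map takes the
   same value on them. *)
Definition bc_eq s t : bool :=
  `[< forall (M : zmodType) (b : A -> L -> M), balanced b ->
        \sum_(p <- s) b p.1 p.2 = \sum_(p <- t) b p.1 p.2 >].

Lemma bc_eq_refl : reflexive bc_eq.
Proof. by move=> s; apply/asboolP. Qed.

Lemma bc_eq_sym : symmetric bc_eq.
Proof. by move=> s t; apply/asboolP/asboolP => st M b hb; rewrite st. Qed.

Lemma bc_eq_trans : transitive bc_eq.
Proof.
move=> t s u /asboolP st /asboolP tu; apply/asboolP => M b hb.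
by rewrite st // tu.
Qed.

Canonical bc_equiv := EquivRel bc_eq bc_eq_refl bc_eq_sym bc_eq_trans.

Definition basechange := {eq_quot bc_equiv}.
HB.instance Definition _ := Choice.on basechange.

Definition bc_class s : basechange := \pi_{eq_quot bc_equiv} s.
Definition bc_repr (q : basechange) : seq (A * L) :=
  repr (q : {eq_quot bc_equiv}).
Definition bc_tensor (a : A) (x : L) : basechange := bc_class [:: (a, x)].

Lemma bc_reprK q : bc_class (bc_repr q) = q.
Proof. exact: reprK. Qed.

Lemma bc_ex (q : basechange) : exists s, q = bc_class s.
Proof. by exists (bc_repr q); rewrite bc_reprK. Qed.

Lemma bcP s t : bc_class s = bc_class t <->
  forall (M : zmodType) (b : A -> L -> M), balanced b ->
    \sum_(p <- s) b p.1 p.2 = \sum_(p <- t) b p.1 p.2.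
Proof. by split=> [/eqmodP /asboolP|st] //; apply/eqmodP/asboolP. Qed.

Lemma bc_reprP s (M : zmodType) (b : A -> L -> M) : balanced b ->
  \sum_(p <- bc_repr (bc_class s)) b p.1 p.2 = \sum_(p <- s) b p.1 p.2.
Proof. by move=> hb; have /bcP -> := bc_reprK (bc_class s). Qed.

Lemma balanced0l (M : zmodType) (b : A -> L -> M) x : balanced b -> b 0 x = 0.
Proof. by case=> bDl _ _; apply: (addIr (b 0 x)); rewrite -bDl addr0 add0r. Qed.

Lemma balancedNl (M : zmodType) (b : A -> L -> M) a x :
  balanced b -> b (- a) x = - b a x.
Proof.
move=> hb; have [bDl _ _] := hb; apply: (addIr (b a x)).
by rewrite -bDl !addNr balanced0l.
Qed.

Definition seq_opp s := [seq (- p.1, p.2) | p <- s].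
Definition seq_mul s t := [seq (p.1 * q.1, p.2 * q.2) | p <- s, q <- t].
Definition seq_scale (y : L) s := [seq (p.1, y * p.2) | p <- s].

Definition bc_add p q := bc_class (bc_repr p ++ bc_repr q).
Definition bc_opp p := bc_class (seq_opp (bc_repr p)).
Definition bc_mul p q := bc_class (seq_mul (bc_repr p) (bc_repr q)).
Definition bc_scale y p := bc_class (seq_scale y (bc_repr p)).

Lemma bc_addE s t : bc_add (bc_class s) (bc_class t) = bc_class (s ++ t).
Proof. by apply/bcP => M b hb; rewrite !big_cat /= !bc_reprP. Qed.

Lemma big_seq_opp s (M : zmodType) (b : A -> L -> M) : balanced b ->
  \sum_(p <- seq_opp s) b p.1 p.2 = - \sum_(p <- s) b p.1 p.2.
Proof.
by move=> hb; rewrite big_map -sumrN; apply: eq_bigr => p _; rewrite balancedNl.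
Qed.

Lemma bc_oppE s : bc_opp (bc_class s) = bc_class (seq_opp s).
Proof. by apply/bcP => M b hb; rewrite !big_seq_opp // bc_reprP. Qed.

Lemma big_seq_mul s t (M : zmodType) (b : A -> L -> M) :
  \sum_(p <- seq_mul s t) b p.1 p.2 =
  \sum_(p <- s) \sum_(q <- t) b (p.1 * q.1) (p.2 * q.2).
Proof. by rewrite big_allpairs_dep. Qed.

Lemma balanced_mull (M : zmodType) (b : A -> L -> M) a' x' : balanced b ->
  balanced (fun a x => b (a' * a) (x' * x)).
Proof.
case=> bDl bDr bZ; split=> [a1 a2 x|a x y|c a x]; rewrite ?mulrDr //.
by rewrite -scalerAr bZ mulrCA.
Qed.

Lemma balanced_mulr (M : zmodType) (b : A -> L -> M) a' x' : balanced b ->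
  balanced (fun a x => b (a * a') (x * x')).
Proof.
case=> bDl bDr bZ; split=> [a1 a2 x|a x y|c a x]; rewrite ?mulrDl //.
by rewrite -scalerAl bZ mulrA.
Qed.

Lemma bc_mulE s t : bc_mul (bc_class s) (bc_class t) = bc_class (seq_mul s t).
Proof.
apply/bcP => M b hb; rewrite !big_seq_mul.
transitivity (\sum_(p <- bc_repr (bc_class s)) \sum_(q <- t)
                b (p.1 * q.1) (p.2 * q.2)).
  by apply: eq_bigr => p _; rewrite (bc_reprP _ (balanced_mull _ _ hb)).
rewrite exchange_big [RHS]exchange_big /=; apply: eq_bigr => q _.
by rewrite (bc_reprP _ (balanced_mulr _ _ hb)).
Qed.

Lemma balanced_scale (M : zmodType) (b : A -> L -> M) y : balanced b ->
  balanced (fun a x => b a (y * x)).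
Proof.
case=> bDl bDr bZ; split=> [a1 a2 x|a x x'|c a x]; rewrite ?mulrDr //.
by rewrite bZ mulrCA.
Qed.

Lemma big_seq_scale s (M : zmodType) (b : A -> L -> M) y :
  \sum_(p <- seq_scale y s) b p.1 p.2 = \sum_(p <- s) b p.1 (y * p.2).
Proof. by rewrite big_map. Qed.

Lemma bc_scaleE y s : bc_scale y (bc_class s) = bc_class (seq_scale y s).
Proof.
apply/bcP => M b hb; rewrite !big_seq_scale.
by rewrite (bc_reprP _ (balanced_scale _ hb)).
Qed.

Lemma bc_addA : associative bc_add.
Proof.
move=> p q r; have [s ->] := bc_ex p; have [t ->] := bc_ex q.
by have [u ->] := bc_ex r; rewrite !bc_addE catA.
Qed.

Lemma bc_addC : commutative bc_add.
Proof.
move=> p q; have [s ->] := bc_ex p; have [t ->] := bc_ex q.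
by rewrite !bc_addE; apply/bcP => M b hb; rewrite !big_cat /= addrC.
Qed.

Lemma bc_add0 : left_id (bc_class [::]) bc_add.
Proof. by move=> p; have [s ->] := bc_ex p; rewrite bc_addE. Qed.

Lemma bc_addN : left_inverse (bc_class [::]) bc_opp bc_add.
Proof.
move=> p; have [s ->] := bc_ex p; rewrite bc_oppE bc_addE.
by apply/bcP => M b hb; rewrite big_cat /= big_seq_opp // addNr big_nil.
Qed.

HB.instance Definition _ :=
  GRing.isZmodule.Build basechange bc_addA bc_addC bc_add0 bc_addN.

Lemma bc_classD s t : bc_class s + bc_class t = bc_class (s ++ t).
Proof. exact: bc_addE. Qed.

Lemma bc_mulA : associative bc_mul.
Proof.
move=> p q r; have [s ->] := bc_ex p; have [t ->] := bc_ex q.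
have [u ->] := bc_ex r; rewrite !bc_mulE; apply/bcP => M b hb.
rewrite !big_seq_mul big_allpairs_dep; apply: eq_bigr => a _.
rewrite big_allpairs_dep; apply: eq_bigr => a' _; apply: eq_bigr => a'' _.
by rewrite !mulrA.
Qed.

Lemma bc_mul1 : left_id (bc_tensor 1 1) bc_mul.
Proof.
move=> p; have [s ->] := bc_ex p; rewrite bc_mulE; apply/bcP => M b hb.
rewrite big_seq_mul big_seq1; apply: eq_bigr => a _.
by rewrite !mul1r.
Qed.

Lemma bc_mulr1 : right_id (bc_tensor 1 1) bc_mul.
Proof.
move=> p; have [s ->] := bc_ex p; rewrite bc_mulE; apply/bcP => M b hb.
rewrite big_seq_mul; apply: eq_bigr => a _.
by rewrite big_seq1 !mulr1.
Qed.

Lemma bc_mulDl : left_distributive bc_mul +%R.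
Proof.
move=> p q r; have [s ->] := bc_ex p; have [t ->] := bc_ex q.
have [u ->] := bc_ex r; rewrite !(bc_classD, bc_mulE); apply/bcP => M b hb.
by rewrite big_cat /= !big_seq_mul big_cat.
Qed.

Lemma bc_mulDr : right_distributive bc_mul +%R.
Proof.
move=> p q r; have [s ->] := bc_ex p; have [t ->] := bc_ex q.
have [u ->] := bc_ex r; rewrite !(bc_classD, bc_mulE); apply/bcP => M b hb.
rewrite big_cat /= !big_seq_mul -big_split /=; apply: eq_bigr => a _.
by rewrite big_cat.
Qed.

Lemma bc_one_neq0 : bc_tensor 1 1 != bc_class [::].
Proof.
apply/eqP => /bcP e; have [phi [phi1 phiD phiZ]] := exists_linear_form A.
have /e : balanced (fun a x => i (phi a) * x).
  split=> [a a' x|a x x'|c a x]; first by rewrite phiD rmorphD mulrDl.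
    by rewrite mulrDr.
  by rewrite phiZ rmorphM mulrA [X in X * _]mulrC.
rewrite big_seq1 big_nil phi1 rmorph1 mulr1 => /eqP.
by rewrite oner_eq0.
Qed.

HB.instance Definition _ := GRing.Zmodule_isNzRing.Build basechange
  bc_mulA bc_mul1 bc_mulr1 bc_mulDl bc_mulDr bc_one_neq0.

Lemma bc_classM s t : bc_class s * bc_class t = bc_class (seq_mul s t).
Proof. exact: bc_mulE. Qed.

Lemma bc_class1 : 1 = bc_tensor 1 1.
Proof. by []. Qed.

Lemma bc_scaleA x y p : bc_scale x (bc_scale y p) = bc_scale (x * y) p.
Proof.
have [s ->] := bc_ex p; rewrite !bc_scaleE; apply/bcP => M b hb.
by rewrite !big_seq_scale big_map; apply: eq_bigr => q _; rewrite mulrA.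
Qed.

Lemma bc_scale1 : left_id 1 bc_scale.
Proof.
move=> p; have [s ->] := bc_ex p; rewrite !bc_scaleE; apply/bcP => M b hb.
by rewrite big_map; apply: eq_bigr => q _; rewrite mul1r.
Qed.

Lemma bc_scaleDr : right_distributive bc_scale +%R.
Proof.
move=> x p q; have [s ->] := bc_ex p; have [t ->] := bc_ex q.
by rewrite !(bc_classD, bc_scaleE) /seq_scale map_cat.
Qed.

Lemma bc_scaleDl p : {morph bc_scale^~ p : x y / x + y}.
Proof.
move=> x y /=; have [s ->] := bc_ex p; rewrite !bc_scaleE bc_classD.
apply/bcP => M b hb; rewrite big_cat /= !big_map -big_split /=.
by apply: eq_bigr => q _; have [_ bDr _] := hb; rewrite mulrDl bDr.
Qed.

HB.instance Definition _ := GRing.Zmodule_isLmodule.Build L basechange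
  bc_scaleA bc_scale1 bc_scaleDr bc_scaleDl.

Lemma bc_classZ x s : x *: bc_class s = bc_class (seq_scale x s).
Proof. exact: bc_scaleE. Qed.

Lemma bc_scaleAl x (p q : basechange) : x *: (p * q) = (x *: p) * q.
Proof.
have [s ->] := bc_ex p; have [t ->] := bc_ex q.
rewrite !(bc_classM, bc_classZ); apply/bcP => M b hb.
rewrite big_seq_scale !big_allpairs_dep big_map; apply: eq_bigr => a _.
by apply: eq_bigr => a' _; rewrite mulrA.
Qed.

HB.instance Definition _ :=
  GRing.Lmodule_isLalgebra.Build L basechange bc_scaleAl.

Lemma bc_scaleAr x (p q : basechange) : x *: (p * q) = p * (x *: q).
Proof.
have [s ->] := bc_ex p; have [t ->] := bc_ex q.
rewrite !(bc_classM, bc_classZ); apply/bcP => M b hb.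
rewrite big_seq_scale !big_allpairs_dep; apply: eq_bigr => a _.
by rewrite big_map; apply: eq_bigr => a' _; rewrite mulrCA.
Qed.

HB.instance Definition _ :=
  GRing.Lalgebra_isAlgebra.Build L basechange bc_scaleAr.

End BaseChange.

Section BaseChangeMap.
Context {k L : fieldType} (i : {rmorphism k -> L}) {A B : algType k}.
Context (f : alg_iso A B) (s : ring_iso L L) (si : forall c, s (i c) = i c).

Definition seq_map (u : seq (A * L)) := [seq (f p.1, s p.2) | p <- u].

Definition bc_fun (q : basechange i A) : basechange i B :=
  bc_class i (seq_map (bc_repr q)).

Lemma big_seq_map u (M : zmodType) (b : B -> L -> M) :
  \sum_(p <- seq_map u) b p.1 p.2 = \sum_(p <- u) b (f p.1) (s p.2).
Proof. by rewrite big_map. Qed.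

Lemma balanced_map (M : zmodType) (b : B -> L -> M) : balanced i b ->
  balanced i (fun a x => b (f a) (s x)).
Proof.
case=> bDl bDr bZ; split=> [a a' x|a x x'|c a x]; rewrite ?rmorphD //.
by rewrite alg_iso_scalable rmorphM si.
Qed.

Lemma bc_funE u : bc_fun (bc_class i u) = bc_class i (seq_map u).
Proof.
apply/bcP => M b hb; rewrite !big_seq_map.
by rewrite (bc_reprP _ (balanced_map hb)).
Qed.

Lemma bc_funD : {morph bc_fun : p q / p + q}.
Proof.
move=> p q; have [u ->] := bc_ex p; have [v ->] := bc_ex q.
by rewrite !(bc_classD, bc_funE) /seq_map map_cat.
Qed.

Lemma bc_funM : {morph bc_fun : p q / p * q}.
Proof.
move=> p q; have [u ->] := bc_ex p; have [v ->] := bc_ex q.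
rewrite !(bc_classM, bc_funE); apply/bcP => M b hb.
rewrite big_seq_map !big_allpairs_dep big_map; apply: eq_bigr => a _.
by rewrite big_map; apply: eq_bigr => a' _; rewrite !rmorphM.
Qed.

Lemma bc_fun1 : bc_fun 1 = 1.
Proof. by rewrite !bc_class1 bc_funE /seq_map /= !rmorph1. Qed.

End BaseChangeMap.

Section BaseChangeIso.
Context {k L : fieldType} (i : {rmorphism k -> L}) {A B : algType k}.
Context (f : alg_iso A B) (s : ring_iso L L) (si : forall c, s (i c) = i c).

Lemma iso_sym_fix c : iso_sym s (i c) = i c.
Proof. by apply: (can_inj (iso_funK s)); rewrite si [LHS]iso_invK. Qed.

Definition bc_inv : basechange i B -> basechange i A :=
  bc_fun (alg_iso_sym f) (iso_sym s).

Lemma bc_funK : cancel (bc_fun f s) bc_inv.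
Proof.
move=> p; have [u ->] := bc_ex p; rewrite (bc_funE f si).
rewrite [LHS](bc_funE (alg_iso_sym f) iso_sym_fix) /seq_map -map_comp.
by congr bc_class; apply: map_id_in => -[a x] _ /=; rewrite !iso_funK.
Qed.

Lemma bc_invK : cancel bc_inv (bc_fun f s).
Proof.
move=> p; have [u ->] := bc_ex p.
rewrite /bc_inv (bc_funE (alg_iso_sym f) iso_sym_fix) (bc_funE f si).
rewrite /seq_map -map_comp.
by congr bc_class; apply: map_id_in => -[a x] _ /=; rewrite !iso_invK.
Qed.

Definition bc_iso : ring_iso (basechange i A) (basechange i B) :=
  mk_ring_iso (bc_funD f si) (bc_funM f si) (bc_fun1 f si) bc_funK bc_invK.

End BaseChangeIso.

Definition is_subalgebra (k : nzRingType) (A : algType k) (S : set A) : Prop :=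
  [/\ S 1, forall (c : k) f h, S f -> S h -> S (c *: f + h) &
      forall f h, S f -> S h -> S (f * h)].

(* An affine variety over an algebraically closed field k is given by its set
   of points together with its finitely generated algebra of regular k-valued
   functions, every k-algebra homomorphism to k being evaluation at exactly one
   point.  ag_mulP and ag_invP say that the group operations are morphisms of
   varieties, with k[G x G] = k[G] (x) k[G]. *)
Record affine_group (k : closedFieldType) := AffineGroup {
  ag_point :> groupType;
  ag_coord : comAlgType k;
  ag_ev : ag_point -> {lrmorphism ag_coord -> k^o};
  ag_ev_inj : forall f h, (forall x, ag_ev x f = ag_ev x h) -> f = h;
  ag_fingen : exists s : seq ag_coord, forall S : set ag_coord,
    is_subalgebra S -> (forall f, f \in s -> S f) -> S = [set: ag_coord];
  ag_pointP : forall phi : {lrmorphism ag_coord -> k^o},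
    exists! x, forall f, phi f = ag_ev x f;
  ag_mulP : forall f, exists s : seq (ag_coord * ag_coord),
    forall x y, ag_ev (x * y)%g f = \sum_(p <- s) ag_ev x p.1 * ag_ev y p.2;
  ag_invP : forall f, exists h, forall x, ag_ev x h = ag_ev x^-1%g f }.

Section AffineGroup.
Context {k : closedFieldType} (G : affine_group k).

Definition regular_fun (u : G -> k) : Prop :=
  exists f : ag_coord G, forall x, u x = ag_ev x f.

Definition zariski_closed (Z : set G) : Prop :=
  exists S : set (ag_coord G), Z = [set x | forall f, S f -> ag_ev x f = 0].

Definition zariski_connected : Prop := forall Y Z : set G,
  zariski_closed Y -> zariski_closed Z -> Y `|` Z = [set: G] ->
  Y `&` Z = set0 -> Y = set0 \/ Z = set0.

(* homomorphisms of algebraic groups G -> GL_n; k[GL_n] is generated by the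
   matrix entries and the inverse of the determinant *)
Definition GL_hom n (M : G -> 'M[k]_n) : Prop :=
  [/\ M 1%g = 1%:M, forall x y, M (x * y)%g = M x *m M y,
      forall a b, regular_fun (fun x => M x a b) &
      regular_fun (fun x => (\det (M x))^-1)].

Definition ag_morphism (t : G -> G) : Prop :=
  forall f, exists h, forall y, ag_ev y h = ag_ev (t y) f.

Lemma ag_morphism_rmul x : ag_morphism (fun y => y * x)%g.
Proof.
move=> f; have [s sP] := ag_mulP f.
exists (\sum_(p <- s) (ag_ev x p.2 : k) *: p.1) => y.
rewrite sP linear_sum; apply: eq_bigr => p _.
by rewrite linearZ [RHS]mulrC.
Qed.

Lemma ag_morphism_lmul x : ag_morphism (fun y => x * y)%g.
Proof.
move=> f; have [s sP] := ag_mulP f.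
exists (\sum_(p <- s) (ag_ev x p.1 : k) *: p.2) => y.
by rewrite sP linear_sum; apply: eq_bigr => p _; rewrite linearZ.
Qed.

Section Pullback.
Variables (t t' : G -> G).
Hypotheses (tm : ag_morphism t) (tm' : ag_morphism t').
Hypotheses (tK : cancel t t') (tK' : cancel t' t).

Definition pullback (s : G -> G) (sm : ag_morphism s) (f : ag_coord G) :=
  sval (cid (sm f)).

Lemma pullbackE s (sm : ag_morphism s) f y :
  ag_ev y (pullback sm f) = ag_ev (s y) f.
Proof. exact: (svalP (cid (sm f))). Qed.

Lemma pullbackD : {morph pullback tm : f h / f + h}.
Proof.
by move=> f h; apply: ag_ev_inj => y; rewrite pullbackE !rmorphD /= !pullbackE.
Qed.

Lemma pullbackM : {morph pullback tm : f h / f * h}.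
Proof.
by move=> f h; apply: ag_ev_inj => y; rewrite pullbackE !rmorphM /= !pullbackE.
Qed.

Lemma pullback1 : pullback tm 1 = 1.
Proof. by apply: ag_ev_inj => y; rewrite pullbackE !rmorph1. Qed.

Lemma pullbackK : cancel (pullback tm) (pullback tm').
Proof. by move=> f; apply: ag_ev_inj => y; rewrite !pullbackE tK'. Qed.

Lemma pullbackK' : cancel (pullback tm') (pullback tm).
Proof. by move=> f; apply: ag_ev_inj => y; rewrite !pullbackE tK. Qed.

Lemma pullbackZ : scalable (pullback tm).
Proof.
move=> c f; apply: ag_ev_inj => y.
by rewrite pullbackE !linearZ /= pullbackE.
Qed.

Definition pullback_iso : alg_iso (ag_coord G) (ag_coord G) :=
  @AlgIso _ _ _
    (mk_ring_iso pullbackD pullbackM pullback1 pullbackK pullbackK') pullbackZ.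

End Pullback.

(* (rho_r(x) f)(y) = f(yx) and (rho_l(x) f)(y) = f(x^-1 y) *)
Definition reg_r (x : G) : alg_iso (ag_coord G) (ag_coord G) :=
  pullback_iso (ag_morphism_rmul x) (ag_morphism_rmul x^-1%g)
    (mulgK x) (mulgVK x).

Definition reg_l (x : G) : alg_iso (ag_coord G) (ag_coord G) :=
  pullback_iso (ag_morphism_lmul x^-1%g) (ag_morphism_lmul x)
    (mulVKg x) (mulKg x).

Lemma reg_rE x f y : ag_ev y (reg_r x f) = ag_ev (y * x)%g f.
Proof. exact: pullbackE. Qed.

Lemma reg_lE x f y : ag_ev y (reg_l x f) = ag_ev (x^-1 * y)%g f.
Proof. exact: pullbackE. Qed.

(* A field of fractions of k[G], given up to isomorphism by its defining
   property; one exists when G is connected, since k[G] is then a domain. *)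
Record function_field := FunctionField {
  ff_field :> fieldType;
  ff_in : {rmorphism ag_coord G -> ff_field};
  ff_in_inj : injective ff_in;
  ff_frac : forall z, exists f h, h != 0 /\ z = ff_in f / ff_in h }.

End AffineGroup.

Section FunctionField.
Context {k : closedFieldType} {G : affine_group k} (K : function_field G).
Let j := @ff_in _ _ K.

Definition ff_const : {rmorphism k -> K} := j \o in_alg (ag_coord G).

Lemma ff_in_neq0 f : f != 0 -> j f != 0.
Proof. by rewrite -(inj_eq (@ff_in_inj _ _ K)) rmorph0. Qed.

Lemma ff_frac2 z : exists p : ag_coord G * ag_coord G,
  p.2 != 0 /\ z = j p.1 / j p.2.
Proof. by have [f [h hP]] := ff_frac z; exists (f, h). Qed.

Section Extension.
Variable s : alg_iso (ag_coord G) (ag_coord G).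

Definition ff_ext_fun (z : K) : K :=
  let p := sval (cid (ff_frac2 z)) in j (s p.1) / j (s p.2).

Lemma iso_neq0 f : f != 0 -> s f != 0.
Proof. by rewrite -(inj_eq (can_inj (iso_funK s))) rmorph0. Qed.

Lemma ff_ext_funE f h : h != 0 -> ff_ext_fun (j f / j h) = j (s f) / j (s h).
Proof.
move=> h0; rewrite /ff_ext_fun; case: cid => -[f' h'] /= [h'0 /eqP].
rewrite eqr_div ?ff_in_neq0 // -!rmorphM => /eqP /(@ff_in_inj _ _ K) e.
apply/eqP; rewrite eqr_div ?ff_in_neq0 ?iso_neq0 //.
by rewrite -!rmorphM e.
Qed.

Lemma ff_prod_neq0 f h : f != 0 -> h != 0 -> f * h != 0 :> ag_coord G.
Proof.
move=> f0 h0; rewrite -(inj_eq (@ff_in_inj _ _ K)) rmorph0 rmorphM.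
by rewrite mulf_neq0 // ff_in_neq0.
Qed.

Lemma ff_ext_funD : {morph ff_ext_fun : y z / y + z}.
Proof.
move=> y z; have [[f h] /= [h0 ->]] := ff_frac2 y.
have [[f' h'] /= [h'0 ->]] := ff_frac2 z.
rewrite addf_div ?ff_in_neq0 // -!(rmorphM, rmorphD).
rewrite !ff_ext_funE ?ff_prod_neq0 // addf_div ?ff_in_neq0 ?iso_neq0 //.
by rewrite !(rmorphM, rmorphD).
Qed.

Lemma ff_ext_funM : {morph ff_ext_fun : y z / y * z}.
Proof.
move=> y z; have [[f h] /= [h0 ->]] := ff_frac2 y.
have [[f' h'] /= [h'0 ->]] := ff_frac2 z.
rewrite mulf_div -!rmorphM.
rewrite !ff_ext_funE ?ff_prod_neq0 // mulf_div.
by rewrite !rmorphM.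
Qed.

Lemma ff_ext_in f : ff_ext_fun (j f) = j (s f).
Proof.
rewrite -[j f]divr1 -(rmorph1 j) ff_ext_funE ?oner_eq0 //.
by rewrite !rmorph1 divr1.
Qed.

Lemma ff_ext_fun1 : ff_ext_fun 1 = 1.
Proof. by rewrite -(rmorph1 j) ff_ext_in !rmorph1. Qed.

End Extension.

Lemma ff_ext_funK (s : alg_iso (ag_coord G) (ag_coord G)) :
  cancel (ff_ext_fun s) (ff_ext_fun (alg_iso_sym s)).
Proof.
move=> z; have [[f h] /= [h0 ->]] := ff_frac2 z.
rewrite ff_ext_funE // ff_ext_funE ?iso_neq0 //.
by rewrite /= !iso_funK.
Qed.

Lemma ff_ext_invK (s : alg_iso (ag_coord G) (ag_coord G)) :
  cancel (ff_ext_fun (alg_iso_sym s)) (ff_ext_fun s).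
Proof.
move=> z; have [[f h] /= [h0 ->]] := ff_frac2 z.
rewrite ff_ext_funE // ff_ext_funE ?iso_neq0 //.
by rewrite /= !iso_invK.
Qed.

(* f/h |-> s(f)/s(h) *)
Definition ff_ext (s : alg_iso (ag_coord G) (ag_coord G)) : ring_iso K K :=
  mk_ring_iso (ff_ext_funD s) (ff_ext_funM s) (ff_ext_fun1 s)
    (ff_ext_funK s) (ff_ext_invK s).

Lemma ff_ext_const s c : ff_ext s (ff_const c) = ff_const c.
Proof.
by rewrite [LHS]ff_ext_in /= alg_iso_scalable rmorph1.
Qed.

Definition ff_r (g : G) : ring_iso K K := ff_ext (reg_r g).
Definition ff_l (g : G) : ring_iso K K := ff_ext (reg_l g).

Definition ff_r_const g : forall c, ff_r g (ff_const c) = ff_const c :=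
  ff_ext_const (reg_r g).
Definition ff_l_const g : forall c, ff_l g (ff_const c) = ff_const c :=
  ff_ext_const (reg_l g).

End FunctionField.

Record alg_action (G : groupType) (k : nzRingType) (R : algType k) := AlgAction {
  act_fun :> G -> {lrmorphism R -> R};
  act_fun1 : forall r, act_fun 1%g r = r;
  act_funM : forall g h r, act_fun (g * h)%g r = act_fun g (act_fun h r) }.

Section AlgAction.
Context {G : groupType} {k : nzRingType} {R : algType k}.
Variable rho : alg_action G R.

Lemma act_funK g : cancel (rho g) (rho g^-1%g).
Proof. by move=> r; rewrite -act_funM mulVg act_fun1. Qed.

Lemma act_invK g : cancel (rho g^-1%g) (rho g).
Proof. by move=> r; rewrite -act_funM mulgV act_fun1. Qed.

Lemma act_scalable g : scalable (@RingIso R R (rho g) _ (act_funK g) (act_invK g)).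
Proof. by move=> a r; rewrite /= linearZ. Qed.

Definition act_iso g : alg_iso R R := AlgIso (act_scalable g).

Definition gstable (A : set R) : Prop := forall g, act_iso g @` A = A.

Definition is_gprime (I : set R) : Prop :=
  [/\ is_ideal I, ~ I 1, gstable I &
      forall A B, is_ideal A -> is_ideal B -> gstable A -> gstable B ->
        ideal_prod A B `<=` I -> A `<=` I \/ B `<=` I].

Record gspec := GSpec {
  gspec_ideal :> proper_ideal R;
  gspecP : is_gprime gspec_ideal }.

Lemma gspec_stable (I : gspec) g : act_iso g @` I = I.
Proof. by have [_ _ Is _] := gspecP I; apply: Is. Qed.

Record spec_over (I : set R) := SpecOver {
  so_ideal :> proper_ideal R;
  so_prime : is_prime so_ideal;
  so_cap : \bigcap_g act_iso g @` so_ideal = I }.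

Section SpecAct.
Variables (I : set R) (g : G) (P : spec_over I).

Definition act_ideal : proper_ideal R :=
  ProperIdeal (is_ideal_image (act_iso g) (ideal_setP P))
    (image_proper (@ideal_set1 _ P)).

Lemma act_ideal_cap : \bigcap_h act_iso h @` act_ideal = I.
Proof.
rewrite -[RHS](so_cap P); apply/seteqP; split=> x xP h _.
  have [_ [p Pp <-] <-] := xP (h * g^-1)%g Logic.I.
  exists p => //=.
  by rewrite -act_funM -mulgA mulVg mulg1.
have [p Pp <-] := xP (h * g)%g Logic.I.
by exists (act_iso g p); [exists p | rewrite /= act_funM].
Qed.

Definition spec_act : spec_over I :=
  @SpecOver I act_ideal (is_prime_image (act_iso g) (so_prime P)) act_ideal_cap.

End SpecAct.

Definition rational_prime (P : proper_ideal R) : Prop :=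
  forall q : extcentroid (quot P), exists a : k, q = a%:A.

End AlgAction.

(* v is a basis of a G-stable subspace V of R containing r, and M is the matrix
   form of the action G -> GL(V) in this basis. *)
Definition rational_action (k : closedFieldType) (G : affine_group k)
    (R : algType k) (rho : alg_action G R) : Prop :=
  forall r : R, exists n (v : 'I_n -> R) (M : G -> 'M[k]_n),
    [/\ forall c : 'I_n -> k, \sum_i c i *: v i = 0 -> forall i, c i = 0,
        exists c : 'I_n -> k, r = \sum_i c i *: v i,
        GL_hom M &
        forall g b, rho g (v b) = \sum_a M g a b *: v a].

Record stable_spec (U : nzRingType) (X : Type) (phi : X -> ring_iso U U) :=
StableSpec {
  ss_ideal :> proper_ideal U;
  ss_prime : is_prime ss_ideal;
  ss_stable : forall x, phi x @` ss_ideal = ss_ideal }.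

Section TI.
Context {k : closedFieldType} {G : affine_group k} (K : function_field G).
Context {R : algType k} {rho : alg_action G R} (I : gspec rho).

Definition TI := basechange (ff_const K) (extcentroid (quot I)).
HB.instance Definition _ := GRing.Algebra.on TI.

(* rho (x) rho_r and Id (x) rho_l on T_I = C(R/I) (x) k(G) *)
Definition TI_r (g : G) : ring_iso TI TI :=
  bc_iso (ec_alg_iso (quot_alg_iso (gspec_stable I g))) (ff_r_const K g).

Definition TI_l (g : G) : ring_iso TI TI :=
  bc_iso (alg_iso_id (extcentroid (quot I))) (ff_l_const K g).

End TI.

Section PrimeTensor.
Context {k : closedFieldType} {G : affine_group k} (K : function_field G).
Context {R : algType k} {rho : alg_action G R} {I : set R}.

Definition RPK (P : proper_ideal R) := basechange (ff_const K) (quot P).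
HB.instance Definition _ P := GRing.Algebra.on (RPK P).

(* Id (x) rho_r and rho (x) rho_l on (R/P) (x) k(G) *)
Definition RPK_r (P : spec_over rho I) (g : G) : ring_iso (RPK P) (RPK P) :=
  bc_iso (alg_iso_id (quot P)) (ff_r_const K g).

Definition RPK_l (P : spec_over rho I) (g : G) :
    ring_iso (RPK P) (RPK (spec_act g P)) :=
  bc_iso (quot_alg_iso (f := act_iso rho g) (I := P) (J := spec_act g P) erefl)
    (ff_l_const K g).

End PrimeTensor.

(* Main.v *)
(* Let U = R/I, a prime ring since G is connected, W = U (x) k(G) and
   T = C(U) (x) k(G).  Letting a point x of G send r to the class of x.r turns a
   prime P over I into a surjective morphism delta : W -> (R/P) (x) k(G) that is
   injective on U.  Its kernel Q is prime, and t in T belongs to c(P) when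
   t b lies in Q for some nonzero b in U.

   By Martindale's lemma every element of W is a sum of e_j t_j, with e_j in U
   linearly independent over C(U) and t_j in T, and multiplications of U isolate
   any e_j.  Hence Q is the set of the w whose coefficients t_j lie in c(P), every
   prime of T arises in this way from a prime of W with zero intersection with U,
   and the extended centroid of (R/P) (x) k(G) consists of fractions of T/c(P).

   The twist nabla : R (x) k(G) -> W, sending r to x |-> class of x^-1.r, makes
   the diagonal action on W correspond to right translation alone, and ideals
   that are stable under right translations are defined over k because
   k(G)^G = k.  So the stable primes Q of W with zero intersection with U are
   exactly the kernels of the maps delta. *)

From HB Require Import structures.
From mathcomp Require Import all_boot all_order all_algebra.
From mathcomp Require Import boolp classical_sets.
Require Import Defs.

Set Implicit Arguments.
Unset Strict Implicit.
Unset Printing Implicit Defensive.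

Import GRing.Theory.
Local Open Scope ring_scope.
Local Open Scope classical_set_scope.

(** * Linear forms and base change *)

(** Elements of T and W are multiplied in N = M(U) (x) k(G), where M(U) is the Amitsur-Martindale
    ring of U. Both embed in N and T is central there, so no central closure of U has to be built,
    and a condition such as t b in Q is an equation in N.

    Elements of A (x) k(G) are handled, after clearing denominators, through the A-valued functions
    on G that they represent. Identities become pointwise, and because k[G] lies in a field, two
    nonzero elements are nonzero at a common point. The same device proves that U is prime: Zorn's
    lemma provides a prime of R whose largest G-stable part is I, and nonzero orbit functions modulo
    that prime are compared at a common point.

    The kernel of delta is not visibly defined over k, since delta mixes the action with the
    coefficients. The twist repairs this: delta o nabla is plain reduction R (x) k(G) -> (R/P) (x)
    k(G), by x.(x^-1.r) = r. Injectivity, inclusions and surjectivity of c all reduce to this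
    identity.

    Spaces are infinite-dimensional throughout; in place of bases, linear forms separate points and
    finitely many vectors are treated at a time. *)

Section LinearForms.
Variable k : fieldType.

Lemma linear_funD (V W : lmodType k) (f : V -> W) :
  linear f -> {morph f : x y / x + y}.
Proof. by move=> fl x y; have := fl 1 x y; rewrite !scale1r. Qed.

Lemma linear_fun0 (V W : lmodType k) (f : V -> W) : linear f -> f 0 = 0.
Proof.
by move=> /linear_funD fD; apply: (addIr (f 0)); rewrite -fD addr0 add0r.
Qed.

Lemma linear_funZ (V W : lmodType k) (f : V -> W) :
  linear f -> forall c, {morph f : x / c *: x}.
Proof.
by move=> fl c x; have := fl c x 0; rewrite (linear_fun0 fl) !addr0.
Qed.

Lemma linear_funB (V W : lmodType k) (f : V -> W) :
  linear f -> {morph f : x y / x - y}.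
Proof.
by move=> fl x y; rewrite -scaleN1r addrC fl scaleN1r addrC.
Qed.

Lemma scalar_funD (V : lmodType k) (f : V -> k) :
  scalar f -> {morph f : x y / x + y}.
Proof. by move=> fl x y; have := fl 1 x y; rewrite scale1r mul1r. Qed.

Lemma scalar_fun0 (V : lmodType k) (f : V -> k) : scalar f -> f 0 = 0.
Proof.
by move=> /scalar_funD fD; apply: (addIr (f 0)); rewrite -fD addr0 add0r.
Qed.

Lemma scalar_funZ (V : lmodType k) (f : V -> k) :
  scalar f -> forall c x, f (c *: x) = c * f x.
Proof.
by move=> fl c x; have := fl c x 0; rewrite (scalar_fun0 fl) !addr0.
Qed.

Definition subspace (V : lmodType k) (S : set V) : Prop :=
  S 0 /\ forall c x y, S x -> S y -> S (c *: x + y).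

Lemma subspaceZ (V : lmodType k) (S : set V) c x : subspace S -> S x -> S (c *: x).
Proof. by move=> [S0 Sl] Sx; rewrite -[_ *: _]addr0; apply: Sl. Qed.

Lemma subspaceD (V : lmodType k) (S : set V) x y :
  subspace S -> S x -> S y -> S (x + y).
Proof. by move=> [S0 Sl] Sx Sy; rewrite -[x]scale1r; apply: Sl. Qed.

(** A maximal subspace containing [S] but not [a] is a complement to the line of [a]; the form reads
    off the coefficient of [a]. *)
Lemma exists_separating_form (V : lmodType k) (S : set V) a :
  subspace S -> ~ S a ->
  exists l : V -> k, [/\ scalar l, forall x, S x -> l x = 0 & l a = 1].
Proof.
move=> Ss nSa.
(* The union with [S] admits the empty chain, whose union is the empty set. *)
pose P (W : set V) := subspace (W `|` S) /\ ~ (W `|` S) a.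
have [|W [[Wss nWa] Wmax]] := @Zorn_bigcup V P.
  move=> F FP Ftot; split.
    split; first by right; case: Ss.
    move=> c x y [[X FX Xx]|Sx] [[Y FY Yy]|Sy].
    - have [XY|YX] := Ftot X Y FX FY.
        have [[_ Yl] _] := FP Y FY.
        by have [] := Yl c x y (or_introl (XY _ Xx)) (or_introl Yy);
          [left; exists Y|right].
      have [[_ Xl] _] := FP X FX.
      by have [] := Xl c x y (or_introl Xx) (or_introl (YX _ Yy));
        [left; exists X|right].
    - have [[_ Xl] _] := FP X FX.
      by have [] := Xl c x y (or_introl Xx) (or_intror Sy);
        [left; exists X|right].
    - have [[_ Yl] _] := FP Y FY.
      by have [] := Yl c x y (or_intror Sx) (or_introl Yy);
        [left; exists Y|right].
    - by right; case: Ss => _; apply.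
  by move=> [[X FX Xa]|//]; have [_] := FP X FX; apply; left.
set W0 := W `|` S in Wss nWa.
have dec x : exists c, W0 (x - c *: a).
  have [Wx|nWx] := pselect (W0 x); first by exists 0; rewrite scale0r subr0.
  pose W' : set V := [set y | exists w c, W0 w /\ y = w + c *: x].
  have W'S : W' `|` S = W'.
    apply/seteqP; split=> y; last by left.
    by case=> // Sy; exists y, 0; rewrite scale0r addr0; split=> //; right.
  have [|nP] := pselect (P W').
    move=> PW'; exfalso; apply: (Wmax W') => //; split.
      by move=> w Ww; exists w, 0; rewrite scale0r addr0; split=> //; left.
    move=> W'W; apply: nWx; left; apply: W'W; exists 0, 1.
    by rewrite scale1r add0r; split=> //; case: Wss.
  have /contrapT[w [c [Ww e]]] : ~ ~ W' a.
    move=> nW'a; apply: nP; rewrite /P W'S; split=> //; split.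
      by exists 0, 0; rewrite scale0r addr0; split=> //; case: Wss.
    move=> d _ _ [w [c [Ww ->]]] [v [b [Wv ->]]].
    exists (d *: w + v), (d * c + b); split; first by case: Wss => _; apply.
    by rewrite scalerDr scalerA scalerDl addrACA.
  have c0 : c != 0.
    by apply/eqP => c0; apply: nWa; rewrite e c0 scale0r addr0.
  exists c^-1.
  have -> : x - c^-1 *: a = (- c^-1) *: w.
    rewrite [X in c^-1 *: X]e scalerDr scalerA mulVf // scale1r opprD addrCA.
    by rewrite subrr addr0 scaleNr.
  exact: subspaceZ.
have uniq x c d : W0 (x - c *: a) -> W0 (x - d *: a) -> c = d.
  move=> xc xd; apply/eqP; rewrite -subr_eq0; apply/negP => /negP cd.
  apply: nWa; have -> : a = (c - d)^-1 *: ((-1) *: (x - c *: a) + (x - d *: a)).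
    rewrite scaleN1r opprB addrA subrK -scalerBl scalerA mulVf //.
    by rewrite scale1r.
  by apply: subspaceZ => //; case: Wss => _; apply.
have {dec} [l lP] := choice dec; exists l; split.
- move=> c x y; apply: uniq (lP _) _.
  rewrite scalerDl opprD addrACA -scalerA -scalerBr.
  by case: Wss => _; apply.
- by move=> x Sx; apply: uniq (lP _) _; rewrite scale0r subr0; right.
- by apply: uniq (lP _) _; rewrite scale1r subrr; case: Wss.
Qed.

Lemma exists_form1 (V : lmodType k) (a : V) : a != 0 ->
  exists l : V -> k, scalar l /\ l a = 1.
Proof.
move=> /eqP a0; have [||l [ls _ la]] := @exists_separating_form V [set 0] a => //.
  by split=> // c x y /= -> ->; rewrite scaler0 addr0.
by exists l.
Qed.

(** The pairs stand in for a basis of the span of [s] and its coordinate forms. Each new form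
    vanishes on the vectors that the previous sum already reproduces, so these stay reproduced. *)
Lemma finite_rank_projection (V : lmodType k) (s : seq V) :
  exists E : seq ((V -> k) * V), (forall j, j \in E -> scalar j.1) /\
    forall v, v \in s -> v = \sum_(j <- E) j.1 v *: j.2.
Proof.
elim: s => [|a s [E [Es EP]]]; first by exists [::].
pose p v := \sum_(j <- E) j.1 v *: j.2.
have pl : linear p.
  move=> c x y; rewrite /p scaler_sumr -big_split /= big_seq [RHS]big_seq.
  apply: eq_bigr => j jE; rewrite (Es _ jE) scalerDl scalerA; congr (_ + _).
have [pa|/eqP pa] := eqVneq (p a) a.
  by exists E; split=> // v; rewrite inE => /orP[/eqP ->|/EP].
have Ss : subspace [set v | p v = v].
  split=> [|c x y /= px py]; first exact: linear_fun0.
  by rewrite pl px py.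
have [l [ls lS la]] := exists_separating_form Ss pa.
exists ((l, a - p a) :: E); split.
  by move=> j; rewrite inE => /orP[/eqP ->|/Es].
move=> v; rewrite inE big_cons /= -/(p v) => /orP[/eqP -> |vs].
  by rewrite la scale1r subrK.
by rewrite lS ?scale0r ?add0r; [exact: EP|rewrite /= -[LHS](EP v vs)].
Qed.

(** Finitely many vectors suffice for injectivity after base change, as an element of a tensor
    product involves only finitely many. *)
Lemma finite_left_inverse (V W : lmodType k) (f : V -> W) (s : seq V) :
  linear f -> injective f ->
  exists g : W -> V, linear g /\ forall v, v \in s -> g (f v) = v.
Proof.
move=> fl fi; elim: s => [|a s [g [gl gP]]].
  by exists (fun=> 0); split=> // c x y; rewrite scaler0 addr0.
have [ga|/eqP ga] := eqVneq (g (f a)) a.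
  by exists g; split=> // v; rewrite inE => /orP[/eqP ->|/gP].
pose S : set W := [set y | exists2 v, y = f v & g (f v) = v].
have Ss : subspace S.
  split; first by exists 0; rewrite !linear_fun0.
  move=> c _ _ [u -> gu] [v -> gv]; exists (c *: u + v).
    by rewrite fl.
  by rewrite fl gl gu gv.
have nS : ~ S (f a) by move=> [v /fi <-].
have [l [ls lS la]] := exists_separating_form Ss nS.
exists (fun y => g y + l y *: (a - g (f a))); split.
  move=> c x y; rewrite gl ls scalerDl -scalerA [c *: (_ + _)]scalerDr.
  by rewrite addrACA.
move=> v; rewrite inE => /orP[/eqP ->|vs].
  by rewrite la scale1r addrC subrK.
by rewrite lS ?scale0r ?addr0; [exact: gP|exists v => //; exact: gP].
Qed.

End LinearForms.

(** * Universal property, forms and linear maps on A (x) L *)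

Section BaseChangeTheory.
Context {k L : fieldType} (i : {rmorphism k -> L}).

Section Lift.
Context {A : algType k}.
Local Notation AL := (basechange i A).
Local Notation "a ⊗ x" := (bc_tensor i (a : A) x) (at level 39).

Lemma bc_tensorDl a b x : (a + b) ⊗ x = a ⊗ x + b ⊗ x.
Proof.
rewrite bc_classD; apply/bcP => M h [hD _ _].
by rewrite big_cons !big_cons !big_nil /= !addr0 hD.
Qed.

Lemma bc_tensorDr a x y : a ⊗ (x + y) = a ⊗ x + a ⊗ y.
Proof.
rewrite bc_classD; apply/bcP => M h [_ hD _].
by rewrite big_cons !big_cons !big_nil /= !addr0 hD.
Qed.

Lemma bc_tensorZ c a x : (c *: a) ⊗ x = a ⊗ (i c * x).
Proof.
apply/bcP => M h [_ _ hZ].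
by rewrite !big_seq1 hZ.
Qed.

Lemma bc_tensorM a b x y : (a ⊗ x) * (b ⊗ y) = (a * b) ⊗ (x * y).
Proof. by rewrite bc_classM. Qed.

Lemma scale_bc_tensor a x y : y *: (a ⊗ x) = a ⊗ (y * x).
Proof. by rewrite bc_classZ. Qed.

Lemma bc_tensor0l x : 0 ⊗ x = 0.
Proof. by apply: (addIr (0 ⊗ x)); rewrite -bc_tensorDl !add0r. Qed.

Lemma bc_tensor0r a : a ⊗ 0 = 0.
Proof. by apply: (addIr (a ⊗ 0)); rewrite -bc_tensorDr !add0r. Qed.

Lemma bc_tensorNl a x : (- a) ⊗ x = - (a ⊗ x).
Proof. by apply: (addIr (a ⊗ x)); rewrite -bc_tensorDl !addNr bc_tensor0l. Qed.

Lemma bc_tensorBr a x y : a ⊗ (x - y) = a ⊗ x - a ⊗ y.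
Proof. by apply: (addIr (a ⊗ y)); rewrite -bc_tensorDr !subrK. Qed.

Lemma bc_tensor_suml (I : Type) (r : seq I) (F : I -> A) x :
  (\sum_(j <- r) F j) ⊗ x = \sum_(j <- r) F j ⊗ x.
Proof.
elim: r => [|j r IHr]; first by rewrite !big_nil bc_tensor0l.
by rewrite !big_cons bc_tensorDl IHr.
Qed.

Lemma bc_tensor_sumr (I : Type) (r : seq I) (F : I -> L) a :
  a ⊗ (\sum_(j <- r) F j) = \sum_(j <- r) a ⊗ F j.
Proof. by apply: (big_morph (bc_tensor i a) (bc_tensorDr a) (bc_tensor0r a)). Qed.

Lemma bc_class_sum s : bc_class i s = \sum_(p <- s) (p.1 : A) ⊗ p.2.
Proof.
elim: s => [|[a x] s IHs]; first by rewrite big_nil.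
by rewrite big_cons -IHs bc_classD.
Qed.

Lemma bc_sum_ex (w : AL) : exists s : seq (A * L), w = \sum_(p <- s) p.1 ⊗ p.2.
Proof. by have [s ->] := bc_ex w; exists s; rewrite bc_class_sum. Qed.

Lemma bc_additive_eq (M : zmodType) (f g : AL -> M) :
  {morph f : x y / x + y} -> {morph g : x y / x + y} ->
  (forall a x, f (a ⊗ x) = g (a ⊗ x)) -> f =1 g.
Proof.
move=> fD gD fg w; have [s ->] := bc_sum_ex w.
have h0 h : {morph h : x y / x + y} -> h (0 : AL) = 0 :> M.
  by move=> hD; apply: (addIr (h 0)); rewrite -hD !add0r.
rewrite (big_morph f fD (h0 _ fD)) (big_morph g gD (h0 _ gD)).
by apply: eq_bigr => p _.
Qed.

Definition bc_lift (M : zmodType) (b : A -> L -> M) (w : AL) : M :=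
  \sum_(p <- bc_repr w) b p.1 p.2.

Section LiftTheory.
Variables (M : zmodType) (b : A -> L -> M).
Hypothesis hb : balanced i b.

Lemma bc_liftE s : bc_lift b (bc_class i s) = \sum_(p <- s) b p.1 p.2.
Proof. exact: bc_reprP. Qed.

Lemma bc_liftD : {morph bc_lift b : v w / v + w}.
Proof.
move=> v w; have [s ->] := bc_ex v; have [t ->] := bc_ex w.
by rewrite bc_classD !bc_liftE big_cat.
Qed.

Lemma bc_lift_tensor a x : bc_lift b (a ⊗ x) = b a x.
Proof. by rewrite bc_liftE big_seq1. Qed.

End LiftTheory.

(** The map [l] (x) id, with k (x) L identified with L. *)
Definition bc_form (l : A -> k) : AL -> L := bc_lift (fun a x => i (l a) * x).

Section Form.
Variable l : A -> k.
Hypothesis ls : scalar l.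

Lemma bc_form_balanced : balanced i (fun a x => i (l a) * x).
Proof.
split=> [a a' x|a x x'|c a x]; first by rewrite scalar_funD // rmorphD mulrDl.
  by rewrite mulrDr.
by rewrite scalar_funZ // rmorphM mulrA [X in X * _]mulrC.
Qed.

Lemma bc_formD : {morph bc_form l : v w / v + w}.
Proof. exact: bc_liftD bc_form_balanced. Qed.

Lemma bc_form_tensor a x : bc_form l (a ⊗ x) = i (l a) * x.
Proof. exact: (bc_lift_tensor bc_form_balanced). Qed.

Lemma bc_form0 : bc_form l 0 = 0.
Proof. by apply: (addIr (bc_form l 0)); rewrite -bc_formD !add0r. Qed.

Lemma bc_form_sum (I : Type) (r : seq I) (F : I -> AL) :
  bc_form l (\sum_(j <- r) F j) = \sum_(j <- r) bc_form l (F j).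
Proof. exact: (big_morph _ bc_formD bc_form0). Qed.

Lemma bc_formZ y w : bc_form l (y *: w) = y * bc_form l w.
Proof.
have [s ->] := bc_sum_ex w; rewrite scaler_sumr !bc_form_sum mulr_sumr.
apply: eq_bigr => p _.
by rewrite scale_bc_tensor !bc_form_tensor mulrCA.
Qed.

End Form.

Lemma bc_form_expansion (w : AL) :
  exists E : seq ((A -> k) * A), (forall j, j \in E -> scalar j.1) /\
    w = \sum_(j <- E) j.2 ⊗ bc_form j.1 w.
Proof.
have [s ->] := bc_sum_ex w.
have [E [Es EP]] := finite_rank_projection [seq p.1 | p <- s].
exists E; split=> //.
transitivity (\sum_(p <- s) \sum_(j <- E) j.2 ⊗ (i (j.1 p.1) * p.2)).
  rewrite !big_seq; apply: eq_bigr => p ps.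
  rewrite {1}(EP p.1) ?map_f // bc_tensor_suml.
  by apply: eq_bigr => j _; rewrite bc_tensorZ.
rewrite exchange_big /= big_seq [RHS]big_seq; apply: eq_bigr => j jE.
rewrite -bc_tensor_sumr bc_form_sum; last exact: Es.
by congr (_ ⊗ _); apply: eq_bigr => p _; rewrite bc_form_tensor //; apply: Es.
Qed.

Lemma bc_form_eq0 (w : AL) : (forall l, scalar l -> bc_form l w = 0) -> w = 0.
Proof.
move=> w0; have [E [Es ->]] := bc_form_expansion w.
by rewrite big_seq big1 // => j jE; rewrite w0 ?bc_tensor0r //; apply: Es.
Qed.

Lemma bc_tensor_eq0 a : a ⊗ 1 = 0 -> a = 0.
Proof.
move=> a1; apply/eqP/negPn/negP => /exists_form1[l [ls la]].
have := bc_form_tensor ls a 1; rewrite a1 bc_form0 // la rmorph1 mulr1.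
by move/eqP; rewrite eq_sym oner_eq0.
Qed.

Lemma bc_tensor_inj a b : a ⊗ 1 = b ⊗ 1 -> a = b.
Proof.
move=> ab; apply/eqP; rewrite -subr_eq0; apply/eqP/bc_tensor_eq0.
by rewrite bc_tensorDl bc_tensorNl ab subrr.
Qed.

End Lift.

Section Map.
Context {A B : algType k}.
Local Notation "a ⊗ x" := (bc_tensor i a x) (at level 39).

Definition bc_map (f : A -> B) : basechange i A -> basechange i B :=
  bc_lift (fun a x => f a ⊗ x).

Section MapTheory.
Variable f : A -> B.
Hypothesis fl : linear f.

Lemma bc_map_balanced : balanced i (fun a x => f a ⊗ x).
Proof.
split=> [a a' x|a x x'|c a x]; first by rewrite linear_funD // bc_tensorDl.
  by rewrite bc_tensorDr.
by rewrite linear_funZ // bc_tensorZ.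
Qed.

Lemma bc_mapD : {morph bc_map f : v w / v + w}.
Proof. exact: bc_liftD bc_map_balanced. Qed.

Lemma bc_map_tensor a x : bc_map f (a ⊗ x) = f a ⊗ x.
Proof. exact: (bc_lift_tensor bc_map_balanced). Qed.

Lemma bc_mapZ y w : bc_map f (y *: w) = y *: bc_map f w.
Proof.
apply: (bc_additive_eq (f := fun w => bc_map f (y *: w))
  (g := fun w => y *: bc_map f w)).
- by move=> u v; rewrite scalerDr bc_mapD.
- by move=> u v; rewrite bc_mapD scalerDr.
- by move=> a x; rewrite !(scale_bc_tensor, bc_map_tensor).
Qed.

Lemma bc_map_linear : linear (bc_map f).
Proof. by move=> y v w; rewrite bc_mapD bc_mapZ. Qed.

End MapTheory.

Lemma bc_mapM (f : A -> B) : linear f -> {morph f : x y / x * y} ->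
  {morph bc_map f : v w / v * w}.
Proof.
move=> fl fM v w.
apply: (bc_additive_eq (f := fun w => bc_map f (v * w))
  (g := fun w => bc_map f v * bc_map f w)).
- by move=> x y; rewrite mulrDr bc_mapD.
- by move=> x y; rewrite bc_mapD // mulrDr.
move=> b y.
apply: (bc_additive_eq (f := fun v => bc_map f (v * (b ⊗ y)))
  (g := fun v => bc_map f v * bc_map f (b ⊗ y))).
- by move=> x z; rewrite mulrDl bc_mapD.
- by move=> x z; rewrite bc_mapD // mulrDl.
by move=> a x; rewrite bc_tensorM !bc_map_tensor // bc_tensorM fM.
Qed.

End Map.

Lemma bc_map_inj (A B : algType k) (f : A -> B) :
  linear f -> injective f -> injective (bc_map f).
Proof.
move=> fl fi.
have f0 w : bc_map f w = 0 -> w = 0.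
  have [s sE] := bc_sum_ex w.
  have [g [gl gP]] := finite_left_inverse [seq p.1 | p <- s] fl fi.
  suff e : bc_map g (bc_map f w) = w.
    by move=> fw; rewrite -e fw (linear_fun0 (bc_map_linear gl)).
  rewrite sE.
  rewrite (big_morph _ (bc_mapD fl) (linear_fun0 (bc_map_linear fl))).
  rewrite (big_morph _ (bc_mapD gl) (linear_fun0 (bc_map_linear gl))).
  rewrite !big_seq; apply: eq_bigr => p ps.
  by rewrite !bc_map_tensor // gP // map_f.
move=> v w /eqP; rewrite -subr_eq0 -(linear_funB (bc_map_linear fl)).
by move=> /eqP /f0 /eqP; rewrite subr_eq0 => /eqP.
Qed.

End BaseChangeTheory.

(** * Prime rings and their extended centroid *)

Section ElementwisePrimes.
Context {U : nzRingType}.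
Implicit Types (P : set U).

Definition elt_prime P : Prop :=
  forall a b, (forall x, P (a * x * b)) -> P a \/ P b.

(** Generated ideals are avoided: [B] consists of the z with a U z inside P, and [A] of the z with z
    U B inside P. Then a lies in A, and A B lies in P. *)
Lemma is_prime_elt P : is_prime P -> elt_prime P.
Proof.
move=> [[P0 PD PM] P1 PP] a b ab.
pose B : set U := [set z | forall x, P (a * x * z)].
pose A : set U := [set z | forall w x, B w -> P (z * x * w)].
have iB : is_ideal B.
  split=> [x|y z By Bz x|u z Bz]; first by rewrite mulr0.
    by rewrite mulrDr; apply: PD; [apply: By|apply: Bz].
  split=> x; first by rewrite mulrA -(mulrA a); apply: Bz.
  by rewrite mulrA; have [] := PM u _ (Bz x).
have iA : is_ideal A.
  split=> [w x _|y z Ay Az w x Bw|u z Az]; first by rewrite !mul0r.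
    by rewrite !mulrDl; apply: PD; [apply: Ay|apply: Az].
  split=> w x Bw; last by rewrite -(mulrA z); apply: Az.
  by rewrite -!mulrA; have [] := PM u _ (Az w x Bw); rewrite -!mulrA.
have [|AP|BP] := PP A B iA iB.
- move=> _ [s [sP ->]]; apply: is_ideal_sum => // p /sP[Ap Bp].
  by have := Ap _ 1 Bp; rewrite mulr1.
- by left; apply: AP => w x; apply.
- by right; apply: BP.
Qed.

Lemma elt_prime_is_prime P : is_ideal P -> ~ P 1 -> elt_prime P -> is_prime P.
Proof.
move=> iP P1 PP; split=> // A B [A0 AD AM] _ ABP.
have [AP|nAP] := pselect (A `<=` P); [by left|right=> b Bb].
apply: contrapT => nPb; apply: nAP => a Aa.
have [x|//|//] := PP a b.
by apply: ABP; apply: ideal_prodMr => //; have [] := AM x _ Aa.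
Qed.

End ElementwisePrimes.

Definition prime_ring (U : nzRingType) : Prop := elt_prime [set (0 : U)].

Lemma to_quot_eq0 (U : nzRingType) (P : proper_ideal U) x :
  to_quot P x = 0 <-> ideal_set P x.
Proof. by rewrite -[0]/(to_quot P 0) quotP subr0. Qed.

Lemma prime_ring_quot (U : nzRingType) (P : proper_ideal U) :
  elt_prime (ideal_set P) -> prime_ring (quot P).
Proof.
move=> PP p q; have [a ->] := quot_ex p; have [b ->] := quot_ex q => ab.
have [x|/to_quot_eq0 ->|/to_quot_eq0 ->] := PP a b; [|by left|by right].
by apply/to_quot_eq0; rewrite !rmorphM; apply: ab.
Qed.

Section Amring.
Context {U : nzRingType}.
Implicit Types (p q : amring U) (a b u : U) (J : set U).

Definition am_in a : amring U := amclass (parthom_lmul a).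

Lemma am_inD : {morph am_in : a b / a + b}.
Proof.
by move=> a b; rewrite amclassD; apply: amclass_eq => x _ _ /=; rewrite mulrDl.
Qed.

Lemma am_inM : {morph am_in : a b / a * b}.
Proof.
by move=> a b; rewrite amclassM; apply: amclass_eq => x _ _ /=; rewrite mulrA.
Qed.

HB.instance Definition _ :=
  GRing.isZmodMorphism.Build U (amring U) am_in (morphD_zmod am_inD).
HB.instance Definition _ :=
  GRing.isMonoidMorphism.Build U (amring U) am_in (erefl, am_inM).

Lemma am_in_inj : injective am_in.
Proof.
move=> a b /amclassP[J [[_ J0] _ JP]]; apply/eqP; rewrite -subr_eq0; apply/eqP.
by apply: J0 => x /JP /= ab; rewrite mulrBl ab subrr.
Qed.

Lemma amclass_in (f : parthom U) a : ph_dom f a -> amclass f * am_in a = am_in (f a).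
Proof.
move=> fa; rewrite amclassM; apply: amclass_eq => x _ _ /=.
by rewrite ph_funM.
Qed.

Lemma am_dom q : exists2 J, in_filter J &
  forall a, J a -> exists b, q * am_in a = am_in b.
Proof.
have [f ->] := amring_ex q; exists (ph_dom f); first exact: ph_domP.
by move=> a fa; exists (f a); rewrite amclass_in.
Qed.

Lemma am_eq0 q J : in_filter J -> (forall a, J a -> q * am_in a = 0) -> q = 0.
Proof.
have [f ->] := amring_ex q => fJ q0; apply/amclassP.
exists (J `&` ph_dom f); split.
- by apply: in_filterI => //; exact: ph_domP.
- by move=> x [Jx fx].
- move=> x [Jx fx] /=; apply: am_in_inj; rewrite -amclass_in // rmorph0.
  exact: q0.
Qed.

Lemma in_filter_neq0 J : in_filter J -> exists2 a, J a & a != 0.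
Proof.
move=> [_ J0]; apply: contrapT => nJ.
have /eqP := oner_neq0 U; apply; apply: J0 => x Jx; rewrite mul1r.
by apply: contrapT => /eqP x0; apply: nJ; exists x.
Qed.

End Amring.

Section AmringAlgebra.
Context {k : fieldType} {A : algType k}.

Lemma am_in_linear : linear (@am_in A).
Proof.
move=> c a b; rewrite rmorphD; congr (_ + _); rewrite amclassZ.
by apply: amclass_eq => x _ _ /=; rewrite scalerAl.
Qed.

Lemma ec_val_linear : linear (@ec_val A).
Proof. by move=> c p q; rewrite ec_valD ec_valZ. Qed.

End AmringAlgebra.

Lemma ec_valB (U : nzRingType) (c d : extcentroid U) :
  ec_val (c - d) = ec_val c - ec_val d.
Proof. exact: (raddfB val). Qed.

Lemma ec_val_inj (U : nzRingType) : injective (@ec_val U).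
Proof. by move=> c d cd; apply: val_inj. Qed.

Lemma ec_valC (U : nzRingType) (c : extcentroid U) q : ec_val c * q = q * ec_val c.
Proof. exact: (am_centerP _ (ec_valP c)). Qed.

Lemma ec_dom (U : nzRingType) (c : extcentroid U) : exists2 J, in_filter J &
  forall a, J a -> exists b, ec_val c * am_in a = am_in b.
Proof. exact: am_dom. Qed.

Section PrimeExtendedCentroid.
Context {U : nzRingType}.
Hypothesis prU : prime_ring U.
Implicit Types (a b x : U) (c d : extcentroid U) (q : amring U) (J : set U).

Lemma prime_neq0 a b : a != 0 -> b != 0 -> exists x, a * x * b != 0.
Proof.
move=> /eqP a0 /eqP b0; apply: contrapT => nx.
have [x|//|//] := prU (a := a) (b := b).
by apply: contrapT => /eqP abx; apply: nx; exists x.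
Qed.

Lemma in_filter_prime J a : is_ideal J -> J a -> a != 0 -> in_filter J.
Proof.
move=> iJ Ja /eqP a0; split=> // u uJ.
have [x|//|//] := prU (a := u) (b := a); rewrite /= -mulrA; apply: uJ.
by have [_ _ JM] := iJ; have [] := JM x _ Ja.
Qed.

(** An ideal that [q] multiplies into U reduces this to primeness of U. *)
Lemma am_lregular a q : a != 0 -> (forall x, am_in (a * x) * q = 0) -> q = 0.
Proof.
move=> /eqP a0 aq; have [J fJ JP] := am_dom q; apply: (am_eq0 fJ) => u Ju.
have [v quv] := JP u Ju; rewrite quv; have [x|//|->] := prU (a := a) (b := v).
  by apply: am_in_inj; rewrite am_inM -quv mulrA aq mul0r rmorph0.
by rewrite rmorph0.
Qed.

Lemma ec_mul_eq0 c a : ec_val c * am_in a = 0 -> a != 0 -> c = 0.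
Proof.
move=> ca a0; apply: val_inj; apply: (am_lregular a0) => x.
by rewrite -ec_valC am_inM mulrA ca mul0r.
Qed.

Lemma ec_eq c d a q : ec_val c * am_in a = q -> ec_val d * am_in a = q ->
  a != 0 -> c = d.
Proof.
move=> ca da a0; apply/eqP; rewrite -subr_eq0; apply/eqP.
apply: (@ec_mul_eq0 _ a) => //; rewrite ec_valB.
by rewrite mulrBl ca da subrr.
Qed.

(* The pairs (z, z') "compatible with S" form the graph of a bimodule
   homomorphism from a nonzero ideal, so no generators need be chosen. *)
Lemma ec_of_pairs (S : U -> U -> Prop) :
  (forall v v' w w' x, S v v' -> S w w' -> v * x * w' = v' * x * w) ->
  (exists v v', S v v' /\ v != 0) ->
  exists c, forall v v', S v v' -> ec_val c * am_in v = am_in v'.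
Proof.
move=> SP [v0 [v0' [S0 v00]]].
(* [G] collects every pair compatible with [S]. Unlike [S] it is closed under sums and two-sided
   multiplication, and the pair with [v0 != 0] makes it single-valued. *)
pose G z z' := forall w w' x, S w w' -> z * x * w' = z' * x * w.
have Gu z y y' : G z y -> G z y' -> y = y'.
  move=> Gy Gy'; apply/eqP; rewrite -subr_eq0; apply/eqP.
  have [x|//|/eqP] := prU (a := y - y') (b := v0); last by rewrite (negPf v00).
  by rewrite /= !mulrBl -(Gy _ _ _ S0) -(Gy' _ _ _ S0) subrr.
have GD z z' y y' : G z z' -> G y y' -> G (z + y) (z' + y').
  by move=> Gz Gy w w' x Sw; rewrite !mulrDl (Gz _ _ _ Sw) (Gy _ _ _ Sw).
have GMl z z' u : G z z' -> G (u * z) (u * z').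
  by move=> Gz w w' x Sw; rewrite -!mulrA mulrA !mulrA -!(mulrA u) (Gz _ _ _ Sw).
have GMr z z' u : G z z' -> G (z * u) (z' * u).
  by move=> Gz w w' x Sw; rewrite -(mulrA z) -(mulrA z') (Gz _ _ _ Sw).
have GS v v' : S v v' -> G v v' by move=> Sv w w' x Sw; apply: SP.
pose J : set U := [set z | exists z', G z z'].
pose f z := if pselect (J z) is left Jz then sval (cid Jz) else 0.
have fG z : J z -> G z (f z).
  by move=> Jz; rewrite /f; case: pselect => // Jz'; apply: (svalP (cid Jz')).
have fE z z' : G z z' -> f z = z'.
  by move=> Gz; apply: (Gu z) => //; apply: fG; exists z'.
have fJ : in_filter J.
  apply: (@in_filter_prime _ v0) => //; last by exists v0'; apply: GS.
  split; first by exists 0 => w w' x _; rewrite !mul0r.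
    by move=> z y [z' Gz] [y' Gy]; exists (z' + y'); apply: GD.
  move=> u z [z' Gz]; split; first by exists (u * z'); apply: GMl.
  by exists (z' * u); apply: GMr.
have fP : is_parthom J f.
  split=> // [z y /fG Gz /fG Gy|z u /fG Gz]; first by apply/fE/GD.
  exact/fE/GMr.
pose p := amclass (mk_parthom fP).
have pin z : J z -> p * am_in z = am_in (f z) by move=> Jz; rewrite amclass_in.
(* Closure under left multiplication makes [p] commute with U; an ideal that [q] multiplies into U
   then extends this to every [q]. *)
have pC u : p * am_in u = am_in u * p.
  apply/eqP; rewrite -subr_eq0; apply/eqP; apply: (am_eq0 fJ) => z Jz.
  rewrite mulrBl -!mulrA pin // -!am_inM pin; last first.
    by have [_ _ JM] := fJ.1; have [] := JM u _ Jz.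
  by rewrite (fE _ _ (GMl _ _ u (fG _ Jz))) subrr.
have pc : p \in am_center.
  apply/am_centerP => q; apply/eqP; rewrite -subr_eq0; apply/eqP.
  have [I fI IP] := am_dom q.
  apply: (am_eq0 fI) => a /IP[b qa].
  by rewrite mulrBl -mulrA qa pC -mulrA pC mulrA qa subrr.
exists (ExtCentroid pc) => v v' Sv /=.
by rewrite pin ?(fE _ _ (GS _ _ Sv)) //; exists v'; apply: GS.
Qed.

(** The inverse is the graph of multiplication by [c], read backwards. *)
Lemma ec_inv_ex c : c != 0 -> exists d, d * c = 1.
Proof.
move=> c0; have [J fJ JP] := ec_dom c.
have [||d dP] := @ec_of_pairs (fun v' v => ec_val c * am_in v = am_in v').
- move=> v v' w w' x /= cv cw; apply: am_in_inj.
  by rewrite !am_inM -cv -cw (ec_valC c (am_in w'))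
    !mulrA -!(mulrA (ec_val c)) ec_valC.
- apply: contrapT => nv; move/eqP: c0; apply; apply: val_inj.
  apply: (am_eq0 fJ) => a Ja; have [b cab] := JP a Ja; rewrite cab.
  apply: contrapT => b0; apply: nv; exists b, a; split=> //.
  by apply/eqP => b00; apply: b0; rewrite b00 rmorph0.
exists d; apply: ec_val_inj; apply/eqP; rewrite -subr_eq0; apply/eqP.
apply: (am_eq0 fJ) => a Ja; have [b cab] := JP a Ja.
rewrite ec_valM ec_val1.
by rewrite mulrBl -mulrA cab (dP _ _ cab) mul1r subrr.
Qed.

End PrimeExtendedCentroid.

(** * Martindale's lemma *)

Section Multiplications.
Context {U : nzRingType}.
Implicit Types (m : seq (U * U)) (a : U).

(** An element of the multiplication ring of U, kept as a list so that one [m] can act on U, on its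
    ring of quotients and on base changes. *)
Definition mult (B : nzRingType) (h : U -> B) m (n : B) : B :=
  \sum_(p <- m) h p.1 * n * h p.2.

Definition mult_l a m := [seq (a * p.1, p.2) | p <- m].
Definition mult_r m a := [seq (p.1, p.2 * a) | p <- m].

Section Theory.
Context {B : nzRingType} (h : {rmorphism U -> B}).

Lemma multD m : {morph mult h m : x y / x + y}.
Proof.
move=> x y; rewrite /mult -big_split; apply: eq_bigr => p _ /=.
by rewrite mulrDr mulrDl.
Qed.

Lemma mult0 m : mult h m 0 = 0.
Proof. by apply: (addIr (mult h m 0)); rewrite -multD !add0r. Qed.

Lemma multN m x : mult h m (- x) = - mult h m x.
Proof. by apply: (addIr (mult h m x)); rewrite -multD !addNr mult0. Qed.

Lemma mult_sum m (I : Type) (r : seq I) (P : pred I) (F : I -> B) :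
  mult h m (\sum_(j <- r | P j) F j) = \sum_(j <- r | P j) mult h m (F j).
Proof. exact: (big_morph _ (multD m) (mult0 m)). Qed.

Lemma mult_central m z n : (forall b, z * b = b * z) ->
  mult h m (z * n) = z * mult h m n.
Proof.
move=> zC; rewrite /mult mulr_sumr; apply: eq_bigr => p _.
by rewrite !mulrA -zC.
Qed.

Lemma mult_cat m m' n : mult h (m ++ m') n = mult h m n + mult h m' n.
Proof. by rewrite /mult big_cat. Qed.

Lemma multE_l a m n : mult h (mult_l a m) n = h a * mult h m n.
Proof.
rewrite /mult big_map mulr_sumr; apply: eq_bigr => p _ /=.
by rewrite rmorphM !mulrA.
Qed.

Lemma multE_r a m n : mult h (mult_r m a) n = mult h m n * h a.
Proof.
rewrite /mult big_map mulr_suml; apply: eq_bigr => p _ /=.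
by rewrite rmorphM !mulrA.
Qed.

Lemma mult_id n : mult h [:: (1, 1)] n = n.
Proof. by rewrite /mult big_seq1 rmorph1 mul1r mulr1. Qed.

End Theory.

Lemma mult_morph (B B' : nzRingType) (h : U -> B) (h' : U -> B')
    (g : {rmorphism B -> B'}) m n :
  (forall u, g (h u) = h' u) -> g (mult h m n) = mult h' m (g n).
Proof.
move=> gh; rewrite /mult rmorph_sum; apply: eq_bigr => p _.
by rewrite !rmorphM !gh.
Qed.

End Multiplications.

Section Martindale.
Context {U : nzRingType}.
Hypothesis prU : prime_ring U.
Implicit Types (m : seq (U * U)) (a u x : U) (e : nat -> U)
  (M : nat -> seq (U * U)).

Local Notation opU := (mult (@idfun U)).
Local Notation opQ := (mult (@am_in U)).

(* The multiplications M j behave as dual to the e j, which forces the e j to be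
   linearly independent over the extended centroid. *)
Definition dual_system n e M : Prop :=
  forall i j, (i < n)%N -> (j < n)%N ->
    (opU (M j) (e i) == 0) = (i != j).

Lemma dual_system_diag n e M j : dual_system n e M -> (j < n)%N ->
  opU (M j) (e j) != 0.
Proof. by move=> De jn; rewrite De // eqxx. Qed.

Lemma dual_system_off n e M i j : dual_system n e M -> (i < n)%N -> (j < n)%N ->
  i != j -> opU (M j) (e i) = 0.
Proof. by move=> De lin jn ij; apply/eqP; rewrite De. Qed.

Lemma opQ_in m a : opQ m (am_in a) = am_in (opU m a).
Proof. by rewrite (mult_morph (g := @am_in U) (h' := @am_in U)). Qed.

(** By induction on t, m(v) = 0 as soon as m kills the e_j with j >= t. At t = n nothing is required
    of m, so the identity multiplication gives v = 0. *)
Lemma dual_system_kill n e M (v : amring U) : dual_system n e M ->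
  (forall j, (j < n)%N -> opQ (M j) v = 0) ->
  (forall m, (forall j, (j < n)%N -> opU m (e j) = 0) -> opQ m v = 0) ->
  v = 0.
Proof.
move=> De Mv Kv.
have kill t : (t <= n)%N -> forall m,
    (forall j, (t <= j < n)%N -> opU m (e j) = 0) -> opQ m v = 0.
  elim: t => [_ m mP|t IHt tn m mP]; first by apply: Kv => j jn; apply: mP.
  apply: (am_lregular prU (dual_system_diag De tn)) => x.
  (* [m'] is y |-> M_t(e_t) x m(y) - M_t(y) x m(e_t), which also kills e_t. On v its second term
     vanishes, so M_t(e_t) x m(v) = 0 for all x. *)
  pose m' := mult_l (opU (M t) (e t) * x) m
             ++ mult_r (M t) (- (x * opU m (e t))).
  have := IHt (ltnW tn) m'; rewrite mult_cat multE_l multE_r Mv // mul0r addr0.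
  apply=> j /andP[tj jn]; rewrite mult_cat multE_l multE_r /= mulrN.
  have [->|jt] := eqVneq j t; first by rewrite mulrA subrr.
  rewrite (dual_system_off De jn tn jt) mP ?mulr0 ?mul0r ?subrr //.
  by rewrite ltn_neqAle eq_sym jt tj.
have := kill n (leqnn n) [:: (1, 1)]; rewrite mult_id; apply=> j.
by case/andP=> nj; rewrite ltnNge nj.
Qed.

(** Either some multiplication kills every e_j but not u, and u joins the system, or every
    multiplication killing the e_j kills u, and u lies in their span over the extended centroid. *)
Lemma dual_system_exists (s : seq U) : exists n e M, dual_system n e M /\
  forall u, u \in s -> exists c : nat -> extcentroid U,
    am_in u = \sum_(j < n) ec_val (c j) * am_in (e j).
Proof.
elim: s => [|u s [n [e [M [De sP]]]]].
  exists 0%N, (fun=> 0), (fun=> [::]).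
  by split=> [i j|u]; rewrite ?ltn0 ?in_nil.
have [[m [mK mu]]|nm] :=
    pselect (exists m, (forall j, (j < n)%N -> opU m (e j) = 0) /\ opU m u != 0).
  have xP j : exists x, (j < n)%N -> opU m u * x * opU (M j) (e j) != 0.
    have [jn|_] := ltnP j n; last by exists 0.
    have [x xP] := prime_neq0 prU mu (dual_system_diag De jn).
    by exists x.
  have [x {}xP] := choice xP.
  (* The correction makes [M' j] vanish on u. As m kills e_j, its value there is m(u) x_j M_j(e_j),
     nonzero by the choice of x_j. *)
  pose M' j := mult_l (opU m u * x j) (M j)
               ++ mult_r m (- (x j * opU (M j) u)).
  have M'E j v : opU (M' j) v =
      opU m u * x j * opU (M j) v - opU m v * (x j * opU (M j) u).
    by rewrite mult_cat multE_l multE_r mulrN.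
  exists n.+1, (fun j => if j == n then u else e j),
    (fun j => if j == n then m else M' j); split.
    move=> i j; rewrite ltnS leq_eqVlt ltnS (leq_eqVlt j).
    move=> /orP[/eqP ->|lin] /orP[/eqP ->|ljn].
    - by rewrite !eqxx (negPf mu).
    - rewrite eqxx (ltn_eqF ljn) (gtn_eqF ljn).
      by rewrite M'E mulrA subrr eqxx.
    - by rewrite eqxx (ltn_eqF lin) mK // eqxx.
    - rewrite (ltn_eqF lin) (ltn_eqF ljn) M'E (mK i) // mul0r subr0.
      have [->|ij] := eqVneq i j; first by rewrite (negPf (xP j ljn)).
      by rewrite (dual_system_off De lin ljn ij) mulr0 eqxx.
  have e'E (c : nat -> extcentroid U) d :
      \sum_(j < n.+1) ec_val (if j == n :> nat then d else c j)
      * am_in (if j == n :> nat then u else e j)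
      = \sum_(j < n) ec_val (c j) * am_in (e j) + ec_val d * am_in u.
    rewrite big_ord_recr /= eqxx; congr (_ + _); apply: eq_bigr => j _.
    by rewrite ltn_eqF.
  move=> v; rewrite inE => /orP[/eqP ->|/sP[c cE]].
    exists (fun j => if j == n then 1 else 0).
    rewrite (e'E (fun=> 0)) ec_val1 mul1r big1 ?add0r // => j _.
    by rewrite [ec_val 0](rmorph0 val) mul0r.
  exists (fun j => if j == n then 0 else c j).
  by rewrite e'E [ec_val 0](rmorph0 val) mul0r addr0.
have uK m : (forall j, (j < n)%N -> opU m (e j) = 0) -> opU m u = 0.
  by move=> mK; apply: contrapT => /eqP mu; apply: nm; exists m.
exists n, e, M; split=> // v; rewrite inE => /orP[/eqP ->{v}|/sP//].
have cP j : exists c : extcentroid U, (j < n)%N ->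
    ec_val c * am_in (opU (M j) (e j)) = am_in (opU (M j) u).
  have [jn|_] := ltnP j n; last by exists 0.
  (* The coefficient of e_j is m(u) over m(e_j) for any m killing the other e_i. Two choices agree
     because y |-> m(e_j) x m'(y) - m(y) x m'(e_j) kills all the e_i, hence u. *)
  have [||c cP] := ec_of_pairs prU (S := fun v v' => exists m,
    [/\ forall i, (i < n)%N -> i != j -> opU m (e i) = 0,
        v = opU m (e j) & v' = opU m u]).
  - move=> v v' w w' x [m [mK -> ->]] [m' [m'K -> ->]].
    have := uK (mult_l (opU m (e j) * x) m' ++ mult_r m (- (x * opU m' (e j)))).
    rewrite mult_cat multE_l multE_r mulrN mulrA => /(_ _)/eqP.
    rewrite subr_eq0 => /(_ _)/eqP; apply=> i lin.
    rewrite mult_cat multE_l multE_r mulrN mulrA.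
    have [->|ij] := eqVneq i j; first by rewrite subrr.
    by rewrite (mK i) // (m'K i) // mulr0 !mul0r subrr.
  - exists (opU (M j) (e j)), (opU (M j) u); split.
      exists (M j); split=> // i lin ij.
      exact: (dual_system_off De).
    exact: (dual_system_diag De).
  exists c => _; apply: cP; exists (M j); split=> // i lin ij.
  exact: (dual_system_off De).
have [c {}cP] := choice cP; exists c.
apply/eqP; rewrite -subr_eq0; apply/eqP.
have opE m : opQ m (am_in u - \sum_(j < n) ec_val (c j) * am_in (e j)) =
    am_in (opU m u) - \sum_(j < n) ec_val (c j) * am_in (opU m (e j)).
  rewrite multD opQ_in -sumrN mult_sum -sumrN; congr (_ + _).
  apply: eq_bigr => j _.
  by rewrite multN mult_central ?opQ_in //; exact: ec_valC.
apply: (dual_system_kill De) => [j jn|m mK]; rewrite opE.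
  rewrite (bigD1 (Ordinal jn)) //= cP // big1 ?addr0 ?subrr // => i ij.
  by rewrite (dual_system_off De (ltn_ord i) jn) // rmorph0 mulr0.
by rewrite uK // rmorph0 big1 ?subr0 // => j _; rewrite mK // rmorph0 mulr0.
Qed.

End Martindale.

(** * Contraction of primes to the extended centroid *)

Section BaseChangeInclusion.
Context {k L : fieldType} (i : {rmorphism k -> L}) {A : algType k}.

Definition bc_in (a : A) : basechange i A := bc_tensor i a 1.

Lemma bc_inD : {morph bc_in : a b / a + b}.
Proof. by move=> a b; rewrite /bc_in bc_tensorDl. Qed.

Lemma bc_inM : {morph bc_in : a b / a * b}.
Proof. by move=> a b; rewrite /bc_in bc_tensorM mulr1. Qed.

Lemma bc_in1 : bc_in 1 = 1.
Proof. by []. Qed.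

HB.instance Definition _ :=
  GRing.isZmodMorphism.Build A (basechange i A) bc_in (morphD_zmod bc_inD).
HB.instance Definition _ :=
  GRing.isMonoidMorphism.Build A (basechange i A) bc_in (bc_in1, bc_inM).

Lemma bc_tensor_in a x : bc_tensor i a x = x *: bc_in a.
Proof. by rewrite scale_bc_tensor mulr1. Qed.

Lemma bc_in_sum_ex (w : basechange i A) :
  exists s : seq (A * L), w = \sum_(p <- s) p.2 *: bc_in p.1.
Proof.
have [s ->] := bc_sum_ex w; exists s.
by apply: eq_bigr => p _; rewrite bc_tensor_in.
Qed.

End BaseChangeInclusion.

Section Commutative.
Context {k L : fieldType} (i : {rmorphism k -> L}).

Lemma bc_mulC (A : algType k) : (forall a b : A, a * b = b * a) ->
  forall s t : basechange i A, s * t = t * s.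
Proof.
move=> AC s; apply: bc_additive_eq => [x y|x y|b y]; rewrite ?mulrDl ?mulrDr //.
move: s; apply: bc_additive_eq => [x z|x z|a x]; rewrite ?mulrDl ?mulrDr //.
by rewrite !bc_tensorM AC mulrC.
Qed.

End Commutative.

Section Correspondence.
Context {k L : fieldType} (i : {rmorphism k -> L}) {U : algType k}.

Local Notation W := (basechange i U).
Local Notation C := (extcentroid U).
Local Notation T := (basechange i C).
Local Notation N := (basechange i (amring U)).

Definition embW (w : W) : N := bc_map (@am_in U) w.
Definition embT (t : T) : N := bc_map (@ec_val U) t.

HB.instance Definition _ := GRing.isZmodMorphism.Build W N embW
  (morphD_zmod (bc_mapD (@am_in_linear _ U))).
HB.instance Definition _ := GRing.isMonoidMorphism.Build W N embW
  (bc_map_tensor i (@am_in_linear _ U) 1 1,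
   bc_mapM (@am_in_linear _ U) (@am_inM U)).
HB.instance Definition _ := GRing.isZmodMorphism.Build T N embT
  (morphD_zmod (bc_mapD (@ec_val_linear _ U))).
HB.instance Definition _ := GRing.isMonoidMorphism.Build T N embT
  (bc_map_tensor i (@ec_val_linear _ U) 1 1,
   bc_mapM (@ec_val_linear _ U) (@ec_valM U)).

Lemma embWD : {morph embW : v w / v + w}.
Proof. exact: rmorphD. Qed.
Lemma embWM : {morph embW : v w / v * w}.
Proof. exact: rmorphM. Qed.
Lemma embTD : {morph embT : s t / s + t}.
Proof. exact: rmorphD. Qed.
Lemma embTM : {morph embT : s t / s * t}.
Proof. exact: rmorphM. Qed.

Lemma embTB : {morph embT : s t / s - t}.
Proof. exact: rmorphB. Qed.
Lemma embW_sum (I : Type) (r : seq I) (P : pred I) (F : I -> W) :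
  embW (\sum_(j <- r | P j) F j) = \sum_(j <- r | P j) embW (F j).
Proof. exact: rmorph_sum. Qed.
Lemma embT_sum (I : Type) (r : seq I) (P : pred I) (F : I -> T) :
  embT (\sum_(j <- r | P j) F j) = \sum_(j <- r | P j) embT (F j).
Proof. exact: rmorph_sum. Qed.

Definition embU (u : U) : N := embW (bc_in i u).

Lemma embUD : {morph embU : u v / u + v}.
Proof. by move=> u v; rewrite /embU bc_inD embWD. Qed.
Lemma embUM : {morph embU : u v / u * v}.
Proof. by move=> u v; rewrite /embU bc_inM embWM. Qed.

HB.instance Definition _ := GRing.isZmodMorphism.Build U N embU (morphD_zmod embUD).
HB.instance Definition _ := GRing.isMonoidMorphism.Build U N embU
  (bc_map_tensor i (@am_in_linear _ U) 1 1, embUM).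

Lemma embUE u : embU u = bc_tensor i (am_in u) 1.
Proof. by rewrite /embU /embW bc_map_tensor //; exact: am_in_linear. Qed.

Lemma embWE a x : embW (bc_tensor i a x) = bc_tensor i (am_in a) x.
Proof. by rewrite /embW bc_map_tensor //; exact: am_in_linear. Qed.

Lemma embTE c x : embT (bc_tensor i c x) = bc_tensor i (ec_val c) x.
Proof. by rewrite /embT bc_map_tensor //; exact: ec_val_linear. Qed.

Lemma embWZ y w : embW (y *: w) = y *: embW w.
Proof. exact: (bc_mapZ (@am_in_linear _ U)). Qed.

Lemma embTZ y t : embT (y *: t) = y *: embT t.
Proof. exact: (bc_mapZ (@ec_val_linear _ U)). Qed.

Lemma embW_inj : injective embW.
Proof. exact: bc_map_inj (@am_in_linear _ U) (@am_in_inj U). Qed.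

Lemma embTC t n : embT t * n = n * embT t.
Proof.
move: n; apply: bc_additive_eq => [x y|x y|q y]; rewrite ?mulrDl ?mulrDr //.
move: t; apply: bc_additive_eq => [x z|x z|c x];
  rewrite ?embTD ?mulrDl ?mulrDr //.
by rewrite embTE !bc_tensorM ec_valC mulrC.
Qed.

Lemma bc_ec_mulC (s t : T) : s * t = t * s.
Proof. by apply: bc_mulC => c d; rewrite mulrC. Qed.

Lemma embT_dom (ts : seq T) : exists2 J, in_filter J &
  forall a t, J a -> t \in ts -> exists w, embT t * embU a = embW w.
Proof.
have dom1 t : exists2 J, in_filter J &
    forall a, J a -> exists w, embT t * embU a = embW w.
  have [s ->] := bc_sum_ex t; elim: s => [|[c x] s [J fJ JP]].
    exists [set: U]; first exact: in_filterT.
    by move=> a _; exists 0; rewrite big_nil !rmorph0 mul0r.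
  have [I fI IP] := ec_dom c; exists (I `&` J); first exact: in_filterI.
  move=> a [Ia Ja]; have [b cab] := IP a Ia; have [w wP] := JP a Ja.
  exists (bc_tensor i b x + w); rewrite big_cons embTD embWD mulrDl wP.
  by rewrite embWE embTE embUE bc_tensorM mulr1 cab.
elim: ts => [|t ts [J fJ JP]]; first by exists [set: U]; [exact: in_filterT|].
have [I fI IP] := dom1 t; exists (I `&` J); first exact: in_filterI.
move=> a t' [Ia Ja]; rewrite inE => /orP[/eqP ->|]; first exact: IP.
exact: JP.
Qed.

Lemma embT_dom_neq0 (ts : seq T) : exists2 a : U, a != 0 &
  forall t, t \in ts -> exists w, embT t * embU a = embW w.
Proof.
have [J fJ JP] := embT_dom ts; have [a Ja a0] := in_filter_neq0 fJ.
by exists a => // t; exact: JP.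
Qed.

Hypothesis prU : prime_ring U.

(** The map c |-> c b is linear and injective on the extended centroid, and injectivity survives
    base change. *)
Lemma embU_embT_eq0 b t : b != 0 -> embU b * embT t = 0 -> t = 0.
Proof.
move=> b0; pose f (c : C) := ec_val c * am_in b.
have fl : linear f.
  by move=> x c d; rewrite /f ec_val_linear mulrDl -scalerAl.
have fi : injective f by move=> c d cd; apply: (ec_eq prU cd).
have -> : embU b * embT t = bc_map f t.
  move: t; apply: bc_additive_eq => [x y|x y|c x].
  - by rewrite embTD mulrDr.
  - exact: (bc_mapD fl).
  - by rewrite embTE embUE bc_tensorM mul1r bc_map_tensor // /f ec_valC.
move=> ft; apply: (bc_map_inj fl fi).
by rewrite ft (linear_fun0 (bc_map_linear fl)).
Qed.

Lemma embU_expansion n (e : nat -> U) (c : nat -> C) u :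
  am_in u = \sum_(j < n) ec_val (c j) * am_in (e j) ->
  embW (bc_in i u) = \sum_(j < n) embU (e j) * embT (bc_in i (c j)).
Proof.
move=> uE; rewrite -/(embU u) embUE uE bc_tensor_suml; apply: eq_bigr => j _.
by rewrite embUE embTE bc_tensorM mulr1 ec_valC.
Qed.

(** A single dual system for [b] and [w] allows their coefficients at the same e_j to be compared;
    [heart_surj] reads a fraction off this comparison. *)
Lemma dual_expansion2 (b : U) (w : W) :
  exists n e M (c : nat -> C) (tau : nat -> T), [/\ dual_system n e M,
    am_in b = \sum_(j < n) ec_val (c j) * am_in (e j) &
    embW w = \sum_(j < n) embU (e j) * embT (tau j)].
Proof.
have [s ->] := bc_sum_ex w.
have [n [e [M [De sP]]]] := dual_system_exists prU (b :: [seq p.1 | p <- s]).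
have /choice[c cP] : forall u, exists c : nat -> C,
    u \in b :: [seq p.1 | p <- s] ->
    am_in u = \sum_(j < n) ec_val (c j) * am_in (e j).
  move=> u; have [us|_] := boolP (u \in b :: [seq p.1 | p <- s]).
    by have [c cP] := sP u us; exists c.
  by exists (fun=> 0).
exists n, e, M, (c b), (fun j => \sum_(p <- s) bc_tensor i (c p.1 j) p.2).
split=> //; first by apply: cP; rewrite mem_head.
transitivity (\sum_(p <- s) \sum_(j < n)
    bc_tensor i (ec_val (c p.1 j) * am_in (e j)) p.2).
  rewrite embW_sum !big_seq; apply: eq_bigr => p ps.
  by rewrite embWE cP ?bc_tensor_suml // inE map_f ?orbT.
rewrite exchange_big; apply: eq_bigr => j _ /=.
rewrite embT_sum mulr_sumr; apply: eq_bigr => p _.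
by rewrite embTE embUE bc_tensorM mul1r ec_valC.
Qed.

Lemma dual_expansion (w : W) : exists n e M (tau : nat -> T),
  dual_system n e M /\ embW w = \sum_(j < n) embU (e j) * embT (tau j).
Proof.
have [n [e [M [_ [tau [De _ wE]]]]]] := dual_expansion2 0 w.
by exists n, e, M, tau.
Qed.

Lemma dual_expansion_neq0 n (e : nat -> U) (c : nat -> C) b : b != 0 ->
  am_in b = \sum_(j < n) ec_val (c j) * am_in (e j) ->
  exists2 j, (j < n)%N & c j != 0.
Proof.
move=> b0 bE; apply: contrapT => nj; move/eqP: b0; apply; apply: am_in_inj.
rewrite bE rmorph0 big1 // => j _.
have -> : c j = 0; last by rewrite [ec_val 0](rmorph0 val) mul0r.
by apply: contrapT => /eqP cj; apply: nj; exists j.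
Qed.

Lemma embU_mult m u : embU (mult idfun m u) = mult embU m (embU u).
Proof. exact: mult_morph. Qed.

Lemma mult_in_expansion n e M (tau : nat -> T) w j : dual_system n e M ->
  embW w = \sum_(j < n) embU (e j) * embT (tau j) -> (j < n)%N ->
  embW (mult (@bc_in _ _ i U) (M j) w) =
  embU (mult idfun (M j) (e j)) * embT (tau j).
Proof.
move=> De wE jn.
have -> : embW (mult (@bc_in _ _ i U) (M j) w) = mult embU (M j) (embW w).
  exact: mult_morph.
rewrite wE mult_sum.
have mE l : mult embU (M j) (embU (e l) * embT (tau l)) =
    embU (mult idfun (M j) (e l)) * embT (tau l).
  rewrite -embTC mult_central; last exact: embTC.
  by rewrite -embU_mult embTC.
rewrite (bigD1 (Ordinal jn)) //= [X in _ + X]big1 ?addr0 => [|l lj].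
  exact: (mE j).
rewrite mE (dual_system_off De) //.
by rewrite rmorph0 mul0r.
Qed.

Section Contraction.
Context {V : algType L} (d : {lrmorphism W -> V}).

Definition contraction : set T := [set t | exists b w,
  [/\ b != 0, embT t * embU b = embW w & d w = 0]].

Hypothesis prV : prime_ring V.
Hypothesis d_inj : forall u, d (bc_in i u) = 0 -> u = 0.
Hypothesis d_surj : forall v, exists w, d w = v.

Let dD : {morph d : v w / v + w} := rmorphD d.
Let dM : {morph d : v w / v * w} := rmorphM d.
Let d0 : d 0 = 0 := rmorph0 d.
Let d1 : d 1 = 1 := rmorph1 d.

Lemma image_prime v w : (forall x, d (v * x * w) = 0) -> d v = 0 \/ d w = 0.
Proof.
move=> vw; apply: prV => y; have [x <-] := d_surj y.
by rewrite /= -!dM vw.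
Qed.

(** This makes the choice of b in [contraction] immaterial. As t is central, w x b = n x w' for all
    x; the right side is killed by d while b is not, so primeness gives d w = 0. *)
Lemma contraction_kill t n w : contraction t -> embT t * embW n = embW w ->
  d w = 0.
Proof.
move=> [b [w' [b0 tb dw']]] tn.
have [x|//|/d_inj/eqP] := @image_prime w (bc_in i b); last by rewrite (negPf b0).
have -> : w * x * bc_in i b = n * x * w'.
  apply: embW_inj; rewrite !embWM -tn -tb.
  by rewrite -!mulrA [LHS]embTC [embT t * _]embTC !mulrA.
by rewrite dM dw' mulr0.
Qed.

Lemma contraction_ideal : is_ideal contraction.
Proof.
split.
- exists 1, 0; split; [exact: oner_neq0| |exact: d0].
  by rewrite (rmorph0 embT) mul0r (rmorph0 embW).
- move=> s t qs qt; have [b b0 bP] := embT_dom_neq0 [:: s; t].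
  have [|v vP] := bP s; first by rewrite mem_head.
  have [|w wP] := bP t; first by rewrite !inE eqxx orbT.
  exists b, (v + w); split=> //; first by rewrite embTD mulrDl vP wP -embWD.
  by rewrite dD (contraction_kill qs vP) (contraction_kill qt wP) addr0.
- move=> s t qt; suff st : contraction (s * t) by split=> //; rewrite bc_ec_mulC.
  have [b b0 bP] := embT_dom_neq0 [:: s; s * t].
  have [|v vP] := bP s; first by rewrite mem_head.
  have [|w wP] := bP (s * t); first by rewrite !inE eqxx orbT.
  exists b, w; split=> //; apply: (contraction_kill (n := v) qt).
  by rewrite -wP embTM -vP !mulrA embTC.
Qed.

Lemma contraction1 : ~ contraction 1.
Proof.
move=> q1; have := @contraction_kill _ 1 1 q1; rewrite (rmorph1 embT) mul1r.
by rewrite d1 => /(_ erefl)/eqP; rewrite oner_eq0.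
Qed.

Lemma contraction_prime : elt_prime contraction.
Proof.
move=> s t st.
have {}st : contraction (s * t) by have := st 1; rewrite mulr1.
have [b b0 bP] := embT_dom_neq0 [:: s; t].
have [|v vP] := bP s; first by rewrite mem_head.
have [|w wP] := bP t; first by rewrite !inE eqxx orbT.
have [x|dv|dw] := @image_prime v w.
(* With v = s b and w = t b, centrality gives v x w = s t (b x b). *)
- apply: (contraction_kill (n := bc_in i b * x * bc_in i b) st).
  rewrite embTM !embWM -vP -wP -!mulrA; congr (_ * _).
  by rewrite [embT t * embU b]embTC [LHS]embTC !mulrA.
- by left; exists b, v.
- by right; exists b, w.
Qed.

(** The terms e_j tau_j need not lie in W, so one nonzero a clears all the tau_j: w x a is the sum
    of the e_j x (tau_j a), each killed by d, while a is not. *)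
Lemma contraction_sum n (e : nat -> U) (tau : nat -> T) w :
  embW w = \sum_(j < n) embU (e j) * embT (tau j) ->
  (forall j, (j < n)%N -> contraction (tau j)) -> d w = 0.
Proof.
move=> wE tauq; have [a a0 aP] := embT_dom_neq0 (mkseq tau n).
have /choice[v vP] : forall j, exists v, (j < n)%N ->
    embT (tau j) * embU a = embW v.
  move=> j; have [jn|_] := ltnP j n; last by exists 0.
  have [|v vP] := aP (tau j); last by exists v.
  by apply/mapP; exists j; rewrite ?mem_iota.
have [x|//|/d_inj/eqP] := @image_prime w (bc_in i a); last by rewrite (negPf a0).
have -> : w * x * bc_in i a = \sum_(j < n) bc_in i (e j) * x * v j.
  apply: embW_inj; rewrite !embWM wE embW_sum !mulr_suml.
  apply: eq_bigr => j _; rewrite !embWM -vP // -!mulrA; congr (_ * _).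
  by rewrite [embT _ * embU a]embTC [LHS]embTC !mulrA.
rewrite (big_morph _ dD d0) big1 // => j _; rewrite dM.
have -> : d (v j) = 0; last by rewrite mulr0.
by apply: (contraction_kill (n := bc_in i a) (tauq j (ltn_ord j))); apply: vP.
Qed.

(* Applying the dual multiplication M j to w isolates the coefficient tau j. *)
Lemma exists_monomial w : d w <> 0 -> exists m b tau,
  [/\ b != 0, embW (mult (@bc_in _ _ i U) m w) = embU b * embT tau &
      ~ contraction tau].
Proof.
move=> dw; have [n [e [M [tau [De wE]]]]] := dual_expansion w.
have [j jn tauj] : exists2 j, (j < n)%N & ~ contraction (tau j).
  apply: contrapT => nj; apply: dw; apply: (contraction_sum wE) => j jn.
  by apply: contrapT => tauj; apply: nj; exists j.
exists (M j), (mult idfun (M j) (e j)), (tau j); split=> //.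
  exact: dual_system_diag De jn.
exact: mult_in_expansion De wE jn.
Qed.

End Contraction.

Lemma contraction_sub (V V' : algType L) (d : {lrmorphism W -> V})
    (d' : {lrmorphism W -> V'}) :
  (forall w, d w = 0 -> d' w = 0) -> contraction d `<=` contraction d'.
Proof.
by move=> dd' t [b [w [b0 tb dw]]]; exists b, w; split=> //; apply: dd'.
Qed.

(** Dual multiplications preserve the kernel of d, so the coefficients of an element of this kernel
    lie in the contraction of d. Conversely, coefficients in the contraction of d' force membership
    in the kernel of d'. *)
Lemma kernel_sub (V V' : algType L) (d : {lrmorphism W -> V})
    (d' : {lrmorphism W -> V'}) :
  prime_ring V' -> (forall u, d' (bc_in i u) = 0 -> u = 0) ->
  (forall v, exists w, d' w = v) ->
  contraction d `<=` contraction d' -> forall w, d w = 0 -> d' w = 0.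
Proof.
move=> prV' d'_inj d'_surj dd' w dw.
have [n [e [M [tau [De wE]]]]] := dual_expansion w.
apply: (contraction_sum prV' d'_inj d'_surj wE) => j jn; apply: dd'.
exists (mult idfun (M j) (e j)), (mult (@bc_in _ _ i U) (M j) w); split.
- exact: dual_system_diag De jn.
- by rewrite (mult_in_expansion De wE jn) embTC.
rewrite /mult rmorph_sum big1 // => p _.
by rewrite !rmorphM /= dw mulr0 mul0r.
Qed.

End Correspondence.

(** * Extension of primes from the extended centroid *)

Section QuotientLinear.
Context {F : nzRingType} {A : algType F} (I : proper_ideal A).

HB.instance Definition _ :=
  GRing.isScalable.Build F A (quot I) *:%R (to_quot I) (@to_quotZ F A I).

End QuotientLinear.

Section Extension.
Context {k L : fieldType} (i : {rmorphism k -> L}) {U : algType k}.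

Local Notation W := (basechange i U).
Local Notation C := (extcentroid U).
Local Notation T := (basechange i C).
Local Notation N := (basechange i (amring U)).
Local Notation embW := (@embW _ _ i U).
Local Notation embT := (@embT _ _ i U).
Local Notation embU := (@embU _ _ i U).

Hypothesis prU : prime_ring U.
Variable q : set T.
Hypotheses (iq : is_ideal q) (q1 : ~ q 1) (qP : elt_prime q).

Let qM s t : q t -> q (s * t).
Proof. by case: iq => _ _ + qt => /(_ s t qt)[]. Qed.

Definition extension : set W := [set w | exists s : seq (U * T),
  (forall p, p \in s -> q p.2) /\ embW w = \sum_(p <- s) embU p.1 * embT p.2].

(** Expand b and the elements of U in the given sum over one dual system, and pick j with
    coefficient beta_j of b nonzero. Applying M_j and cancelling M_j(e_j) puts beta_j t in q, and
    beta_j is invertible in the extended centroid. *)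
Lemma extension_monomial b t w : b != 0 -> embW w = embU b * embT t ->
  extension w -> q t.
Proof.
move=> b0 wE [s [sq sE]].
have [n [e [M [De eP]]]] := dual_system_exists prU (b :: [seq p.1 | p <- s]).
have [|beta bE] := eP b; first exact: mem_head.
have [j jn betaj] := dual_expansion_neq0 b0 bE.
have /choice[c cP] : forall u, exists c : nat -> C, u \in [seq p.1 | p <- s] ->
    am_in u = \sum_(j < n) ec_val (c j) * am_in (e j).
  move=> u; have [us|_] := boolP (u \in [seq p.1 | p <- s]).
    by have [|c cP] := eP u; [rewrite inE us orbT|exists c].
  by exists (fun=> 0).
pose bj := mult idfun (M j) (e j).
have multE u (g : nat -> C) : am_in u = \sum_(j < n) ec_val (g j) * am_in (e j) ->
    forall t, mult embU (M j) (embU u * embT t) = embU bj * embT (bc_in i (g j) * t).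
  move=> uE t'; rewrite -embTC mult_central; last exact: embTC.
  have := mult_in_expansion (tau := fun j => bc_in i (g j)) De
    (embU_expansion i (e := e) (c := g) uE) jn.
  rewrite [LHS](mult_morph (g := embW) (h' := embU)) //= -/(embU u) => ->.
  by rewrite embTC -mulrA -embTM.
have q_beta : q (bc_in i (beta j) * t).
  have -> : bc_in i (beta j) * t = \sum_(p <- s) bc_in i (c p.1 j) * p.2.
    apply/eqP; rewrite -subr_eq0; apply/eqP.
    apply: (@embU_embT_eq0 _ _ i U prU bj); first exact: dual_system_diag De jn.
    rewrite embTB mulrBr -(multE _ _ bE) -wE sE mult_sum embT_sum mulr_sumr.
    apply/eqP; rewrite subr_eq0; apply/eqP; rewrite !big_seq.
    by apply: eq_bigr => p ps; rewrite (multE p.1 (c p.1)) // cP // map_f.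
  by apply: is_ideal_sum => // p /sq; apply: qM.
have [x|qb|//] := qP (a := bc_in i (beta j)) (b := t).
  by rewrite [_ * x]bc_ec_mulC -mulrA; apply: qM.
have [g gb] := ec_inv_ex prU betaj.
by exfalso; apply: q1; rewrite -(rmorph1 (@bc_in _ _ i C)) -gb rmorphM; apply: qM.
Qed.

Lemma extension_ideal : is_ideal extension.
Proof.
have ext0 : extension 0.
  by exists [::]; split=> //; rewrite big_nil (rmorph0 embW).
have extD v w : extension v -> extension w -> extension (v + w).
  move=> [s [sq sE]] [s' [s'q s'E]]; exists (s ++ s'); split.
    by move=> p; rewrite mem_cat => /orP[/sq|/s'q].
  by rewrite embWD sE s'E big_cat.
split=> // v w [s [sq sE]]; have [r ->] := bc_in_sum_ex v.
rewrite mulr_sumr mulr_suml; split; apply: big_rec => // p x _ extx;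
  apply: extD => //.
- exists [seq (p.1 * t.1, p.2 *: t.2) | t <- s]; split.
    move=> _ /mapP[t /sq qt ->] /=; rewrite -[_ *: _]mul1r -scalerAr scalerAl.
    exact: qM.
  rewrite embWM sE big_map mulr_sumr; apply: eq_bigr => t _ /=.
  by rewrite embWZ embTZ embUM -scalerAl -scalerAr mulrA.
- exists [seq (t.1 * p.1, p.2 *: t.2) | t <- s]; split.
    move=> _ /mapP[t /sq qt ->] /=; rewrite -[_ *: _]mul1r -scalerAr scalerAl.
    exact: qM.
  rewrite embWM sE big_map mulr_suml; apply: eq_bigr => t _ /=.
  rewrite embWZ embTZ embUM -!scalerAr -!mulrA; congr (_ *: (_ * _)).
  by rewrite embTC.
Qed.

Lemma extension_in u : extension (bc_in i u) -> u = 0.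
Proof.
move=> extu; apply/eqP/negPn/negP => u0; apply: q1.
by apply: (extension_monomial u0 _ extu); rewrite (rmorph1 embT) mulr1.
Qed.

Lemma extension1 : ~ extension 1.
Proof.
rewrite -(rmorph1 (@bc_in _ _ i U)) => /extension_in/eqP.
by rewrite oner_eq0.
Qed.

Lemma exists_monomial_notin w : ~ extension w -> exists m b tau,
  [/\ b != 0, embW (mult (@bc_in _ _ i U) m w) = embU b * embT tau & ~ q tau].
Proof.
move=> nw; have [n [e [M [tau [De wE]]]]] := dual_expansion prU w.
have [j jn tauj] : exists2 j, (j < n)%N & ~ q (tau j).
  apply: contrapT => nj; apply: nw; exists [seq (e j, tau j) | j <- iota 0 n].
  split.
    move=> _ /mapP[j + ->]; rewrite mem_iota add0n => /= jn.
    by apply: contrapT => tauj; apply: nj; exists j.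
  by rewrite wE big_map -(big_mkord xpredT (fun j => embU (e j) * embT (tau j)))
    /index_iota subn0.
exists (M j), (mult idfun (M j) (e j)), (tau j); split=> //.
  exact: dual_system_diag De jn.
exact: mult_in_expansion De wE jn.
Qed.

(** Multiplications reduce two elements outside the extension to monomials b s and b' t with s and t
    outside q. Then (b s) x (b' t) = (b x b') s t with b x b' nonzero, and [extension_monomial] puts
    s t in q. *)
Lemma extension_prime : elt_prime extension.
Proof.
have [_ _ extM] := extension_ideal.
have ext_mult m w x : (forall y, extension (w * y * x)) ->
    forall y, extension (mult (@bc_in _ _ i U) m w * y * x).
  move=> wx y; rewrite /mult !mulr_suml; apply: is_ideal_sum.
    exact: extension_ideal.
  move=> p _; rewrite -!mulrA.
  by have [+ _] := extM (bc_in i p.1) _ (wx (bc_in i p.2 * y)); rewrite !mulrA.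
have ext_mult' m w x : (forall y, extension (x * y * w)) ->
    forall y, extension (x * y * mult (@bc_in _ _ i U) m w).
  move=> wx y; rewrite /mult !mulr_sumr; apply: is_ideal_sum.
    exact: extension_ideal.
  move=> p _; rewrite !mulrA.
  by have [_] := extM (bc_in i p.2) _ (wx (y * bc_in i p.1)); rewrite !mulrA.
move=> v w vw; apply: contrapT => /not_orP[nv nw].
have [m [b [s [b0 vE ns]]]] := exists_monomial_notin nv.
have [m' [b' [t [b'0 wE nt]]]] := exists_monomial_notin nw.
have [x bxb'] := prime_neq0 prU b0 b'0.
have qst : q (s * t).
  apply: (extension_monomial bxb' _
    (ext_mult' m' _ _ (ext_mult m _ _ vw) (bc_in i x))).
  rewrite !embWM vE wE -/(embU x) embTM !embUM -!mulrA; congr (_ * _).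
  rewrite [embT s * _]embTC -!mulrA; congr (_ * (_ * _)).
  by rewrite -embTM bc_ec_mulC embTM.
have [y|//|//] := qP (a := s) (b := t).
by rewrite [s * y]bc_ec_mulC -mulrA; apply: qM.
Qed.

Definition extension_proper : proper_ideal W :=
  ProperIdeal extension_ideal extension1.

Lemma contraction_extension : contraction (to_quot extension_proper) = q.
Proof.
apply/seteqP; split=> [t [b [w [b0 tb /to_quot_eq0 extw]]]|t qt].
  by apply: (extension_monomial b0 _ extw); rewrite -tb embTC.
have [b b0 bP] := embT_dom_neq0 [:: t].
have [|w wP] := bP t; first exact: mem_head.
exists b, w; split=> //; apply/to_quot_eq0; exists [:: (b, t)].
split; first by move=> p; rewrite inE => /eqP ->.
by rewrite big_seq1 -wP embTC.
Qed.

End Extension.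

(** * Comparison of extended centroids *)

Section Fractions.
Context {U D : nzRingType} (p : {rmorphism U -> D}).
Implicit Types (z : extcentroid D) (s t : U).

(** [z] is the quotient of [p t] by [p s], stated without division. *)
Definition is_frac z s t : Prop := ec_val z * am_in (p s) = am_in (p t).

Let pM : {morph p : s t / s * t} := rmorphM p.

Lemma is_frac_mull z s t r : is_frac z s t -> is_frac z (s * r) (t * r).
Proof. by rewrite /is_frac !pM !am_inM mulrA => ->. Qed.

Lemma is_frac1 s : is_frac 1 s s.
Proof. by rewrite /is_frac ec_val1 mul1r. Qed.

Lemma is_frac_cross z s t s' t' : is_frac z s t -> is_frac z s' t' ->
  p (s * t' - t * s') = 0.
Proof.
rewrite /is_frac => zst zst'; rewrite rmorphB !pM; apply/eqP.
rewrite subr_eq0; apply/eqP/am_in_inj.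
by rewrite !am_inM -zst -zst' mulrA -ec_valC.
Qed.

Hypothesis p_surj : forall v, exists s, p s = v.

Lemma is_frac_ex z : exists s t, p s != 0 /\ is_frac z s t.
Proof.
have [J fJ JP] := ec_dom z; have [v Jv v0] := in_filter_neq0 fJ.
have [v' zv] := JP v Jv; have [s sE] := p_surj v; have [t tE] := p_surj v'.
by exists s, t; rewrite /is_frac sE tE.
Qed.

Hypotheses (prD : prime_ring D) (UC : forall s t : U, s * t = t * s).

Lemma exists_frac s t : p s != 0 -> exists z, is_frac z s t.
Proof.
move=> ps; have [||z zP] := ec_of_pairs prD
  (S := fun v v' => v = p s /\ v' = p t).
- move=> v v' w w' x [-> ->] [-> ->]; have [y <-] := p_surj x.
  by rewrite -!pM [s * y * t]UC [s * y]UC mulrA.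
- by exists (p s), (p t).
by exists z; apply: zP.
Qed.

End Fractions.

Section Heart.
Context {k L : fieldType} (i : {rmorphism k -> L}) {U : algType k}.

Local Notation W := (basechange i U).
Local Notation C := (extcentroid U).
Local Notation T := (basechange i C).
Local Notation embW := (@embW _ _ i U).
Local Notation embT := (@embT _ _ i U).
Local Notation embU := (@embU _ _ i U).

Hypothesis prU : prime_ring U.
Context {V : algType L} (d : {lrmorphism W -> V}).
Hypothesis prV : prime_ring V.
Hypothesis d_inj : forall u, d (bc_in i u) = 0 -> u = 0.
Hypothesis d_surj : forall v, exists w, d w = v.

Context {D : algType L} (p : {lrmorphism T -> D}).
Hypothesis p_surj : forall v, exists t, p t = v.
Hypothesis p_ker : forall t, p t = 0 <-> contraction d t.

Let dD : {morph d : v w / v + w} := rmorphD d.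
Let dM : {morph d : v w / v * w} := rmorphM d.
Let d0 : d 0 = 0 := rmorph0 d.
Let dZ y w : d (y *: w) = y *: d w.
Proof. by rewrite linearZ. Qed.

Let pD : {morph p : s t / s + t} := rmorphD p.
Let pM : {morph p : s t / s * t} := rmorphM p.
Let pZ y t : p (y *: t) = y *: p t.
Proof. by rewrite linearZ. Qed.

Lemma heart_source_prime : prime_ring D.
Proof.
move=> v w; have [s <-] := p_surj v; have [t <-] := p_surj w => vw.
have [x|/p_ker|/p_ker] := contraction_prime prV d_inj d_surj (a := s) (b := t);
  [|by left|by right].
by apply/p_ker; rewrite !pM; apply: vw.
Qed.

Lemma heart_source_mul s t : p s != 0 -> p t != 0 -> p (s * t) != 0.
Proof.
move=> /eqP s0 /eqP t0; apply/eqP => st.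
have [x|//|//] := heart_source_prime (a := p s) (b := p t).
have [y <-] := p_surj x; rewrite /= -!pM bc_ec_mulC mulrA [t * s]bc_ec_mulC pM st.
by rewrite mul0r.
Qed.

Lemma contraction_kernel a t w : a != 0 -> embT t * embU a = embW w ->
  d w = 0 <-> p t = 0.
Proof.
move=> a0 tw; split=> [dw|/p_ker qt]; first by apply/p_ker; exists a, w.
exact: (contraction_kill prV d_inj d_surj (n := bc_in i a) qt tw).
Qed.

(** If z = t/s and a clears the denominators of s and t, then y is the quotient of the images of t a
    and s a in V. Quantifying over all representatives leaves each later proof free to choose its
    own. *)
Definition heart_rel (z : extcentroid D) (y : extcentroid V) : Prop :=
  forall s t a w w', is_frac p z s t -> embT s * embU a = embW w ->
    embT t * embU a = embW w' -> ec_val y * am_in (d w) = am_in (d w').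

Lemma is_frac_dom (ts : seq T) : exists a, exists w : T -> W, a != 0 /\
  forall t, t \in ts -> embT t * embU a = embW (w t).
Proof.
have [a a0 aP] := embT_dom_neq0 ts.
have /choice[w wP] : forall t, exists w, t \in ts -> embT t * embU a = embW w.
  move=> t; have [/aP[w wP]|_] := boolP (t \in ts); first by exists w.
  by exists 0.
by exists a, w.
Qed.

(** For two representatives of z the cross difference of the fractions lies in the contraction.
    Multiplied by a x a1 it falls in the kernel of d, which is the compatibility that [ec_of_pairs]
    asks for. *)
Lemma heart_ex z : exists y, heart_rel z y.
Proof.
have [||y yP] := ec_of_pairs prV (S := fun v v' => exists s t a w w',
  [/\ is_frac p z s t, embT s * embU a = embW w, embT t * embU a = embW w',
      v = d w & v' = d w']).
- move=> v v' u u' x [s [t [a [w [w' [zst sw tw -> ->]]]]]].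
  move=> [s1 [t1 [a1 [w1 [w1' [zst1 sw1 tw1 -> ->]]]]]].
  have [x' <-] := d_surj x; apply/eqP; rewrite -subr_eq0 -!dM -mulN1r.
  rewrite -(rmorph1 d) -(rmorphN d) -dM -dD; apply/eqP.
  have /p_ker qst := is_frac_cross zst zst1.
  apply: (contraction_kill prV d_inj d_surj
    (n := bc_in i a * x' * bc_in i a1) qst).
  rewrite embTB !embTM !embWD !embWM mulrBl.
  rewrite [embW (-1)](rmorphN embW) (rmorph1 embW) mulN1r; congr (_ - _).
    rewrite -sw -tw1 -!mulrA; congr (_ * _).
    by rewrite [in RHS]embTC [LHS]embTC !mulrA.
  rewrite -tw -sw1 -!mulrA; congr (_ * _).
  by rewrite [in RHS]embTC [LHS]embTC !mulrA.
- have [s [t [qs zst]]] := is_frac_ex p_surj z.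
  have [a [w [a0 wP]]] := is_frac_dom [:: s; t].
  have sw := wP s (mem_head _ _).
  exists (d (w s)), (d (w t)); split; last first.
    by apply/eqP => /(contraction_kernel a0 sw)/eqP; apply/negP.
  exists s, t, a, (w s), (w t); split=> //; apply: wP.
  by rewrite !inE eqxx orbT.
by exists y => s t a w w' zst sw tw; apply: yP; exists s, t, a, w, w'.
Qed.

Definition heart z : extcentroid V := sval (cid (heart_ex z)).

Lemma heartP z : heart_rel z (heart z).
Proof. exact: (svalP (cid (heart_ex z))). Qed.

Lemma heart_eq z y s t a w w' : p s != 0 -> a != 0 -> is_frac p z s t ->
  embT s * embU a = embW w -> embT t * embU a = embW w' ->
  ec_val y * am_in (d w) = am_in (d w') -> heart z = y.
Proof.
move=> qs a0 zst sw tw yw; apply: (ec_eq prV (heartP zst sw tw) yw).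
by apply/eqP => /(contraction_kernel a0 sw)/eqP; apply/negP.
Qed.

Lemma heartD : {morph heart : z z' / z + z'}.
Proof.
move=> z z'; have [s [t [qs zst]]] := is_frac_ex p_surj z.
have [s' [t' [qs' zst']]] := is_frac_ex p_surj z'.
have {}zst := is_frac_mull s' zst; have {}zst' := is_frac_mull s zst'.
rewrite bc_ec_mulC in zst'.
have qss := heart_source_mul qs qs'.
have [a [w [a0 wP]]] := is_frac_dom [:: s * s'; t * s'; t' * s].
have sw := wP _ (mem_head _ _).
have [tw tw'] : embT (t * s') * embU a = embW (w (t * s')) /\
    embT (t' * s) * embU a = embW (w (t' * s)).
  by split; apply: wP; rewrite !inE eqxx ?orbT.
apply: (heart_eq (s := s * s') (t := t * s' + t' * s)
  (w' := w (t * s') + w (t' * s)) qss a0 _ sw).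
- by rewrite /is_frac ec_valD mulrDl zst zst' -am_inD -pD.
- by rewrite embTD mulrDl tw tw' -embWD.
rewrite ec_valD mulrDl (heartP zst sw tw) (heartP zst' sw tw').
by rewrite dD am_inD.
Qed.

Lemma heartM : {morph heart : z z' / z * z'}.
Proof.
move=> z z'; have [s [t [qs zst]]] := is_frac_ex p_surj z.
have [s' [t' [qs' zst']]] := is_frac_ex p_surj z'.
have {}zst := is_frac_mull t' zst; have {}zst' := is_frac_mull s zst'.
rewrite bc_ec_mulC [t' * s]bc_ec_mulC in zst'.
have qss := heart_source_mul qs qs'.
have [a [w [a0 wP]]] := is_frac_dom [:: s * s'; s * t'; t * t'].
have sw := wP _ (mem_head _ _).
have [tw tw'] : embT (s * t') * embU a = embW (w (s * t')) /\
    embT (t * t') * embU a = embW (w (t * t')).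
  by split; apply: wP; rewrite !inE eqxx ?orbT.
apply: (heart_eq (s := s * s') (t := t * t') qss a0 _ sw tw').
  by rewrite /is_frac ec_valM -mulrA zst' zst.
by rewrite ec_valM -mulrA (heartP zst' sw tw) (heartP zst tw tw').
Qed.

Lemma heart1 : heart 1 = 1.
Proof.
have [a [w [a0 wP]]] := is_frac_dom [:: 1].
have sw := wP _ (mem_head _ _).
apply: (heart_eq _ a0 (is_frac1 p _) sw sw).
  by rewrite rmorph1 oner_neq0.
by rewrite ec_val1 mul1r.
Qed.

Lemma heartZ : scalable heart.
Proof.
move=> x z; have [s [t [qs zst]]] := is_frac_ex p_surj z.
have [a [w [a0 wP]]] := is_frac_dom [:: s; t].
have sw := wP _ (mem_head _ _).
have tw : embT t * embU a = embW (w t) by apply: wP; rewrite !inE eqxx orbT.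
apply: (heart_eq (s := s) (t := x *: t) (w' := x *: w t) qs a0 _ sw).
- rewrite /is_frac ec_valZ -scalerAl zst [RHS](congr1 am_in (pZ x t)).
  by rewrite (linear_funZ (@am_in_linear _ _)).
- by rewrite embTZ -scalerAl tw -embWZ.
rewrite ec_valZ -scalerAl (heartP zst sw tw) dZ.
by rewrite (linear_funZ (@am_in_linear _ _)).
Qed.

Lemma heart_eq0 z : heart z = 0 -> z = 0.
Proof.
move=> hz; have [s [t [qs zst]]] := is_frac_ex p_surj z.
have [a [w [a0 wP]]] := is_frac_dom [:: s; t].
have sw := wP _ (mem_head _ _).
have tw : embT t * embU a = embW (w t) by apply: wP; rewrite !inE eqxx orbT.
have := heartP zst sw tw; rewrite hz [ec_val 0](rmorph0 val) mul0r => dw.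
have pt : p t = 0.
  by apply/(contraction_kernel a0 tw)/am_in_inj; rewrite -dw rmorph0.
apply: (ec_mul_eq0 heart_source_prime _ qs).
by rewrite [LHS]zst -(rmorph0 (@am_in D)); congr am_in.
Qed.

Lemma heart_inj : injective heart.
Proof.
move=> z z' zz'; apply/eqP; rewrite -subr_eq0; apply/eqP/heart_eq0.
have := heartD (z - z') z'; rewrite subrK zz'.
by rewrite -[X in X = _]add0r => /addIr.
Qed.

(* If y [d w] = [d v] with w = b tau, then b x w = w x b forces b x v = v x b
   modulo ker d; applying to it a multiplication dual to b writes v as a
   multiple of b, which exhibits y as a fraction. *)
Lemma heart_surj y : exists z, heart z = y.
Proof.
have [J fJ JP] := ec_dom y; have [v0 Jv0 v00] := in_filter_neq0 fJ.
have [v0' yv0] := JP v0 Jv0; have [w0 w0E] := d_surj v0.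
have [w0' w0'E] := d_surj v0'.
have [m [b [tau [b0 wE ntau]]]] : exists m b tau,
    [/\ b != 0, embW (mult (@bc_in _ _ i U) m w0) = embU b * embT tau &
        ~ contraction d tau].
  by apply: exists_monomial => // dw0; move: v00; rewrite -w0E dw0 eqxx.
set w := mult _ m w0 in wE; pose v := mult (@bc_in _ _ i U) m w0'.
have ywv : ec_val y * am_in (d w) = am_in (d v).
  have dmult x : am_in (d (mult (@bc_in _ _ i U) m x)) =
      mult (@am_in V \o d \o @bc_in _ _ i U) m (am_in (d x)).
    exact: (mult_morph (g := @am_in V \o d)).
  rewrite !dmult -mult_central; last exact: ec_valC.
  by rewrite w0E yv0 -w0'E.
have bxv x : d (bc_in i b * x * v) = d (v * x * bc_in i b).
  have bxw : bc_in i b * x * w = w * x * bc_in i b.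
    apply: embW_inj; rewrite !embWM wE -/(embU b) -!mulrA; congr (_ * _).
    by rewrite [RHS]embTC !mulrA.
  apply: am_in_inj; rewrite dM am_inM -ywv mulrA -ec_valC -mulrA.
  by rewrite -am_inM -dM bxw -mulrA dM am_inM mulrA ywv -am_inM -dM mulrA.
have [n [e [M [c [tau' [De bE vE]]]]]] := dual_expansion2 prU b v.
have [j jn cj] := dual_expansion_neq0 b0 bE.
set mj := M j; pose b' := mult idfun mj (e j); pose b'' := mult idfun mj b.
have b'0 : b' != 0 := dual_system_diag De jn.
have vjE := mult_in_expansion De vE jn; rewrite -/mj -/b' in vjE.
have bjE : embU b'' = embU b' * embT (bc_in i (c j)).
  rewrite /b'' embU_mult.
  have <- := mult_in_expansion (tau := fun j => bc_in i (c j)) De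
    (embU_expansion i bE) jn.
  by apply/esym; apply: (mult_morph (g := embW)).
have [u bub] := prime_neq0 prU b0 b'0.
have buv : d (bc_in i b * bc_in i u * mult (@bc_in _ _ i U) mj v) =
    d (v * bc_in i u * bc_in i b'').
  have -> : bc_in i b'' = mult (@bc_in _ _ i U) mj (bc_in i b).
    exact: (mult_morph (g := @bc_in _ _ i U)).
  rewrite /mult !mulr_sumr !(big_morph _ dD d0); apply: eq_bigr => r _.
  rewrite !mulrA [LHS]dM [RHS]dM; congr (_ * _).
  by have := bxv (bc_in i u * bc_in i r.1); rewrite !mulrA.
(* The fraction is tau'_j over tau c_j, with b u b' as the clearing element: tau c_j times it is w u
   b'', and tau'_j times it is b u M_j(v). *)
have ns : p (tau * bc_in i (c j)) != 0.
  apply: heart_source_mul; first by apply/eqP => /p_ker.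
  have [g gc] := ec_inv_ex prU cj; apply/eqP => pc.
  have : p 1 = 1 := rmorph1 p; rewrite -(@bc_in1 _ _ i C) -gc bc_inM pM pc mulr0.
  by move/eqP; rewrite eq_sym oner_eq0.
have [z zst] := exists_frac p_surj heart_source_prime (@bc_ec_mulC _ _ i U)
  (tau' j) ns; exists z.
apply: (heart_eq (w := w * bc_in i u * bc_in i b'')
  (w' := bc_in i b * bc_in i u * mult (@bc_in _ _ i U) mj v) ns bub zst _ _ _).
- rewrite !embWM wE -/(embU u) -/(embU b'') bjE embTM !embUM.
  rewrite -[embU b * embT tau]embTC -!mulrA; congr (_ * _).
  by rewrite [LHS]embTC !mulrA.
- by rewrite embTC !embUM -!mulrA -vjE !embWM.
rewrite -[w * _ * _]mulrA dM am_inM mulrA ywv -am_inM -dM mulrA.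
by rewrite -buv.
Qed.

Definition heart_inv y := sval (cid (heart_surj y)).

Lemma heart_invK : cancel heart_inv heart.
Proof. by move=> y; apply: (svalP (cid (heart_surj y))). Qed.

Lemma heartK : cancel heart heart_inv.
Proof. by move=> z; apply: heart_inj; rewrite heart_invK. Qed.

Definition heart_iso : alg_iso (extcentroid D) (extcentroid V) :=
  @AlgIso _ _ _ (mk_ring_iso heartD heartM heart1 heartK heart_invK) heartZ.

End Heart.

(** * Naturality *)

Lemma am_fun_in (U V : nzRingType) (f : ring_iso U V) a :
  am_fun f (am_in a) = am_in (f a).
Proof.
rewrite am_funE; apply: amclass_eq => x _ _ /=.
by rewrite rmorphM iso_invK.
Qed.

Lemma ec_iso_in (U V : nzRingType) (f : ring_iso U V) c a b :
  ec_val c * am_in a = am_in b -> ec_val (ec_iso f c) * am_in (f a) = am_in (f b).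
Proof. by move=> cab; rewrite /= -!am_fun_in -am_funM cab. Qed.

Lemma bc_fun_tensor (k L : fieldType) (i : {rmorphism k -> L}) (A B : algType k)
    (f : alg_iso A B) (s : ring_iso L L) (si : forall c, s (i c) = i c) a x :
  bc_fun f s (bc_tensor i a x) = bc_tensor i (f a) (s x).
Proof. by rewrite (bc_funE f si). Qed.

Section Naturality.
Context {k L : fieldType} (i : {rmorphism k -> L}) {U : algType k}.

Local Notation W := (basechange i U).
Local Notation C := (extcentroid U).
Local Notation T := (basechange i C).
Local Notation N := (basechange i (amring U)).
Local Notation embW := (@embW _ _ i U).
Local Notation embT := (@embT _ _ i U).
Local Notation embU := (@embU _ _ i U).

Variables (f : alg_iso U U) (f_ec : alg_iso C C) (s : ring_iso L L).
Hypothesis f_ecE : forall c, f_ec c = ec_iso f c.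
Hypothesis si : forall c, s (i c) = i c.

Lemma am_iso_scalable : scalable (am_iso f).
Proof.
move=> a p /=; have [h ->] := amring_ex p; rewrite !(amclassZ, am_funE).
by apply: amclass_eq => x _ _ /=; rewrite alg_iso_scalable.
Qed.

Let fN : alg_iso (amring U) (amring U) := AlgIso am_iso_scalable.
Let mapW : ring_iso W W := bc_iso f si.
Let mapT : ring_iso T T := bc_iso f_ec si.
Let mapN : ring_iso N N := bc_iso fN si.

Let mapWE a x : mapW (bc_tensor i a x) = bc_tensor i (f a) (s x).
Proof. exact: bc_fun_tensor. Qed.
Let mapTE c x : mapT (bc_tensor i c x) = bc_tensor i (f_ec c) (s x).
Proof. exact: bc_fun_tensor. Qed.
Let mapNE p x : mapN (bc_tensor i p x) = bc_tensor i (am_iso f p) (s x).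
Proof. exact: (bc_fun_tensor fN). Qed.

Let mapN_embW w : mapN (embW w) = embW (mapW w).
Proof.
move: w; apply: bc_additive_eq => [x y|x y|a x].
- by rewrite embWD rmorphD.
- by rewrite rmorphD embWD.
by rewrite mapWE !embWE mapNE /= am_fun_in.
Qed.

Let mapN_embT t : mapN (embT t) = embT (mapT t).
Proof.
move: t; apply: bc_additive_eq => [x y|x y|c x].
- by rewrite embTD rmorphD.
- by rewrite rmorphD embTD.
by rewrite mapTE !embTE mapNE f_ecE.
Qed.

Let mapN_embU u : mapN (embU u) = embU (f u).
Proof. by rewrite !embUE mapNE rmorph1 /= am_fun_in. Qed.

Lemma extension_bc_iso (q : set T) w : (forall t, q t -> q (bc_iso f_ec si t)) ->
  extension q w -> extension q (bc_iso f si w).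
Proof.
move=> qs [r [rq rE]]; exists [seq (f p.1, mapT p.2) | p <- r]; split.
  by move=> _ /mapP[p /rq pq ->]; apply: qs.
rewrite big_map -mapN_embW rE rmorph_sum; apply: eq_bigr => p _.
by rewrite rmorphM mapN_embU mapN_embT.
Qed.

Context {V1 V2 : algType L} (d1 : {lrmorphism W -> V1}) (d2 : {lrmorphism W -> V2}).
Variable h : ring_iso V1 V2.
Hypothesis hd : forall w, h (d1 w) = d2 (bc_iso f si w).

Let iso_eq0 (A B : nzRingType) (g : ring_iso A B) x : g x = 0 -> x = 0.
Proof. by rewrite -(rmorph0 g) => /(can_inj (iso_funK g)). Qed.

Lemma contraction_bc_iso t :
  contraction d1 t <-> contraction d2 (bc_iso f_ec si t).
Proof.
split=> [[b [w [b0 tb dw]]]|[b [w [b0 tb dw]]]].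
  exists (f b), (mapW w); split.
  - by apply: contra_neq b0; apply: iso_eq0.
  - by rewrite -mapN_embT -mapN_embU -mapN_embW -rmorphM tb.
  - by rewrite -hd dw rmorph0.
exists (iso_inv f b), (iso_inv mapW w); split.
- by apply: contra_neq b0 => b0; rewrite -(iso_invK f b) b0 rmorph0.
- apply: (can_inj (iso_funK mapN)).
  by rewrite rmorphM mapN_embT mapN_embU mapN_embW !iso_invK.
- by apply: (iso_eq0 (g := h)); rewrite hd -/mapW iso_invK.
Qed.

Lemma contraction_bc_image : bc_iso f_ec si @` contraction d1 = contraction d2.
Proof.
rewrite image_isoE; apply/seteqP; split=> t /=.
  by move/contraction_bc_iso; rewrite iso_invK.
by move=> qt; apply/contraction_bc_iso; rewrite iso_invK.
Qed.

Hypothesis prU : prime_ring U.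
Hypotheses (prV1 : prime_ring V1) (prV2 : prime_ring V2).
Hypothesis d1_inj : forall u, d1 (bc_in i u) = 0 -> u = 0.
Hypothesis d2_inj : forall u, d2 (bc_in i u) = 0 -> u = 0.
Hypothesis d1_surj : forall v, exists w, d1 w = v.
Hypothesis d2_surj : forall v, exists w, d2 w = v.
Context {D1 D2 : algType L} (p1 : {lrmorphism T -> D1}) (p2 : {lrmorphism T -> D2}).
Hypothesis p1_surj : forall v, exists t, p1 t = v.
Hypothesis p2_surj : forall v, exists t, p2 t = v.
Hypothesis p1_ker : forall t, p1 t = 0 <-> contraction d1 t.
Hypothesis p2_ker : forall t, p2 t = 0 <-> contraction d2 t.
Variable g : ring_iso D1 D2.
Hypothesis gp : forall t, g (p1 t) = p2 (bc_iso f_ec si t).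

(** The maps carry a representative of [z] to one of its image under [g], and one representative
    determines the heart. *)
Lemma heart_natural z :
  heart_iso prU prV2 d2_inj d2_surj p2_surj p2_ker (ec_iso g z) =
  ec_iso h (heart_iso prU prV1 d1_inj d1_surj p1_surj p1_ker z).
Proof.
have [s1 [t1 [ps zst]]] := is_frac_ex p1_surj z.
have [a [w [a0 wP]]] := @is_frac_dom _ _ i U [:: s1; t1].
have sw := wP s1 (mem_head _ _).
have tw : embT t1 * embU a = embW (w t1) by apply: wP; rewrite !inE eqxx orbT.
have mapP t : t \in [:: s1; t1] ->
    embT (mapT t) * embU (f a) = embW (mapW (w t)).
  by move=> /wP tw'; rewrite -mapN_embT -mapN_embU -mapN_embW -rmorphM tw'.
apply: (heart_eq prV2 d2_inj d2_surj p2_surj p2_ker (s := mapT s1) (t := mapT t1)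
  (a := f a) (w := mapW (w s1)) (w' := mapW (w t1))).
- by rewrite -gp; apply: contra_neq ps; apply: iso_eq0.
- by apply: contra_neq a0; apply: iso_eq0.
- have zst' : ec_val z * am_in (p1 s1) = am_in (p1 t1) := zst.
  by have := ec_iso_in g zst'; rewrite !gp.
- by apply: mapP; rewrite mem_head.
- by apply: mapP; rewrite !inE eqxx orbT.
by rewrite -!hd; apply: ec_iso_in;
  apply: (heartP prV1 d1_inj d1_surj p1_surj p1_ker zst sw tw).
Qed.

End Naturality.

(** * Regular functions *)

Section RegularFunctions.
Context {k : closedFieldType} {G : affine_group k} (K : function_field G).
Local Notation i := (ff_const K).
Local Notation j := (@ff_in _ _ K).

(** [ag_ev] with values in the field k instead of the algebra [k^o]. *)
Definition ev (x : G) (f : ag_coord G) : k := ag_ev x f.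

Lemma evD x : {morph ev x : f h / f + h}.
Proof. by move=> f h; rewrite /ev rmorphD. Qed.
Lemma evM x : {morph ev x : f h / f * h}.
Proof. by move=> f h; rewrite /ev rmorphM. Qed.
Lemma evZ x c f : ev x (c *: f) = c * ev x f.
Proof. by rewrite /ev linearZ. Qed.
Lemma ev0 x : ev x 0 = 0.
Proof. by rewrite /ev rmorph0. Qed.
Lemma ev1 x : ev x 1 = 1.
Proof. by rewrite /ev rmorph1. Qed.
Lemma ev_sum x (I : Type) (r : seq I) (F : I -> ag_coord G) :
  ev x (\sum_(t <- r) F t) = \sum_(t <- r) ev x (F t).
Proof. exact: (big_morph _ (evD x) (ev0 x)). Qed.

Lemma ff_in_scale c f : j (c *: f) = i c * j f.
Proof. by rewrite -mulr_algl rmorphM. Qed.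

Section Representation.
Context {A : algType k}.
Local Notation AK := (basechange i A).
Implicit Types (F : G -> A) (w : AK).

(* w is the element of A (x) k[G], seen inside A (x) k(G), that corresponds to
   the regular function F. *)
Definition regular_rep F w : Prop := exists s : seq (A * ag_coord G),
  w = \sum_(p <- s) bc_tensor i p.1 (j p.2) /\
  forall x, F x = \sum_(p <- s) ev x p.2 *: p.1.

Lemma regular_rep_form F w l : regular_rep F w -> scalar l ->
  exists h, bc_form l w = j h /\ forall x, ev x h = l (F x).
Proof.
move=> [s [-> sF]] ls; exists (\sum_(p <- s) l p.1 *: p.2); split.
  rewrite bc_form_sum // rmorph_sum; apply: eq_bigr => p _.
  by rewrite bc_form_tensor // -ff_in_scale.
move=> x; rewrite ev_sum sF (big_morph _ (scalar_funD ls) (scalar_fun0 ls)).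
by apply: eq_bigr => p _; rewrite evZ (scalar_funZ ls) mulrC.
Qed.

(** Linear forms separate the elements of A (x) k(G) and send these two into k[G], where points
    separate. *)
Lemma regular_rep_uniq F F' w w' : regular_rep F w -> regular_rep F' w' ->
  F =1 F' -> w = w'.
Proof.
move=> Fw Fw' FF'; apply/eqP; rewrite -subr_eq0; apply/eqP/bc_form_eq0 => l ls.
have [h [wh hF]] := regular_rep_form Fw ls.
have [h' [wh' hF']] := regular_rep_form Fw' ls.
rewrite bc_formD // -scaleN1r bc_formZ // mulN1r wh wh'.
by apply/eqP; rewrite subr_eq0; apply/eqP; congr (j _);
  apply: ag_ev_inj => x; rewrite -[LHS]/(ev x h) hF FF' -hF'.
Qed.

Lemma regular_rep_eq0 F : regular_rep F 0 -> forall x, F x = 0.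
Proof.
move=> F0 x; apply/eqP/negPn/negP => /exists_form1[l [ls]].
have [h [h0 hF]] := regular_rep_form F0 ls; rewrite -hF.
have -> : h = 0 by apply: (@ff_in_inj _ _ K); rewrite -h0 bc_form0 // rmorph0.
by rewrite ev0 => /eqP; rewrite eq_sym oner_eq0.
Qed.

Lemma regular_repD F F' w w' : regular_rep F w -> regular_rep F' w' ->
  regular_rep (fun x => F x + F' x) (w + w').
Proof.
move=> [s [-> sF]] [s' [-> sF']]; exists (s ++ s'); rewrite big_cat.
by split=> // x; rewrite sF sF' big_cat.
Qed.

Lemma regular_rep0 : regular_rep (fun=> 0) 0.
Proof. by exists [::]; split=> [|x]; rewrite big_nil. Qed.

Lemma regular_rep_sum (I : Type) (r : seq I) (F : I -> G -> A) (w : I -> AK) :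
  (forall t, regular_rep (F t) (w t)) ->
  regular_rep (fun x => \sum_(t <- r) F t x) (\sum_(t <- r) w t).
Proof.
move=> Fw; elim: r => [|t r [s [sw sF]]].
  by exists [::]; split=> [|x]; rewrite !big_nil.
have [s' [sw' sF']] := Fw t; exists (s' ++ s); rewrite big_cons big_cat sw sw'.
by split=> // x; rewrite big_cons big_cat sF sF'.
Qed.

Lemma regular_repM F F' w w' : regular_rep F w -> regular_rep F' w' ->
  regular_rep (fun x => F x * F' x) (w * w').
Proof.
move=> [s [-> sF]] [s' [-> sF']].
exists [seq (p.1 * p'.1, p.2 * p'.2) | p <- s, p' <- s']; split=> [|x].
  rewrite big_allpairs_dep mulr_suml; apply: eq_bigr => p _.
  rewrite mulr_sumr; apply: eq_bigr => p' _.
  by rewrite bc_tensorM -rmorphM.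
rewrite big_allpairs_dep sF sF' mulr_suml; apply: eq_bigr => p _.
rewrite mulr_sumr; apply: eq_bigr => p' _ /=.
by rewrite evM -scalerAl -scalerAr scalerA.
Qed.

Lemma regular_repZ F w f : regular_rep F w ->
  regular_rep (fun x => ev x f *: F x) (j f *: w).
Proof.
move=> [s [-> sF]]; exists [seq (p.1, f * p.2) | p <- s]; split=> [|x].
  rewrite big_map scaler_sumr; apply: eq_bigr => p _.
  by rewrite scale_bc_tensor rmorphM.
rewrite big_map sF scaler_sumr; apply: eq_bigr => p _.
by rewrite scalerA evM.
Qed.

Lemma regular_rep_cst a : regular_rep (fun=> a) (bc_in i a).
Proof.
exists [:: (a, 1)]; split=> [|x]; rewrite big_seq1 ?rmorph1 //=.
by rewrite ev1 scale1r.
Qed.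

(** Irreducibility of G enters here: a nonzero coordinate of each element is a nonzero regular
    function, and so is their product, since k[G] lies in a field. *)
Lemma common_point F F' w w' : regular_rep F w -> regular_rep F' w' ->
  w != 0 -> w' != 0 -> exists x, F x != 0 /\ F' x != 0.
Proof.
have form (v : AK) : v != 0 -> exists l, scalar l /\ bc_form l v != 0.
  move=> /eqP v0; apply: contrapT => nl; apply: v0; apply: bc_form_eq0 => l ls.
  by apply: contrapT => /eqP lv; apply: nl; exists l.
move=> Fw Fw' /form[l [ls lw]] /form[l' [ls' lw']].
have [h [wh hF]] := regular_rep_form Fw ls.
have [h' [wh' hF']] := regular_rep_form Fw' ls'.
have : h * h' != 0.
  apply: (@ff_prod_neq0 _ _ K).
    by apply: contra_neq lw => h0; rewrite wh h0 rmorph0.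
  by apply: contra_neq lw' => h0; rewrite wh' h0 rmorph0.
move=> hh'; have [x xhh'] : exists x, ev x (h * h') != 0.
  apply: contrapT => nx; move/eqP: hh'; apply; apply: ag_ev_inj => x.
  rewrite rmorph0; apply: contrapT => /eqP xhh'; apply: nx; by exists x.
exists x; move: xhh'; rewrite evM hF hF' mulf_eq0 negb_or => /andP[lx lx'].
split; first by apply: contra_neq lx => ->; rewrite scalar_fun0.
by apply: contra_neq lx' => ->; rewrite scalar_fun0.
Qed.

Lemma clear_denominator w : exists h F, h != 0 /\ regular_rep F (j h *: w).
Proof.
have [s ->] := bc_sum_ex w; elim: s => [|[a y] s [h [F [h0 Fw]]]].
  exists 1, (fun=> 0); rewrite big_nil scaler0 oner_neq0; split=> //.
  exact: regular_rep0.
have [f [h' [h'0 ->]]] := ff_frac y.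
exists (h * h'), (fun x => ev x h *: (ev x f *: a) + ev x h' *: F x).
split; first exact: (@ff_prod_neq0 _ _ K).
rewrite big_cons scalerDr; apply: regular_repD.
  rewrite scale_bc_tensor rmorphM mulrACA -mulrA mulrCA divff ?ff_in_neq0 //.
  rewrite mulr1 mulrC -rmorphM; exists [:: (a, h * f)].
  split=> [|x]; first by rewrite big_seq1 /= [f * h]mulrC.
  by rewrite big_seq1 /= evM scalerA.
by rewrite mulrC rmorphM -scalerA; apply: regular_repZ.
Qed.

(** At a common point x some a gives F(x) a F'(x) nonzero, although the function x |-> F(x) a F'(x)
    represents a multiple of v a w = 0. *)
Lemma prime_ring_basechange : prime_ring A -> prime_ring AK.
Proof.
move=> prA v w vw; apply: contrapT => /not_orP[/eqP v0 /eqP w0].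
have [h [F [h0 Fv]]] := clear_denominator v.
have [h' [F' [h'0 Fw]]] := clear_denominator w.
have scale0 (y : K) (u : AK) : y != 0 -> u != 0 -> y *: u != 0.
  move=> y0; apply: contra_neq => yu.
  by rewrite -[u]scale1r -(mulVf y0) -scalerA yu scaler0.
have [||x [Fx F'x]] := common_point Fv Fw.
- by apply: scale0 => //; apply: ff_in_neq0.
- by apply: scale0 => //; apply: ff_in_neq0.
have [a /eqP] := prime_neq0 prA Fx F'x; apply.
apply: (@regular_rep_eq0 (fun x => F x * a * F' x)).
have := regular_repM (regular_repM Fv (regular_rep_cst a)) Fw.
by rewrite -scalerAr -!scalerAl vw !scaler0.
Qed.

End Representation.

Lemma regular_rep_map (A B : algType k) (f : A -> B) F w : linear f ->
  regular_rep F w -> regular_rep (f \o F) (bc_map f w).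
Proof.
move=> fl [s [-> sF]]; exists [seq (f p.1, p.2) | p <- s]; split=> [|x].
  rewrite big_map (big_morph _ (bc_mapD fl) (linear_fun0 (bc_map_linear fl))).
  by apply: eq_bigr => p _; rewrite bc_map_tensor.
rewrite big_map /= sF (big_morph _ (linear_funD fl) (linear_fun0 fl)).
by apply: eq_bigr => p _; rewrite linear_funZ.
Qed.

Lemma regular_rep_iso (A B : algType k) (f : alg_iso A B)
    (s : alg_iso (ag_coord G) (ag_coord G)) (t : G -> G) F w :
  (forall h x, ev x (s h) = ev (t x) h) -> regular_rep F w ->
  regular_rep (fun x => f (F (t x))) (bc_iso f (ff_ext_const K s) w).
Proof.
move=> st [r [-> rF]]; exists [seq (f p.1, s p.2) | p <- r]; split=> [|x].
  rewrite big_map rmorph_sum; apply: eq_bigr => p _ /=.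
  rewrite (bc_funE f (ff_ext_const K s)) /seq_map /= bc_class_sum big_seq1 /=.
  by rewrite ff_ext_in.
rewrite big_map /= rF rmorph_sum; apply: eq_bigr => p _.
by rewrite alg_iso_scalable st.
Qed.

Lemma ff_fixed (y : K) : (forall g, ff_r K g y = y) -> exists c, y = i c.
Proof.
have [f [h [h0 ->]]] := ff_frac y => yG.
have [x hx] : exists x, ev x h != 0.
  apply: contrapT => nx; move/eqP: h0; apply; apply: ag_ev_inj => x.
  by rewrite rmorph0; apply: contrapT => /eqP hx; apply: nx; exists x.
exists (ev x f / ev x h).
have fh g : reg_r g f * h = f * reg_r g h.
  apply: (@ff_in_inj _ _ K); apply/eqP; rewrite !rmorphM -eqr_div ?ff_in_neq0 //;
    last by apply: iso_neq0.
  by rewrite -[X in _ == X](yG g) /= ff_ext_funE.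
have -> : f = (ev x f / ev x h) *: h.
  apply: ag_ev_inj => z; rewrite -[LHS]/(ev z f) -[RHS]/(ev z _) evZ.
  (* The identity for the group element x^-1 z, evaluated at x, reads f(z) h(x) = f(x) h(z). *)
  have := congr1 (ev x) (fh (x^-1 * z)%g); rewrite !evM.
  rewrite [ev x (reg_r _ f)]reg_rE [ev x (reg_r _ h)]reg_rE mulVKg => e.
  by rewrite mulrAC -e mulfK.
by rewrite ff_in_scale mulfK ?ff_in_neq0 // evZ mulfK.
Qed.

(** * Regular families of algebra maps as maps over k(G) *)

Section OrbitMap.
Context {B A : algType k} (phi : G -> B -> A).
Hypothesis phiD : forall x, {morph phi x : b b' / b + b'}.
Hypothesis phiM : forall x, {morph phi x : b b' / b * b'}.
Hypothesis phi1 : forall x, phi x 1 = 1.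
Hypothesis phiZ : forall x c b, phi x (c *: b) = c *: phi x b.
Hypothesis phi_regular : forall b, exists w, regular_rep (phi^~ b) w.

Definition orbit (b : B) : basechange i A := sval (cid (phi_regular b)).

Lemma orbitP b : regular_rep (phi^~ b) (orbit b).
Proof. exact: (svalP (cid (phi_regular b))). Qed.

Lemma orbit_balanced : balanced i (fun b y => y *: orbit b).
Proof.
have eqx (w w' : basechange i A) F F' y : regular_rep F w ->
    regular_rep F' w' -> F =1 F' -> y *: w = y *: w'.
  by move=> Fw Fw' FF'; rewrite (regular_rep_uniq Fw Fw').
split=> [b b' y|b y y'|c b y].
- rewrite -scalerDr; apply: eqx (orbitP _) (regular_repD (orbitP b) (orbitP b')) _.
  by move=> x; rewrite phiD.
- by rewrite scalerDl.
- rewrite mulrC -scalerA.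
  apply: eqx (orbitP _) (regular_repZ c%:A (orbitP b)) _ => x.
  by rewrite phiZ evZ ev1 mulr1.
Qed.

Definition orbit_fun (w : basechange i B) : basechange i A :=
  bc_lift (fun b y => y *: orbit b) w.

Lemma orbit_funD : {morph orbit_fun : v w / v + w}.
Proof. exact: (bc_liftD orbit_balanced). Qed.

Lemma orbit_fun_tensor b y : orbit_fun (bc_tensor i b y) = y *: orbit b.
Proof. exact: (bc_lift_tensor orbit_balanced). Qed.

Lemma orbit_funM : {morph orbit_fun : v w / v * w}.
Proof.
have orbitM b b' : orbit (b * b') = orbit b * orbit b'.
  apply: regular_rep_uniq (orbitP _) (regular_repM (orbitP b) (orbitP b')) _.
  by move=> x; rewrite phiM.
move=> v w.
apply: (bc_additive_eq (f := fun w => orbit_fun (v * w))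
  (g := fun w => orbit_fun v * orbit_fun w)) => [x y|x y|b' y'].
- by rewrite mulrDr orbit_funD.
- by rewrite orbit_funD mulrDr.
apply: (bc_additive_eq (f := fun v => orbit_fun (v * bc_tensor i b' y'))
  (g := fun v => orbit_fun v * orbit_fun (bc_tensor i b' y'))) => [x y|x y|b y].
- by rewrite mulrDl orbit_funD.
- by rewrite orbit_funD mulrDl.
by rewrite bc_tensorM !orbit_fun_tensor orbitM -scalerAr -scalerAl scalerA mulrC.
Qed.

Lemma orbit_funZ : scalable orbit_fun.
Proof.
move=> z w; apply: (bc_additive_eq (f := fun w => orbit_fun (z *: w))
  (g := fun w => z *: orbit_fun w)) => [x y|x y|b y].
- by rewrite scalerDr orbit_funD.
- by rewrite orbit_funD scalerDr.
by rewrite scale_bc_tensor !orbit_fun_tensor scalerA.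
Qed.

Lemma orbit_in b : orbit_fun (bc_in i b) = orbit b.
Proof. by rewrite orbit_fun_tensor scale1r. Qed.

Lemma orbit_fun1 : orbit_fun 1 = 1.
Proof.
rewrite -[1 in LHS](@bc_in1 _ _ i) orbit_in.
apply: regular_rep_uniq (orbitP 1) (regular_rep_cst 1) _ => x.
by rewrite phi1.
Qed.

Definition orbit_map : {lrmorphism basechange i B -> basechange i A} :=
  HB.pack orbit_fun
    (GRing.isZmodMorphism.Build _ _ orbit_fun (morphD_zmod orbit_funD))
    (GRing.isMonoidMorphism.Build _ _ orbit_fun (orbit_fun1, orbit_funM))
    (GRing.isScalable.Build _ _ _ _ orbit_fun orbit_funZ).

(** This pointwise description is all that [nabla] and [delta] retain of the construction. *)
Lemma orbit_map_regular F w : regular_rep F w ->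
  regular_rep (fun x => phi x (F x)) (orbit_map w).
Proof.
move=> [s [-> sF]].
have phi0 x : phi x 0 = 0 by apply: (addIr (phi x 0)); rewrite -phiD !add0r.
have FE x : phi x (F x) = \sum_(p <- s) ev x p.2 *: phi x p.1.
  rewrite sF (big_morph _ (phiD x) (phi0 x)).
  by apply: eq_bigr => p _; rewrite phiZ.
have [r [rw rF]] := regular_rep_sum s (fun p => regular_repZ p.2 (orbitP p.1)).
exists r; split=> [|x]; last by rewrite FE rF.
rewrite -rw rmorph_sum; apply: eq_bigr => p _.
by rewrite /= orbit_fun_tensor.
Qed.

End OrbitMap.

End RegularFunctions.

(** * G-prime ideals are prime *)

Section Span.
Context {k : fieldType} {V : lmodType k}.
Implicit Types (s : seq V) (S X : set V).

Definition spanned s : set V :=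
  [set x | forall S, subspace S -> (forall a, a \in s -> S a) -> S x].

Lemma subspace_spanned s : subspace (spanned s).
Proof.
split=> [S [S0 _] //|c x y xs ys S Ss sS].
by case: (Ss) => _; apply; [apply: xs|apply: ys].
Qed.

Lemma spanned_mem s a : a \in s -> spanned s a.
Proof. by move=> a_s S _; apply. Qed.

Lemma subspaceB (S : set V) x y : subspace S -> S x -> S y -> S (x - y).
Proof. by move=> [_ Sl] Sx Sy; rewrite -scaleN1r addrC; apply: Sl. Qed.

Lemma spanned_cons a s x : spanned (a :: s) x -> exists c, spanned s (x - c *: a).
Proof.
move=> xs; apply: (xs [set y | exists c, spanned s (y - c *: a)]).
  split.
    by exists 0; rewrite scale0r subr0; case: (subspace_spanned s).
  move=> c y z [b yb] [b' zb']; exists (c * b + b').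
  rewrite scalerDl -scalerA opprD addrACA -scalerBr.
  by case: (subspace_spanned s) => _; apply.
move=> b; rewrite inE => /orP[/eqP ->|bs].
  by exists 1; rewrite scale1r subrr; case: (subspace_spanned s).
by exists 0; rewrite scale0r subr0; apply: spanned_mem.
Qed.

Lemma spanned_trans s X : subspace X -> (forall a, a \in s -> X a) -> spanned s `<=` X.
Proof. by move=> Xs sX x; apply. Qed.

(** If some element of X has a nonzero coefficient on the head of [s], subtracting its multiples
    moves the rest of X into the span of the tail. *)
Lemma subspace_finite s X : subspace X -> X `<=` spanned s ->
  exists t, (forall a, a \in t -> X a) /\ X `<=` spanned t.
Proof.
elim: s X => [|a s IHs] X Xs Xspan.
  by exists [::].
have [||t [tX tspan]] := IHs (X `&` spanned s).
- split; first by split; [case: Xs|case: (subspace_spanned s)].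
  move=> c x y [Xx sx] [Xy sy]; split; first by case: Xs => _; apply.
  by case: (subspace_spanned s) => _; apply.
- by move=> x [].
have [[x0 [c0 [Xx0 c00 x0s]]]|nX] := pselect (exists x0 c0,
    [/\ X x0, c0 != 0 & spanned s (x0 - c0 *: a)]).
  exists (x0 :: t); split.
    by move=> b; rewrite inE => /orP[/eqP -> //|/tX[]].
  move=> x Xx; have [c xs] := spanned_cons (Xspan x Xx).
  have Xx' : X (x - (c / c0) *: x0).
    exact: (subspaceB Xs Xx (subspaceZ _ Xs Xx0)).
  have sx' : spanned s (x - (c / c0) *: x0).
    have -> : x - (c / c0) *: x0 = (x - c *: a) - (c / c0) *: (x0 - c0 *: a).
      by rewrite scalerBr scalerA divfK // opprB addrA subrK.
    have ss := subspace_spanned s.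
    exact: (subspaceB ss xs (subspaceZ _ ss x0s)).
  move=> S Ss tS; rewrite -(subrK ((c / c0) *: x0) x); apply: subspaceD => //.
    apply: (tspan _ (conj Xx' sx')) => // b bt; apply: tS.
    by rewrite inE bt orbT.
  by apply: subspaceZ => //; apply: tS; rewrite mem_head.
exists t; split=> [b /tX[] //|x Xx].
apply: tspan; split=> //; have [c xs] := spanned_cons (Xspan x Xx).
have c0 : c = 0.
  by apply: contrapT => /eqP c0; apply: nX; exists x, c.
by move: xs; rewrite c0 scale0r subr0.
Qed.

End Span.

Lemma ideal_subspace (k : fieldType) (A : algType k) (I : set A) :
  is_ideal I -> subspace I.
Proof.
move=> [I0 ID IM]; split=> // c x y Ix Iy; apply: ID => //.
by rewrite -mulr_algl; have [] := IM c%:A _ Ix.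
Qed.

Section RationalAction.
Context {k : closedFieldType} {G : affine_group k} {R : algType k}.
Variable rho : alg_action G R.
Hypothesis rho_rational : rational_action rho.

Lemma orbit_rep r : exists s : seq (R * ag_coord G),
  forall x, rho x r = \sum_(p <- s) ev x p.2 *: p.1.
Proof.
have [n [v [M [_ [c rE] [_ _ Mreg _] Mv]]]] := rho_rational r.
have /choice[f fP] : forall ab : 'I_n * 'I_n, exists f, forall x,
    M x ab.1 ab.2 = ev x f.
  by move=> [a b]; have [f fP] := Mreg a b; exists f.
exists [seq (v a, c b *: f (a, b)) | a <- enum 'I_n, b <- enum 'I_n] => x.
rewrite big_allpairs_dep exchange_big /= big_enum rE rmorph_sum.
apply: eq_bigr => b _; rewrite [LHS]linearZ /= Mv scaler_sumr big_enum.
by apply: eq_bigr => a _; rewrite evZ scalerA -fP.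
Qed.

Lemma orbit_rep_inv r : exists s : seq (R * ag_coord G),
  forall x, rho x^-1%g r = \sum_(p <- s) ev x p.2 *: p.1.
Proof.
have [s sP] := orbit_rep r; have [h hP] := choice (@ag_invP _ G).
exists [seq (p.1, h p.2) | p <- s] => x; rewrite sP big_map.
by apply: eq_bigr => p _; rewrite /ev -hP.
Qed.

Lemma quot_regular (K : function_field G) (P : proper_ideal R) (F : G -> R)
    (s : seq (R * ag_coord G)) :
  (forall x, F x = \sum_(p <- s) ev x p.2 *: p.1) ->
  exists w : basechange (ff_const K) (quot P), regular_rep (to_quot P \o F) w.
Proof.
move=> sF.
exists (\sum_(p <- s) bc_tensor (ff_const K) (to_quot P p.1) (@ff_in _ _ K p.2)).
exists [seq (to_quot P p.1, p.2) | p <- s]; rewrite big_map; split=> // x.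
rewrite /= sF rmorph_sum big_map; apply: eq_bigr => p _.
by rewrite [LHS]to_quotZ.
Qed.

Lemma orbit_quot_regular (K : function_field G) (P : proper_ideal R) r :
  exists w : basechange (ff_const K) (quot P),
    regular_rep (fun x => to_quot P (rho x r)) w.
Proof. by have [s /(quot_regular K P)] := orbit_rep r. Qed.

Lemma orbit_inv_quot_regular (K : function_field G) (P : proper_ideal R) r :
  exists w : basechange (ff_const K) (quot P),
    regular_rep (fun x => to_quot P (rho x^-1%g r)) w.
Proof. by have [s /(quot_regular K P)] := orbit_rep_inv r. Qed.

Definition orbit_core (J : set R) : set R := [set r | forall x, J (rho x r)].

Lemma orbit_core_ideal J : is_ideal J -> is_ideal (orbit_core J).
Proof.
move=> [J0 JD JM]; split=> [x|r s Jr Js x|u r Jr].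
- by rewrite rmorph0.
- by rewrite rmorphD; apply: JD (Jr x) (Js x).
by split=> x; rewrite rmorphM; have [] := JM (rho x u) _ (Jr x).
Qed.

Lemma orbit_core_stable J : gstable rho (orbit_core J).
Proof.
move=> g; rewrite image_isoE; apply/seteqP; split=> r /= Jr x.
  by have := Jr (x * g)%g; rewrite act_funM act_invK.
by rewrite -act_funM.
Qed.

Lemma orbit_core_sub J : orbit_core J `<=` J.
Proof. by move=> r /(_ 1%g); rewrite act_fun1. Qed.

Lemma gstable_act I : gstable rho I -> forall g r, I r -> I (rho g r).
Proof. by move=> Is g r Ir; rewrite -(Is g); exists r. Qed.

Variable I : gspec rho.

(* Zorn's lemma: chains are bounded because the orbit of an element lies in a
   finite-dimensional space, so that a union of ideals containing the orbit has a
   member that already contains it. *)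
Lemma exists_prime_with_core : exists P : set R,
  [/\ is_prime P, ideal_set I `<=` P & orbit_core P `<=` ideal_set I].
Proof.
have [iI I1 Is IP] := gspecP I.
(* The union with I admits the empty chain. *)
pose Pr (J : set R) := is_ideal (J `|` ideal_set I) /\
  orbit_core (J `|` ideal_set I) `<=` ideal_set I.
have [|P0 [[iP coreP] Pmax]] := @Zorn_bigcup R Pr.
  move=> F FP Ftot; rewrite /Pr; set J := _ `|` _.
  have iJ : is_ideal J.
    split; first by right; case: iI.
      move=> x y [[X FX Xx]|Ix] [[Y FY Yy]|Iy].
      - have [XY|YX] := Ftot X Y FX FY.
          have [[_ YD _] _] := FP Y FY.
          by have [] := YD x y (or_introl (XY _ Xx)) (or_introl Yy);
            [left; exists Y|right].
        have [[_ XD _] _] := FP X FX.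
        by have [] := XD x y (or_introl Xx) (or_introl (YX _ Yy));
          [left; exists X|right].
      - have [[_ XD _] _] := FP X FX.
        by have [] := XD x y (or_introl Xx) (or_intror Iy);
          [left; exists X|right].
      - have [[_ YD _] _] := FP Y FY.
        by have [] := YD x y (or_intror Ix) (or_introl Yy);
          [left; exists Y|right].
      - by right; case: iI => _ + _; apply.
    move=> u x [[X FX Xx]|Ix].
      have [[_ _ XM] _] := FP X FX; have [Xux Xxu] := XM u x (or_introl Xx).
      by split; [case: Xux|case: Xxu] => ?; by [left; exists X|right].
    by case: iI => _ _ /(_ u x Ix)[]; split; right.
  split=> // r rJ; have [s sP] := orbit_rep r.
  (* The orbit of r lies in J and in a finite-dimensional space. The part of J in that space has a
     finite spanning list, which one member of the chain, or I alone, already contains. *)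
  have [||t [tJ tspan]] := @subspace_finite _ R [seq p.1 | p <- s]
      (J `&` spanned [seq p.1 | p <- s]).
  - have [J0 Jl] := ideal_subspace iJ.
    have [s0 sl] := subspace_spanned [seq p.1 | p <- s].
    by split=> // c x y [Jx sx] [Jy sy]; split; [apply: Jl|apply: sl].
  - by move=> x [].
  have [X [XP Xt]] : exists X, Pr X /\ forall a, a \in t -> (X `|` ideal_set I) a.
    have {tJ} : forall a, a \in t -> J a by move=> a /tJ[].
    suff : forall t : seq R, (forall a, a \in t -> J a) ->
        (forall a, a \in t -> ideal_set I a) \/
        exists2 X, F X & forall a, a \in t -> (X `|` ideal_set I) a.
      move=> H /H[tI|[X FX Xt]]; last by exists X; split=> //; apply: FP.
      exists set0; split; last by move=> a /tI; right.
      rewrite /Pr set0U; split=> //; exact: orbit_core_sub.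
    elim=> [|a t' IHt tJ]; first by left.
    have [|t'I|[X FX Xt']] := IHt.
    - by move=> b bt; apply: tJ; rewrite inE bt orbT.
    - have [[X FX Xa]|Ia] := tJ a (mem_head _ _).
        right; exists X => // b; rewrite inE => /orP[/eqP ->|/t'I]; by [left|right].
      by left=> b; rewrite inE => /orP[/eqP ->|/t'I].
    - right; have [[Y FY Ya]|Ia] := tJ a (mem_head _ _); last first.
        by exists X => // b; rewrite inE => /orP[/eqP ->|/Xt' //]; right.
      have [XY|YX] := Ftot X Y FX FY.
        exists Y => // b; rewrite inE => /orP[/eqP ->|/Xt'[]]; first by left.
          by move=> /XY; left.
        by right.
      exists X => // b; rewrite inE => /orP[/eqP ->|/Xt' //].
      by left; apply: YX.
  have [iX coreX] := XP; apply: coreX => x.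
  apply: (spanned_trans (ideal_subspace iX) Xt); apply: tspan; split; first exact: rJ.
  rewrite sP; have := subspace_spanned [seq p.1 | p <- s]; rewrite big_seq => ss.
  apply: big_rec => [|p y ps sy]; first by case: ss.
  by case: ss => _; apply=> //; apply: spanned_mem; apply: map_f.
set P := P0 `|` ideal_set I in iP coreP.
have IsubP : ideal_set I `<=` P by move=> x; right.
exists P; split=> //; split=> //.
  move=> P1; apply: I1; apply: coreP => x.
  by rewrite rmorph1.
(* When A is not inside P, the sum A + P is strictly larger than P, so by maximality its core is not
   inside I. *)
have big A : is_ideal A -> ~ A `<=` P -> exists A' : set R,
    [/\ is_ideal A', gstable rho A', ~ A' `<=` ideal_set I &
        forall r, A' r -> forall x, exists a p, [/\ A a, P p & rho x r = a + p]].
  move=> iA nAP; pose AP : set R := [set y | exists a p, [/\ A a, P p & y = a + p]].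
  have PA : P `<=` AP.
    by move=> p Pp; exists 0, p; rewrite add0r; split=> //; case: iA.
  have iAP : is_ideal AP.
    have [A0 AD AM] := iA; have [P00 PD PM] := iP.
    split; first by apply: PA.
      move=> _ _ [a [p [Aa Pp ->]]] [a' [p' [Aa' Pp' ->]]].
      by exists (a + a'), (p + p'); rewrite addrACA; split; [apply: AD|apply: PD|].
    move=> u _ [a [p [Aa Pp ->]]]; split.
      by exists (u * a), (u * p); rewrite mulrDr; split=> //;
        [have [] := AM u _ Aa|have [] := PM u _ Pp].
    by exists (a * u), (p * u); rewrite mulrDl; split=> //;
      [have [] := AM u _ Aa|have [] := PM u _ Pp].
  exists (orbit_core AP); split=> //.
  - exact: orbit_core_ideal.
  - exact: orbit_core_stable.
  move=> APsub; have APE : AP `|` ideal_set I = AP.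
    by apply/seteqP; split=> x; [case=> // /IsubP/PA|left].
  apply: (Pmax AP); last by rewrite /Pr APE.
  split; first by move=> y P0y; apply: PA; left.
  move=> APP0; apply: nAP => a Aa; left; apply: APP0; exists a, 0.
  by rewrite addr0; split=> //; case: iP.
move=> A B iA iB ABP; apply: contrapT => /not_orP[nA nB].
have [A' [iA' sA' nA' A'P]] := big A iA nA.
have [B' [iB' sB' nB' B'P]] := big B iB nB.
have [|/nA'|/nB'] // := IP A' B' iA' iB' sA' sB'.
move=> _ [s [sP ->]]; apply: is_ideal_sum => // -[a b] /sP[/= A'a B'b].
apply: coreP => x; have -> : rho x (a * b) = rho x a * rho x b by exact: rmorphM.
have [a1 [p1 [Aa1 Pp1 ->]]] := A'P a A'a x.
have [b1 [p2 [Bb1 Pp2 ->]]] := B'P b B'b x.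
have [_ PD PM] := iP; rewrite mulrDr mulrDl -addrA; apply: (PD).
  by apply: ABP; apply: ideal_prodMr.
apply: PD; first by have [] := PM b1 _ Pp1.
by have [] := PM (a1 + p1) _ Pp2.
Qed.

(** Take a prime P containing I with core inside I. If a and b are outside I, their orbit functions
    modulo P are nonzero, so x.a and x.b are both outside P for some x; but (x.a) R (x.b) lies in I
    by stability, hence in P. *)
Lemma gprime_elt_prime (K : function_field G) : elt_prime (ideal_set I).
Proof.
have [P [primeP IP coreP]] := exists_prime_with_core.
have [iP P1 _] := primeP; have ePP := is_prime_elt primeP.
pose Pi := ProperIdeal iP P1.
have nz r (w : basechange (ff_const K) (quot Pi)) :
    regular_rep (fun x => to_quot Pi (rho x r)) w -> ~ ideal_set I r ->
    w != 0.
  move=> rw nIr; apply/eqP => w0; rewrite w0 in rw; apply: nIr; apply: coreP => x.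
  by apply/(to_quot_eq0 Pi)/(regular_rep_eq0 rw).
move=> a b ab; apply: contrapT => /not_orP[na nb].
have [v av] := orbit_quot_regular K Pi a.
have [w bw] := orbit_quot_regular K Pi b.
have [x [xa xb]] := common_point av bw (nz _ _ av na) (nz _ _ bw nb).
have [r|Pa|Pb] := ePP (rho x a) (rho x b).
- have -> : rho x a * r * rho x b = rho x (a * rho x^-1%g r * b).
    by rewrite !rmorphM /= act_invK.
  by apply: IP; apply: gstable_act; [case: (gspecP I)|apply: ab].
- by move: xa; rewrite (proj2 (to_quot_eq0 Pi _) Pa) eqxx.
- by move: xb; rewrite (proj2 (to_quot_eq0 Pi _) Pb) eqxx.
Qed.

End RationalAction.

(** * Descent along right translations *)

Section Descent.
Context {k : closedFieldType} {G : affine_group k} (K : function_field G).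
Context {A : algType k}.
Local Notation i := (ff_const K).
Local Notation AK := (basechange i A).
Local Notation shift g := (bc_iso (alg_iso_id A) (ff_r_const K g)).

Variable J : set AK.
Hypotheses (iJ : is_ideal J) (J1 : ~ J 1).
Hypothesis J_stable : forall g w, J w -> J (shift g w).

Definition descended : set A := [set a | J (bc_in i a)].

Let JZ y w : J w -> J (y *: w).
Proof.
by move=> Jw; rewrite -mulr_algl; have [_ _ JM] := iJ; have [] := JM y%:A _ Jw.
Qed.

Lemma descended_ideal : is_ideal descended.
Proof.
have [J0 JD JM] := iJ; split.
- by move: J0; rewrite -(rmorph0 (@bc_in _ _ i A)).
- by move=> a b Ja Jb; rewrite /descended /= bc_inD; apply: JD.
by move=> u a Ja; rewrite /descended /= !bc_inM; apply: JM.
Qed.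

Lemma descended1 : ~ descended 1.
Proof. by rewrite /descended /= bc_in1. Qed.

Definition descended_proper : proper_ideal A :=
  ProperIdeal descended_ideal descended1.

Local Notation P := descended_proper.
Local Notation pi := (bc_map (to_quot P)).

Let pil : linear (to_quot P).
Proof. by move=> c x y; rewrite linearP. Qed.

(** Modulo elements of P, the first tensor factors become combinations of lifts of finitely many
    classes. The coefficients are then forms evaluated on pi w, hence zero. *)
Lemma kernel_sub_descended w : pi w = 0 -> J w.
Proof.
have [s ->] := bc_in_sum_ex w => piw.
have [E [Es EP]] := finite_rank_projection [seq to_quot P p.1 | p <- s].
pose rem a := a - \sum_(e <- E) e.1 (to_quot P a) *: quot_repr e.2.
have remP p : p \in s -> descended (rem p.1).
  move=> ps; apply/(to_quot_eq0 P).
  rewrite /rem (linear_funB pil) [X in X - _](EP _ (map_f _ ps)).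
  rewrite (big_morph _ (linear_funD pil) (linear_fun0 pil)).
  apply/eqP; rewrite subr_eq0; apply/eqP; apply: eq_bigr => e _.
  by rewrite [RHS](linear_funZ pil) quot_reprK.
have -> : \sum_(p <- s) p.2 *: bc_in i p.1 =
    \sum_(p <- s) p.2 *: bc_in i (rem p.1)
    + \sum_(p <- s) p.2 *: bc_in i (\sum_(e <- E) e.1 (to_quot P p.1) *: quot_repr e.2).
  by rewrite -big_split; apply: eq_bigr => p _ /=; rewrite -scalerDr -bc_inD subrK.
have [J0 JD _] := iJ; apply: (JD).
  by apply: is_ideal_sum => // p ps; apply: JZ; apply: remP.
suff -> : \sum_(p <- s)
    p.2 *: bc_in i (\sum_(e <- E) e.1 (to_quot P p.1) *: quot_repr e.2) = 0 by [].
transitivity (\sum_(e <- E) bc_tensor i (quot_repr e.2)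
    (\sum_(p <- s) i (e.1 (to_quot P p.1)) * p.2)).
  transitivity (\sum_(p <- s) \sum_(e <- E) bc_tensor i (quot_repr e.2)
      (i (e.1 (to_quot P p.1)) * p.2)).
    apply: eq_bigr => p _; rewrite /bc_in bc_tensor_suml scaler_sumr.
    by apply: eq_bigr => e _; rewrite scale_bc_tensor bc_tensorZ mulr1 mulrC.
  by rewrite exchange_big; apply: eq_bigr => e _; rewrite bc_tensor_sumr.
rewrite big_seq big1 // => e eE.
have -> : \sum_(p <- s) i (e.1 (to_quot P p.1)) * p.2 =
    bc_form e.1 (pi (\sum_(p <- s) p.2 *: bc_in i p.1)).
  rewrite (big_morph _ (bc_mapD pil) (linear_fun0 (bc_map_linear pil))).
  rewrite (bc_form_sum (Es e eE)); apply: eq_bigr => p _.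
  rewrite scale_bc_tensor mulr1 (bc_map_tensor i pil).
  by rewrite (bc_form_tensor i (Es e eE)).
by rewrite piw (bc_form0 i (Es e eE)) bc_tensor0r.
Qed.

Lemma bc_form_shift (B : algType k) (l : B -> k) g (w : basechange i B) : scalar l ->
  bc_form l (bc_iso (alg_iso_id B) (ff_r_const K g) w) = ff_r K g (bc_form l w).
Proof.
move=> ls; move: w; apply: bc_additive_eq => [x y|x y|b y].
- by rewrite rmorphD bc_formD.
- by rewrite bc_formD // rmorphD.
rewrite [bc_iso _ _ _](bc_fun_tensor _ (ff_r_const K g)).
by rewrite !bc_form_tensor // [RHS]rmorphM ff_r_const.
Qed.

(** The coordinates of w are invariant rational functions, hence constants. *)
Lemma shift_fixed (B : algType k) (w : basechange i B) :
  (forall g, bc_iso (alg_iso_id B) (ff_r_const K g) w = w) ->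
  exists b, w = bc_in i b.
Proof.
move=> wG; have [E [Es wE]] := bc_form_expansion w.
have /choice[c cP] : forall e : (B -> k) * B, exists c, e \in E ->
    bc_form e.1 w = i c.
  move=> e; have [eE|_] := boolP (e \in E); last by exists 0.
  have [g|c cP] := @ff_fixed _ _ K (bc_form e.1 w); last by exists c.
  by rewrite -bc_form_shift ?wG //; apply: Es.
exists (\sum_(e <- E) c e *: e.2).
rewrite {1}wE /bc_in bc_tensor_suml !big_seq; apply: eq_bigr => e eE.
by rewrite cP // bc_tensorZ mulr1.
Qed.

(* Induction on the number of terms: after rescaling one coefficient to 1, the
   difference of w and its translate is a shorter element of J, so pi w is fixed
   by the translations and is defined over k. *)
Lemma descended_sub_kernel w : J w -> pi w = 0.
Proof.
have [s ->] := bc_sum_ex w; move: {2}(size s) (leqnn (size s)) => n.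
elim: n s {w} => [|n IHn] [|[a y] s] //=.
- by rewrite big_nil (linear_fun0 (bc_map_linear pil)).
- by rewrite big_nil (linear_fun0 (bc_map_linear pil)).
rewrite ltnS => sn Jw; have [y0|y0] := eqVneq y 0.
  rewrite big_cons /= y0 bc_tensor0r add0r; apply: IHn => //.
  by move: Jw; rewrite big_cons /= y0 bc_tensor0r add0r.
set w := \sum_(p <- _) _ in Jw *.
pose v := y^-1 *: w; have Jv : J v by apply: JZ.
have vE : v = bc_tensor i a 1 + \sum_(p <- s) bc_tensor i p.1 (y^-1 * p.2).
  rewrite /v /w big_cons scalerDr scale_bc_tensor /= mulVf // scaler_sumr.
  by congr (_ + _); apply: eq_bigr => p _; rewrite scale_bc_tensor.
have shiftv g : pi (shift g v) = pi v.
  apply/eqP; rewrite -subr_eq0 -(linear_funB (bc_map_linear pil)); apply/eqP.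
  have e : shift g v - v =
      \sum_(p <- [seq (p.1, ff_r K g (y^-1 * p.2) - y^-1 * p.2) | p <- s])
        bc_tensor i p.1 p.2.
    rewrite vE big_map rmorphD rmorph_sum opprD addrACA.
    rewrite [bc_iso _ _ _](bc_fun_tensor _ (ff_r_const K g)) rmorph1 subrr add0r.
    rewrite -sumrB; apply: eq_bigr => p _.
    by rewrite [X in X - _](bc_fun_tensor _ (ff_r_const K g)) bc_tensorBr.
  have Je : J (shift g v - v).
    have [_ JD _] := iJ; apply: JD; first exact: J_stable.
    exact: is_idealN.
  by rewrite e in Je *; apply: IHn => //; rewrite size_map.
have [b piv] : exists b, pi v = bc_in i b.
  apply: shift_fixed => g; rewrite -[RHS](shiftv g).
  move: (v); apply: bc_additive_eq => [x z|x z|c z].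
  - by rewrite (bc_mapD pil) rmorphD.
  - by rewrite rmorphD (bc_mapD pil).
  rewrite [shift g _](bc_fun_tensor _ (ff_r_const K g)) !(bc_map_tensor i pil).
  by rewrite [LHS](bc_fun_tensor _ (ff_r_const K g)).
(* Since v - a' lies in the kernel of pi, hence in J, so does a'; therefore b = 0. *)
have [a' bE] := quot_ex b.
have Ja' : descended a'.
  rewrite /descended /=; have -> : bc_in i a' = v - (v - bc_in i a') by rewrite subKr.
  have [_ JD _] := iJ; apply: JD => //; apply: is_idealN => //.
  apply: kernel_sub_descended; rewrite (linear_funB (bc_map_linear pil)) piv.
  by rewrite (bc_map_tensor i pil) bE subrr.
have -> : w = y *: v by rewrite /v scalerA mulfV // scale1r.
rewrite (bc_mapZ pil) piv bE (proj2 (to_quot_eq0 P _) Ja').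
by rewrite (rmorph0 (@bc_in _ _ i (quot P))) scaler0.
Qed.

End Descent.

(** * Scalar extended centroids *)

Section Scalars.
Context {L : fieldType}.

Definition all_scalars (D : algType L) : Prop := forall v : D, exists x : L, v = x%:A.

Lemma ec_scalar_in (D : algType L) (x : L) (v : D) :
  ec_val (x%:A : extcentroid D) * am_in v = am_in (x *: v).
Proof.
by rewrite ec_valZ ec_val1 -scalerAl mul1r (linear_funZ (@am_in_linear _ _)).
Qed.

Lemma all_scalars_ec (D : algType L) : prime_ring D -> all_scalars D ->
  all_scalars (extcentroid D).
Proof.
move=> prD sD z; have [J fJ JP] := ec_dom z.
have [v Jv v0] := in_filter_neq0 fJ; have [v' zv] := JP v Jv.
have [x vE] := sD v; have [x' v'E] := sD v'.
have x0 : x != 0 by apply: contra_neq v0 => x0; rewrite vE x0 scale0r.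
exists (x' / x); apply: (ec_eq prD zv _ v0).
by rewrite ec_scalar_in vE v'E scalerA divfK.
Qed.

(** A commutative D embeds in its extended centroid: v is the ratio of the pair (1, v). *)
Lemma ec_all_scalars (D : algType L) : prime_ring D ->
  (forall v w : D, v * w = w * v) ->
  all_scalars (extcentroid D) -> all_scalars D.
Proof.
move=> prD DC sC v.
have [||c cP] := ec_of_pairs prD (S := fun w w' => w = 1 /\ w' = v).
- move=> w1 w1' w2 w2' x [-> ->] [-> ->].
  by rewrite mul1r mulr1 DC.
- by exists 1, v; split=> //; apply: oner_neq0.
have [x cE] := sC c; exists x; apply: am_in_inj.
by rewrite -(cP 1 v) // cE ec_scalar_in.
Qed.

Lemma all_scalars_iso (D : algType L) :
  all_scalars D <-> inhabited (alg_iso D L^o).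
Proof.
split=> [sD|[f] v]; last first.
  exists (f v); apply: (can_inj (iso_funK f)).
  rewrite (alg_iso_scalable f) rmorph1.
  exact: (esym (mulr1 _)).
have [g gP] := choice sD.
pose e (x : L^o) : D := (x : L)%:A.
have eD : {morph e : x y / x + y} by move=> x y; rewrite /e scalerDl.
have eM : {morph e : x y / x * y}.
  by move=> x y; rewrite /e -scalerAl mul1r scalerA.
have e1 : e 1 = 1 by rewrite /e scale1r.
have eK : cancel e g.
  move=> x; apply: (fmorph_inj (in_alg D)).
  by rewrite /= -gP.
have gK : cancel g e by move=> v; rewrite /e -gP.
have es : scalable (mk_ring_iso eD eM e1 eK gK).
  by move=> a x; rewrite /= /e scalerA.
by constructor; apply: alg_iso_sym (AlgIso es).
Qed.

Lemma alg_iso_scalars (D E : algType L) (f : alg_iso D E) :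
  all_scalars D <-> all_scalars E.
Proof.
split=> [sD v|sE v].
  have [x vE] := sD (iso_inv f v); exists x.
  by rewrite -[v](iso_invK f) vE (alg_iso_scalable f) rmorph1.
have [x vE] := sE (f v); exists x; apply: (can_inj (iso_funK f)).
by rewrite vE (alg_iso_scalable f) rmorph1.
Qed.

End Scalars.

Section ScalarExtension.
Context {k L : fieldType} (i : {rmorphism k -> L}) {A : algType k}.
Hypotheses (prA : prime_ring A) (prAL : prime_ring (basechange i A)).

(** Forward: with d the identity of A (x) L, the heart isomorphism identifies the extended centroid
    of A (x) L with that of a quotient of C(A) (x) L, in which everything is a scalar. Backward: if
    c a = a', the pair (a, a') has in A (x) L a scalar ratio x, and a form with value 1 at a shows
    that x comes from k. *)
Lemma basechange_scalars :
  all_scalars (extcentroid A) <-> all_scalars (extcentroid (basechange i A)).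
Proof.
split=> [sC|sCL c].
  pose d : {lrmorphism basechange i A -> basechange i A} := idfun.
  have d_inj u : d (bc_in i u) = 0 -> u = 0 by apply: bc_tensor_eq0.
  have d_surj v : exists w, d w = v by exists v.
  pose q := ProperIdeal (contraction_ideal prAL d_inj d_surj)
    (contraction1 prAL d_inj d_surj).
  pose p : {lrmorphism _ -> quot q} := to_quot q.
  have p_surj v : exists t, p t = v by have [t ->] := quot_ex v; exists t.
  have p_ker t : p t = 0 <-> contraction d t by apply: (to_quot_eq0 q).
  apply/(alg_iso_scalars (heart_iso prA prAL d_inj d_surj p_surj p_ker)).
  apply: all_scalars_ec.
    exact: (heart_source_prime prAL d_inj d_surj p_surj p_ker).
  move=> v; have [t <-] := p_surj v.
  have [y tE] : exists y, t = y%:A; last by exists y; rewrite tE linearZ /= rmorph1.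
  have [s ->] := bc_in_sum_ex t; elim: s => [|[c y] s [y' sE]].
    by exists 0; rewrite big_nil scale0r.
  have [a ->] := sC c; exists (y * i a + y'); rewrite big_cons sE scalerDl.
  congr (_ + _) => /=; rewrite /bc_in bc_tensorZ mulr1 bc_tensor_in scalerA.
  by rewrite bc_in1.
have [J fJ JP] := ec_dom c; have [a Ja a0] := in_filter_neq0 fJ.
have [a' ca] := JP a Ja.
have aua' u : a * u * a' = a' * u * a.
  apply: am_in_inj; rewrite !am_inM -ca -[RHS]mulrA !mulrA.
  by rewrite -[in LHS]ec_valC !mulrA.
have [||y yP] := ec_of_pairs prAL
  (S := fun v v' => v = bc_in i a /\ v' = bc_in i a').
- move=> v v' w w' x [-> ->] [-> ->]; move: x.
  apply: bc_additive_eq => [x y|x y|u y]; rewrite ?mulrDr ?mulrDl //.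
  by rewrite /bc_in !bc_tensorM aua'.
- exists (bc_in i a), (bc_in i a'); split=> //.
  by apply: contra_neq a0; apply: bc_tensor_eq0.
have [x yE] := sCL y; have [l [ls la]] := exists_form1 a0.
have xa : x *: bc_in i a = bc_in i a'.
  by apply: am_in_inj; rewrite -ec_scalar_in -yE; apply: yP.
have xE : x = i (l a').
  have := congr1 (bc_form l) xa; rewrite bc_formZ // !bc_form_tensor //.
  by rewrite la rmorph1 !mulr1.
have a'E : a' = l a' *: a.
  apply: (@bc_tensor_inj _ _ i); rewrite bc_tensorZ mulr1 -xE.
  by rewrite [RHS]bc_tensor_in xa.
exists (l a'); apply: (ec_eq prA ca _ a0).
by rewrite ec_scalar_in -a'E.
Qed.

End ScalarExtension.

(** * Contractions along a family of quotients of W *)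

Section ContractionFamily.
Context {k L : fieldType} (i : {rmorphism k -> L}) {U : algType k}.

Local Notation W := (basechange i U).
Local Notation C := (extcentroid U).
Local Notation T := (basechange i C).

Hypothesis prU : prime_ring U.
Context {X : Type} (V : X -> algType L) (d : forall x, {lrmorphism W -> V x}).
Hypothesis prV : forall x, prime_ring (V x).
Hypothesis d_inj : forall x u, d x (bc_in i u) = 0 -> u = 0.
Hypothesis d_surj : forall x v, exists w, d x w = v.

Definition contraction_proper x : proper_ideal T :=
  ProperIdeal (contraction_ideal (@prV x) (@d_inj x) (@d_surj x))
    (contraction1 (@prV x) (@d_inj x) (@d_surj x)).

Definition contraction_quot x : {lrmorphism T -> quot (contraction_proper x)} :=
  to_quot (contraction_proper x).

Lemma contraction_quot_surj x v : exists t, contraction_quot x t = v.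
Proof. by have [t ->] := quot_ex v; exists t. Qed.

Lemma contraction_quot_ker x t : contraction_quot x t = 0 <-> contraction (d x) t.
Proof. exact: (to_quot_eq0 (contraction_proper x)). Qed.

Lemma contraction_proper_prime x : is_prime (contraction_proper x).
Proof.
apply: elt_prime_is_prime; [exact: ideal_setP|exact: ideal_set1|].
exact: (contraction_prime (@prV x) (@d_inj x) (@d_surj x)).
Qed.

Definition contraction_heart x :
    alg_iso (extcentroid (quot (contraction_proper x))) (extcentroid (V x)) :=
  heart_iso prU (@prV x) (@d_inj x) (@d_surj x) (@contraction_quot_surj x)
    (@contraction_quot_ker x).

Lemma contraction_heart_natural x x' (f : alg_iso U U) (f_ec : alg_iso C C)
    (s : ring_iso L L) (f_ecE : forall c, f_ec c = ec_iso f c)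
    (si : forall c, s (i c) = i c) (h : ring_iso (V x) (V x'))
    (hd : forall w, h (d x w) = d x' (bc_iso f si w))
    (e : bc_iso f_ec si @` contraction_proper x = contraction_proper x') z :
  contraction_heart x' (ec_iso (quot_iso e) z) = ec_iso h (contraction_heart x z).
Proof.
apply: (heart_natural f_ecE hd) => t.
exact: (quot_funE e).
Qed.

(** The quotient of T is commutative and prime, so it consists of scalars exactly when its extended
    centroid does, and the heart isomorphism moves the condition to [V x]. *)
Lemma contraction_scalars x : all_scalars (extcentroid (V x)) <->
  inhabited (alg_iso (quot (contraction_proper x)) L^o).
Proof.
have prD : prime_ring (quot (contraction_proper x)).
  exact: (heart_source_prime (@prV x) (@d_inj x) (@d_surj x)
    (@contraction_quot_surj x) (@contraction_quot_ker x)).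
have DC (v w : quot (contraction_proper x)) : v * w = w * v.
  have [s ->] := quot_ex v; have [t ->] := quot_ex w.
  by rewrite -!to_quotM bc_ec_mulC.
rewrite -all_scalars_iso -(alg_iso_scalars (contraction_heart x)).
by split; [exact: ec_all_scalars|exact: all_scalars_ec].
Qed.

End ContractionFamily.

(** * The bijection *)

Section SpecBijection.
Context {k : closedFieldType} {G : affine_group k} (K : function_field G).
Context {R : algType k} {rho : alg_action G R}.
Hypothesis rho_rational : rational_action rho.
Variable I : gspec rho.
Local Notation i := (ff_const K).
Local Notation U := (quot I).
Local Notation W := (basechange i U).

Lemma act_gspec x r : ideal_set I r -> ideal_set I (rho x r).
Proof. by case: (gspecP I) => _ _ Is _; apply: gstable_act. Qed.

Lemma prime_ring_gspec : prime_ring U.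
Proof. exact: (prime_ring_quot (gprime_elt_prime rho_rational K)). Qed.

(** * The twist of R (x) k(G) by inverse translations *)

Section Nabla.

Let phi (x : G) (r : R) : U := to_quot I (rho x^-1%g r).

Let phiD x : {morph phi x : r s / r + s}.
Proof. by move=> r s; rewrite /phi !rmorphD. Qed.
Let phiM x : {morph phi x : r s / r * s}.
Proof. by move=> r s; rewrite /phi !rmorphM. Qed.
Let phi1 x : phi x 1 = 1.
Proof. by rewrite /phi !rmorph1. Qed.
Let phiZ x c r : phi x (c *: r) = c *: phi x r.
Proof. by rewrite /phi linearZ /= to_quotZ. Qed.

Lemma nabla_ex : exists n : {lrmorphism basechange i R -> W},
  forall F w, regular_rep F w -> regular_rep (fun x => phi x (F x)) (n w).
Proof.
exists (orbit_map phiD phiM phi1 phiZ (orbit_inv_quot_regular rho_rational K I)).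
by move=> F w; apply: orbit_map_regular.
Qed.

(* r |-> (x |-> class of x^-1 r) *)
Definition nabla : {lrmorphism basechange i R -> W} := sval (cid nabla_ex).

Lemma nabla_regular F w : regular_rep F w ->
  regular_rep (fun x => to_quot I (rho x^-1%g (F x))) (nabla w).
Proof. exact: (svalP (cid nabla_ex)). Qed.

End Nabla.

Lemma orbit_regular r : exists w : basechange i R, regular_rep (rho^~ r) w.
Proof.
have [s sP] := orbit_rep rho_rational r.
by exists (\sum_(p <- s) bc_tensor i p.1 (@ff_in _ _ K p.2)), s.
Qed.

(** As x^-1.(x.r) = r, the twist of an orbit function is constant. Surjectivity of [nabla]
    follows. *)
Lemma nabla_orbit r w : regular_rep (rho^~ r) w -> nabla w = bc_in i (to_quot I r).
Proof.
move=> /nabla_regular rw; apply: regular_rep_uniq rw (regular_rep_cst K _) _ => x.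
by rewrite act_funK.
Qed.

Lemma nablaD : {morph nabla : v w / v + w}.
Proof. exact: rmorphD. Qed.
Lemma nablaM : {morph nabla : v w / v * w}.
Proof. exact: rmorphM. Qed.
Lemma nabla0 : nabla 0 = 0.
Proof. exact: rmorph0. Qed.
Lemma nabla1 : nabla 1 = 1.
Proof. exact: rmorph1. Qed.
Lemma nablaZ y w : nabla (y *: w) = y *: nabla w.
Proof. exact: linearZ. Qed.
Lemma nabla_sum (T : Type) (s : seq T) (F : T -> basechange i R) :
  nabla (\sum_(t <- s) F t) = \sum_(t <- s) nabla (F t).
Proof. exact: rmorph_sum. Qed.

Lemma nabla_surj w : exists v, nabla v = w.
Proof.
have [s ->] := bc_in_sum_ex w; elim: s => [|[q y] s [v vE]].
  by exists 0; rewrite big_nil rmorph0.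
have [r qE] := quot_ex q; have [u rP] := orbit_regular r.
exists (y *: u + v); rewrite big_cons nablaD nablaZ.
by rewrite -vE qE; congr (_ *: _ + _); apply: nabla_orbit.
Qed.

(** * Orbit maps modulo a prime over I *)

Section Delta.
Variable P : spec_over rho I.

Lemma so_sub r : ideal_set I r -> ideal_set P r.
Proof.
move=> Ir; have := so_cap P; rewrite -[RHS]/(ideal_set I) => PI.
have : (\bigcap_g act_iso rho g @` P) r by rewrite PI.
by move=> /(_ 1%g Logic.I) [p Pp <-] /=; rewrite act_fun1.
Qed.

Lemma so_core r : (forall x, ideal_set P (rho x r)) -> ideal_set I r.
Proof.
move=> Pr; have := so_cap P; rewrite -[RHS]/(ideal_set I) => <- g _.
by exists (rho g^-1%g r) => //=; rewrite act_invK.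
Qed.

Lemma prime_ring_so : prime_ring (quot P).
Proof. exact/prime_ring_quot/is_prime_elt/so_prime. Qed.

(** The choice of representative is harmless because I is G-stable and contained in P. *)
Definition point_map (x : G) (q : U) : quot P := to_quot P (rho x (quot_repr q)).

Lemma point_mapE x r : point_map x (to_quot I r) = to_quot P (rho x r).
Proof.
apply/esym/quotP; rewrite -rmorphB; apply: so_sub; apply: act_gspec.
exact: quot_reprP.
Qed.

Let pmD x : {morph point_map x : r s / r + s}.
Proof.
move=> p q; have [r ->] := quot_ex p; have [s ->] := quot_ex q.
by rewrite -to_quotD !point_mapE rmorphD to_quotD.
Qed.
Let pmM x : {morph point_map x : r s / r * s}.
Proof.
move=> p q; have [r ->] := quot_ex p; have [s ->] := quot_ex q.
by rewrite -to_quotM !point_mapE rmorphM to_quotM.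
Qed.
Let pm1 x : point_map x 1 = 1.
Proof. by rewrite [LHS](point_mapE x 1) rmorph1. Qed.
Let pmZ x c q : point_map x (c *: q) = c *: point_map x q.
Proof.
have [r ->] := quot_ex q; rewrite -to_quotZ !point_mapE.
by rewrite [rho x _]linearZ to_quotZ.
Qed.
Let pm_regular q : exists w : basechange i (quot P), regular_rep (point_map^~ q) w.
Proof.
have [r ->] := quot_ex q.
have [w [s [ws sP]]] := orbit_quot_regular rho_rational K P r.
by exists w, s; split=> // x; rewrite point_mapE.
Qed.

Lemma delta_ex : exists d : {lrmorphism W -> basechange i (quot P)}, forall F w,
  regular_rep F w ->
  regular_rep (fun x => point_map x (F x)) (d w).
Proof.
exists (orbit_map pmD pmM pm1 pmZ pm_regular).
by move=> F w; apply: orbit_map_regular.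
Qed.

(* class of r |-> (x |-> class of x r) *)
Definition delta : {lrmorphism W -> basechange i (quot P)} := sval (cid delta_ex).

Lemma delta_regular F w : regular_rep F w ->
  regular_rep (fun x => point_map x (F x)) (delta w).
Proof. exact: (svalP (cid delta_ex)). Qed.

Lemma deltaZ y w : delta (y *: w) = y *: delta w.
Proof. exact: linearZ. Qed.
Lemma delta_sum (T : Type) (s : seq T) (F : T -> W) :
  delta (\sum_(t <- s) F t) = \sum_(t <- s) delta (F t).
Proof. exact: rmorph_sum. Qed.

Lemma to_quot_linear : linear (to_quot P).
Proof. by move=> c x y; rewrite linearP. Qed.

(** Since x.(x^-1.r) = r, the kernel of [delta], pulled back along [nabla], is P (x) k(G) and so is
    defined over k. *)
Lemma delta_nabla w : delta (nabla w) = bc_map (to_quot P) w.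
Proof.
have [s ->] := bc_in_sum_ex w.
rewrite (big_morph _ (bc_mapD to_quot_linear)
  (linear_fun0 (bc_map_linear to_quot_linear))) nabla_sum delta_sum.
apply: eq_bigr => p _; rewrite (bc_mapZ to_quot_linear).
rewrite nablaZ deltaZ; congr (_ *: _).
rewrite (bc_map_tensor i to_quot_linear).
have := delta_regular (nabla_regular (regular_rep_cst K p.1)).
move=> /regular_rep_uniq/(_ (regular_rep_cst K (to_quot P p.1))); apply=> x.
by rewrite point_mapE act_invK.
Qed.

Lemma delta_surj v : exists w, delta w = v.
Proof.
suff [u uE] : exists u, bc_map (to_quot P) u = v.
  by exists (nabla u); rewrite delta_nabla.
have [s ->] := bc_in_sum_ex v.
elim: s => [|[q y] s [u uE]].
  by exists 0; rewrite big_nil (linear_fun0 (bc_map_linear to_quot_linear)).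
have [r qE] := quot_ex q; exists (y *: bc_in i r + u).
rewrite big_cons (bc_mapD to_quot_linear) uE (bc_mapZ to_quot_linear).
by rewrite (bc_map_tensor i to_quot_linear) qE.
Qed.

Lemma delta_in r : regular_rep (fun x => to_quot P (rho x r))
  (delta (bc_in i (to_quot I r))).
Proof.
have [s [sw sP]] := delta_regular (regular_rep_cst K (to_quot I r)).
by exists s; split=> // x; rewrite -sP point_mapE.
Qed.

(** An orbit function that vanishes modulo P has all x.r in P, so r lies in the intersection of the
    g.P. *)
Lemma delta_inj q : delta (bc_in i q) = 0 -> q = 0.
Proof.
have [r ->] := quot_ex q => dr; apply/(to_quot_eq0 I)/so_core => x.
apply/(to_quot_eq0 P); move: x; apply: (@regular_rep_eq0 _ _ K).
by have := delta_in r; rewrite dr.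
Qed.

Lemma prime_ring_extended : prime_ring (basechange i (quot P)).
Proof. exact/prime_ring_basechange/prime_ring_so. Qed.

End Delta.

Lemma bc_isoZ (A B : algType k) (f : alg_iso A B) (s : ring_iso K K)
    (si : forall c, s (i c) = i c) y (w : basechange i A) :
  bc_iso f si (y *: w) = s y *: bc_iso f si w.
Proof.
move: w; apply: bc_additive_eq => [v w|v w|a z].
- by rewrite scalerDr rmorphD.
- by rewrite rmorphD scalerDr.
rewrite scale_bc_tensor [LHS](bc_fun_tensor f si) [bc_iso _ _ _](bc_fun_tensor f si).
by rewrite scale_bc_tensor rmorphM.
Qed.

Lemma bc_iso_sum (A B : algType k) (f : alg_iso A B) (s : ring_iso K K)
    (si : forall c, s (i c) = i c) (T : Type) (r : seq T) (F : T -> basechange i A) :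
  bc_iso f si (\sum_(t <- r) F t) = \sum_(t <- r) bc_iso f si (F t).
Proof. exact: rmorph_sum. Qed.

(** On orbit functions this is (x g).r = x.(g.r). *)
Lemma delta_r (P : spec_over rho I) g w :
  bc_iso (alg_iso_id (quot P)) (ff_r_const K g) (delta P w) =
  delta P (bc_iso (quot_alg_iso (gspec_stable I g)) (ff_r_const K g) w).
Proof.
have [s ->] := bc_in_sum_ex w; rewrite delta_sum [LHS]rmorph_sum bc_iso_sum delta_sum.
apply: eq_bigr => -[q y] _; rewrite bc_isoZ !deltaZ /=.
rewrite [LHS](bc_isoZ (alg_iso_id (quot P)) (ff_r_const K g)); congr (_ *: _).
have [r ->] := quot_ex q.
rewrite [bc_fun _ _ _](bc_fun_tensor _ (ff_r_const K g)) rmorph1 /=.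
rewrite (quot_funE (gspec_stable I g)).
have := regular_rep_iso (alg_iso_id (quot P)) (fun h x => reg_rE g h x) (delta_in P r).
move=> /regular_rep_uniq/(_ (delta_in P (rho g r))); apply=> x /=.
by rewrite act_funM.
Qed.

(** On orbit functions this is g.((g^-1 x).r) = x.r. *)
Lemma delta_l (P : spec_over rho I) g w :
  bc_iso (quot_alg_iso (f := act_iso rho g) (I := P) (J := spec_act g P) erefl)
    (ff_l_const K g) (delta P w) =
  delta (spec_act g P) (bc_iso (alg_iso_id U) (ff_l_const K g) w).
Proof.
have [s ->] := bc_in_sum_ex w; rewrite delta_sum [LHS]rmorph_sum bc_iso_sum delta_sum.
apply: eq_bigr => -[q y] _; rewrite bc_isoZ !deltaZ /=.
set f := quot_alg_iso (f := act_iso rho g) (I := P) (J := spec_act g P) erefl.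
rewrite [LHS](bc_isoZ f (ff_l_const K g)); congr (_ *: _).
have [r ->] := quot_ex q.
rewrite [bc_fun _ _ _](bc_fun_tensor _ (ff_l_const K g)) rmorph1 /=.
have := regular_rep_iso f (fun h x => reg_lE g h x) (delta_in P r).
move=> /regular_rep_uniq/(_ (delta_in (spec_act g P) r)); apply=> x.
rewrite [LHS](quot_funE (f := act_iso rho g) (J := spec_act g P) erefl) /=.
by rewrite -act_funM mulVKg.
Qed.

Definition spec_map_ideal :
    spec_over rho I -> proper_ideal (basechange i (extcentroid U)) :=
  contraction_proper (V := fun P : spec_over rho I => basechange i (quot P))
    prime_ring_extended delta_inj delta_surj.

Lemma spec_map_stable P g :
  bc_iso (ec_alg_iso (quot_alg_iso (gspec_stable I g))) (ff_r_const K g)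
    @` spec_map_ideal P = spec_map_ideal P.
Proof.
exact: (contraction_bc_image (f_ec := ec_alg_iso (quot_alg_iso (gspec_stable I g)))
  (fun=> erefl) (delta_r P g)).
Qed.

Definition spec_map P : stable_spec (TI_r K I) :=
  @StableSpec _ _ (TI_r K I) (spec_map_ideal P) (contraction_proper_prime _ _ _ P)
    (spec_map_stable P).

(** [TI_l] is built on the identity of the extended centroid, while naturality asks for the map
    induced by an automorphism of U. *)
Lemma ec_iso_idE (q : extcentroid U) : q = ec_iso (iso_id U) q.
Proof.
apply: ec_val_inj => /=; have [h ->] := amring_ex (ec_val q); rewrite am_funE.
exact: amclass_eq.
Qed.

Lemma spec_map_equivariant g P :
  bc_iso (alg_iso_id (extcentroid U)) (ff_l_const K g) @` spec_map_ideal P =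
  spec_map_ideal (spec_act g P).
Proof.
exact: (contraction_bc_image (f := alg_iso_id U)
  (f_ec := alg_iso_id (extcentroid U)) ec_iso_idE (delta_l P g)).
Qed.

Lemma bc_map_quot_eq0 (P : spec_over rho I) r :
  bc_map (to_quot P) (bc_in i r) = 0 <-> ideal_set P r.
Proof.
rewrite (bc_map_tensor i (@to_quot_linear P)).
split=> [/bc_tensor_eq0/(to_quot_eq0 P) //|/(to_quot_eq0 P) ->].
by rewrite bc_tensor0l.
Qed.

(** Inclusions of contractions amount to inclusions of kernels of the maps [delta], which [nabla]
    turns into inclusions of P (x) k(G) in P' (x) k(G). *)
Lemma spec_map_subset (P P' : spec_over rho I) :
  P `<=` P' <-> spec_map_ideal P `<=` spec_map_ideal P'.
Proof.
split=> [PP'|cPP' r Pr]; last first.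
  have := kernel_sub prime_ring_gspec (@prime_ring_extended P') (@delta_inj P')
    (@delta_surj P') cPP'.
  move=> /(_ (nabla (bc_in i r))); rewrite !delta_nabla => kerPP'.
  by apply/bc_map_quot_eq0/kerPP'/bc_map_quot_eq0.
apply: contraction_sub => w; have [v <-] := nabla_surj w.
rewrite !delta_nabla => dv.
pose f (q : quot P) : quot P' := to_quot P' (quot_repr q).
have fE r : f (to_quot P r) = to_quot P' r.
  by apply/esym/quotP/PP'/quot_reprP.
have fl : linear f.
  move=> a p q; have [r ->] := quot_ex p; have [s ->] := quot_ex q.
  by rewrite -to_quotZ -to_quotD !fE to_quotD to_quotZ.
have -> : bc_map (to_quot P') v = bc_map f (bc_map (to_quot P) v).
  move: (v); apply: bc_additive_eq.
  - exact: (bc_mapD (@to_quot_linear P')).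
  - by move=> x y; rewrite (bc_mapD (@to_quot_linear P)) (bc_mapD fl).
  move=> a y; rewrite (bc_map_tensor i (@to_quot_linear P')).
  by rewrite (bc_map_tensor i (@to_quot_linear P)) (bc_map_tensor i fl) fE.
by rewrite dv (linear_fun0 (bc_map_linear fl)).
Qed.

Lemma spec_over_eq (P P' : spec_over rho I) : P = P' :> set R -> P = P'.
Proof.
case: P P' => [[J iJ J1] primeJ capJ] [[J' iJ' J'1] primeJ' capJ'] /= e.
subst J'; rewrite (Prop_irrelevance iJ' iJ) (Prop_irrelevance J'1 J1) in primeJ' capJ' *.
by rewrite (Prop_irrelevance primeJ' primeJ) (Prop_irrelevance capJ' capJ).
Qed.

Lemma stable_spec_eq (V : nzRingType) (Y : Type) (phi : Y -> ring_iso V V)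
    (q q' : stable_spec phi) : q = q' :> set V -> q = q'.
Proof.
case: q q' => [[J iJ J1] primeJ stJ] [[J' iJ' J'1] primeJ' stJ'] /= e.
subst J'; rewrite (Prop_irrelevance iJ' iJ) (Prop_irrelevance J'1 J1) in primeJ' stJ' *.
by rewrite (Prop_irrelevance primeJ' primeJ) (Prop_irrelevance stJ' stJ).
Qed.

Lemma spec_map_inj (P P' : spec_over rho I) :
  spec_map_ideal P = spec_map_ideal P' :> set _ -> P = P'.
Proof.
move=> e; apply: spec_over_eq; apply/seteqP.
by split; apply/spec_map_subset; rewrite e.
Qed.

(** * Every stable prime of T comes from a prime of R *)

Section Surjectivity.
Variable q : proper_ideal (basechange i (extcentroid U)).
Hypothesis q_prime : is_prime q.
Hypothesis q_stable : forall g,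
  bc_iso (ec_alg_iso (quot_alg_iso (gspec_stable I g))) (ff_r_const K g) @` q = q.

Let iq : is_ideal (ideal_set q) := ideal_setP q.
Let q1 : ~ ideal_set q 1 := @ideal_set1 _ q.
Let qP : elt_prime (ideal_set q) := is_prime_elt q_prime.
Let Q : set W := extension (ideal_set q).
Let iQ : is_ideal Q := extension_ideal iq.
Let QP : elt_prime Q := extension_prime prime_ring_gspec iq q1 qP.
Let J : set (basechange i R) := [set w | Q (nabla w)].

Let iJ : is_ideal J.
Proof.
have [Q0 QD QM] := iQ; split.
- by rewrite -[J _]/(Q (nabla _)) nabla0.
- by move=> x y Jx Jy; rewrite -[J _]/(Q (nabla _)) nablaD; apply: QD.
move=> u x Jx; rewrite -[J (u * x)]/(Q (nabla _)) -[J (x * u)]/(Q (nabla _)).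
by rewrite !nablaM; apply: QM.
Qed.

Let J1 : ~ J 1.
Proof.
rewrite -[J _]/(Q (nabla _)) nabla1.
exact: (extension1 prime_ring_gspec iq q1 qP).
Qed.

(** On constant functions this is g.((x g)^-1.r) = x^-1.r. *)
Lemma nabla_r g w : nabla (bc_iso (alg_iso_id R) (ff_r_const K g) w) =
  bc_iso (quot_alg_iso (gspec_stable I g)) (ff_r_const K g) (nabla w).
Proof.
have [s ->] := bc_in_sum_ex w; rewrite nabla_sum !bc_iso_sum nabla_sum.
apply: eq_bigr => -[r y] _; rewrite !(bc_isoZ, nablaZ); congr (_ *: _).
rewrite [bc_iso (alg_iso_id R) _ _](bc_fun_tensor _ (ff_r_const K g)) rmorph1 /=.
have rep := nabla_regular (regular_rep_cst K r).
have := regular_rep_iso (quot_alg_iso (gspec_stable I g))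
  (fun h x => reg_rE g h x) rep.
move=> /(regular_rep_uniq rep); apply=> x.
rewrite [RHS](quot_funE (gspec_stable I g)) /=.
by rewrite -act_funM invgM mulVKg.
Qed.

Let J_stable g w : J w -> J (bc_iso (alg_iso_id R) (ff_r_const K g) w).
Proof.
rewrite -![J _]/(Q (nabla _)) nabla_r => Qw.
apply: (extension_bc_iso (f_ec := ec_alg_iso (quot_alg_iso (gspec_stable I g)))) => //.
by move=> t qt; rewrite -(q_stable g); exists t.
Qed.

Let P := descended_proper iJ J1.

Let PE r : ideal_set P r <-> Q (nabla (bc_in i r)).
Proof. by []. Qed.

Let P_prime : is_prime (ideal_set P).
Proof.
apply: elt_prime_is_prime; [exact: ideal_setP|exact: ideal_set1|].
move=> a b ab; apply: (@QP (nabla (bc_in i a)) (nabla (bc_in i b))) => w.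
have [v <-] := nabla_surj w.
have span (na nb : W) : (forall r, Q (na * nabla (bc_in i r) * nb)) ->
    Q (na * nabla v * nb).
  move=> nab; have [s ->] := bc_in_sum_ex v; rewrite nabla_sum mulr_sumr mulr_suml.
  apply: (is_ideal_sum iQ) => p _; rewrite nablaZ -scalerAr -scalerAl -mulr_algl.
  by have [_ _ QM] := iQ; have [] := QM p.2%:A _ (nab p.1).
by apply: span => r; rewrite -!nablaM -!bc_inM; apply: ab.
Qed.

Let P_cap : \bigcap_g act_iso rho g @` P = I.
Proof.
have PI r : ideal_set I r -> ideal_set P r.
  move=> Ir; apply/PE; have -> : nabla (bc_in i r) = 0; last by case: iQ.
  have := nabla_regular (regular_rep_cst K r).
  move=> /regular_rep_uniq/(_ (regular_rep0 K)); apply=> x.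
  by apply/(to_quot_eq0 I)/act_gspec.
apply/seteqP; split=> r; last first.
  move=> Ir g _; exists (rho g^-1%g r); last by rewrite /= act_invK.
  exact/PI/act_gspec.
move=> capr.
have {capr} Pr x : ideal_set P (rho x r).
  have [p Pp <-] := capr x^-1%g Logic.I.
  by rewrite /= act_invK.
(* The orbit function of r has all its values in P, so its element w lies in J; [nabla] sends w to
   the class of r in U, and Q meets U only in 0. *)
have [w wr] := orbit_regular r.
have Jw : J w.
  apply: (kernel_sub_descended (iJ := iJ) (J1 := J1)).
  have := regular_rep_map (f := to_quot P) _ wr.
  have tl : linear (to_quot P) by move=> a x y; rewrite linearP.
  move=> /(_ tl) /regular_rep_uniq/(_ (regular_rep0 K)); apply=> x.
  exact/(to_quot_eq0 P).
apply/(to_quot_eq0 I); apply: (extension_in prime_ring_gspec iq q1 qP).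
by move: Jw; rewrite -[J _]/(Q (nabla _)) (nabla_orbit wr).
Qed.

Lemma spec_map_surj : exists P, spec_map_ideal P = q :> set _.
Proof.
exists (SpecOver P_prime P_cap).
set P' := SpecOver P_prime P_cap.
(* Descent identifies J with P (x) k(G), which is the kernel of [delta] seen through [nabla]; and
   the contraction of Q is q. *)
have kerE w : delta P' w = 0 <-> Q w.
  have [v <-] := nabla_surj w; rewrite delta_nabla; split.
    exact: kernel_sub_descended.
  exact: (descended_sub_kernel iJ J1 J_stable).
rewrite -(contraction_extension prime_ring_gspec iq q1 qP).
apply/seteqP; split; apply: contraction_sub => w.
  by move=> /kerE Qw; apply/to_quot_eq0.
by move=> /to_quot_eq0 Qw; apply/kerE.
Qed.

End Surjectivity.

Lemma spec_map_bij : bijective spec_map.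
Proof.
have surj q : exists P, spec_map P = q.
  have [P Pq] := spec_map_surj (ss_prime q) (ss_stable q).
  by exists P; apply: stable_spec_eq.
have [c' c'P] := choice surj.
exists c' => [P|//]; apply: spec_map_inj.
have e := c'P (spec_map P).
have := congr1 (fun q : stable_spec (TI_r K I) => ideal_set (ss_ideal q)) e.
exact.
Qed.

Definition spec_map_heart (P : spec_over rho I) :
    alg_iso (extcentroid (quot (spec_map_ideal P)))
      (extcentroid (basechange i (quot P))) :=
  contraction_heart (V := fun P : spec_over rho I => basechange i (quot P))
    prime_ring_gspec prime_ring_extended delta_inj delta_surj P.

Lemma spec_map_heart_r P g z :
  spec_map_heart P (ec_iso (quot_iso (spec_map_stable P g)) z) =
  ec_iso (bc_iso (alg_iso_id (quot P)) (ff_r_const K g)) (spec_map_heart P z).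
Proof.
exact: (contraction_heart_natural (V := fun P : spec_over rho I => basechange i (quot P))
  (prV := prime_ring_extended) (d_inj := delta_inj) (d_surj := delta_surj)
  (f_ec := ec_alg_iso (quot_alg_iso (gspec_stable I g)))
  prime_ring_gspec (fun=> erefl) (delta_r P g) (spec_map_stable P g) z).
Qed.

Lemma spec_map_heart_l P g z :
  spec_map_heart (spec_act g P) (ec_iso (quot_iso (spec_map_equivariant g P)) z) =
  ec_iso (bc_iso (quot_alg_iso (f := act_iso rho g) (I := P) (J := spec_act g P) erefl)
    (ff_l_const K g)) (spec_map_heart P z).
Proof.
exact: (contraction_heart_natural (V := fun P : spec_over rho I => basechange i (quot P))
  (prV := prime_ring_extended) (d_inj := delta_inj) (d_surj := delta_surj)
  (f := alg_iso_id U) (f_ec := alg_iso_id (extcentroid U))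
  prime_ring_gspec ec_iso_idE (delta_l P g) (spec_map_equivariant g P) z).
Qed.

Lemma rational_prime_spec_map (P : spec_over rho I) :
  rational_prime P <-> inhabited (alg_iso (quot (spec_map_ideal P)) K^o).
Proof.
apply: (iff_trans
  (basechange_scalars (i := i) (@prime_ring_so P) (@prime_ring_extended P))).
exact: (contraction_scalars (V := fun P : spec_over rho I => basechange i (quot P))
  prime_ring_gspec prime_ring_extended delta_inj delta_surj P).
Qed.

End SpecBijection.

Theorem theorem9 (k : closedFieldType) (G : affine_group k)
    (Gconn : zariski_connected G) (K : function_field G)
    (R : algType k) (rho : alg_action G R) (rho_rational : rational_action rho)
    (I : gspec rho) :
  exists (c : spec_over rho I -> stable_spec (TI_r K I))
         (c_equivariant : forall (g : G) (P : spec_over rho I),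
            TI_l K I g @` c P = c (spec_act g P)),
    [/\ bijective c,
        forall P P' : spec_over rho I, P `<=` P' <-> c P `<=` c P',
        exists Psi : forall P : spec_over rho I,
            alg_iso (extcentroid (quot (c P))) (extcentroid (RPK K P)),
          (forall P (g : G) (z : extcentroid (quot (c P))),
             Psi P (ec_iso (quot_iso (ss_stable (c P) g)) z) =
             ec_iso (RPK_r K P g) (Psi P z)) /\
          (forall P (g : G) (z : extcentroid (quot (c P))),
             Psi (spec_act g P) (ec_iso (quot_iso (c_equivariant g P)) z) =
             ec_iso (RPK_l K P g) (Psi P z)) &
        forall P : spec_over rho I,
          rational_prime P <-> inhabited (alg_iso (quot (c P)) K^o)].
Proof.
exists (spec_map K rho_rational (I := I)).
exists (spec_map_equivariant K rho_rational (I := I)).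
split.
- exact: spec_map_bij.
- exact: spec_map_subset.
- exists (spec_map_heart K rho_rational (I := I)); split.
    exact: spec_map_heart_r.
  exact: spec_map_heart_l.
- exact: rational_prime_spec_map.
Qed.
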